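(* Let $k\ge 3$ be an integer. There exist $x_0\in[0,1]^{\mathcal T^L_k}$ and a real $\varepsilon>0$ with $B_\varepsilon(x_0)\subseteq[0,1]^{\mathcal T^L_k}$ such that for every $x\in B_\varepsilon(x_0)$ there exists a tournamenton $W$ with $t(T,W)=x_T$ for every $T\in\mathcal T^L_k$. Moreover, there exists a polynomial map $f:\mathbb R^{\mathcal T^L_k}\to\mathbb R^{\mathcal T_k}$ (i.e., each coordinate of $f$ is a real polynomial in the variables indexed by $\mathcal T^L_k$) such that for every tournamenton $W$, $$f\bigl((t(T,W))_{T\in\mathcal T^L_k}\bigr)=(t(T,W))_{T\in\mathcal T_k}.$$
   Context: A tournament is an orientation of a (finite) complete graph; tournaments are considered up to isomorphism, and $|T|$ is the number of vertices of $T$. The direct sum $T_1\oplus T_2$ is obtained from the disjoint union of tournaments $T_1$ and $T_2$ by adding all edges between them, directed from $T_1$ to $T_2$. The single-vertex tournament counts as strongly connected. Every tournament $T$ can be uniquely expressed as a direct sum $C_1\oplus\cdots\oplus C_m$ of strongly connected tournaments. Tournamentons and densities: a tournamenton is a measurable function $W:[0,1]^2\to[0,1]$ with $W(x,y)+W(y,x)=1$ for all $(x,y)\in[0,1]^2$. The density of a tournament $T$ in $W$ is $$t(T,W)=\int_{[0,1]^{V(T)}}\prod_{\overrightarrow{uv}\in E(T)}W(x_u,x_v)\,dx_{V(T)}.$$ Lyndon words: for a linearly ordered alphabet, words are compared in the lexicographic order (a proper prefix of a word is smaller than the word). A (non-empty) word is Lyndon if no proper (non-empty) suffix of it is lexicographically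 smaller than the word itself. Lyndon tournaments: let $\Sigma^T$ be the set of (isomorphism classes of) strongly connected tournaments, with a fixed linear order in which tournaments with fewer vertices precede those with more vertices and tournaments with the same number of vertices are ordered arbitrarily. For $T=C_1\oplus\cdots\oplus C_m$ with all $C_i$ strongly connected, let $w(T)$ be the word $C_1C_2\cdots C_m$ over $\Sigma^T$. The tournament $T$ is Lyndon if $w(T)$ is a Lyndon word. $\mathcal T_k$ is the set of all tournaments with at most $k$ vertices, and $\mathcal T^L_k$ is the set of all Lyndon tournaments with at least two and at most $k$ vertices. $B_\varepsilon(x)$ is the Euclidean $\varepsilon$-ball centered at $x$. *)

(* Defs.v *)
From HB Require Import structures.
From mathcomp Require Import all_boot all_order all_algebra all_fingroup.
From mathcomp Require Import generic_quotient.
Set Implicit Arguments.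
Unset Strict Implicit.
Unset Printing Implicit Defensive.
Import Order.TTheory GRing.Theory Num.Theory.

Local Open Scope ring_scope.

(* For x = y the condition says that there is no loop at x; for x != y it says
   that exactly one of (x, y) and (y, x) is an edge. *)
Definition is_tournament (n : nat) (E : {set 'I_n * 'I_n}) : bool :=
  [forall x, forall y, ((x, y) \in E) == (x != y) && ((y, x) \notin E)].

Record tournament (n : nat) := Tournament {
  edges : {set 'I_n * 'I_n};
  tournamentP : is_tournament edges }.

HB.instance Definition _ n := [isSub for @edges n].
HB.instance Definition _ n := [Finite of tournament n by <:].

Definition isomorphic (n : nat) (T1 T2 : tournament n) : bool :=
  [exists s : 'S_n, forall x, forall y,
     ((s x, s y) \in edges T2) == ((x, y) \in edges T1)].

Lemma isomorphic_refl n : reflexive (@isomorphic n).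
Proof.
move=> T; apply/existsP; exists 1%g.
by apply/forallP => x; apply/forallP => y; rewrite !perm1.
Qed.

Lemma isomorphic_sym n : symmetric (@isomorphic n).
Proof.
suff h T1 T2 : @isomorphic n T1 T2 -> isomorphic T2 T1.
  by move=> T1 T2; apply/idP/idP; exact: h.
case/existsP => s /forallP hs; apply/existsP; exists s^-1%g.
apply/forallP => x; apply/forallP => y.
by have /forallP/(_ (s^-1%g y)) := hs (s^-1%g x); rewrite !permKV eq_sym.
Qed.

Lemma isomorphic_trans n : transitive (@isomorphic n).
Proof.
move=> T2 T1 T3 /existsP[s /forallP hs] /existsP[t /forallP ht].
apply/existsP; exists (s * t)%g; apply/forallP => x; apply/forallP => y.
rewrite !permM; have /forallP/(_ (s y))/eqP -> := ht (s x).
by have /forallP/(_ y) := hs x.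
Qed.

Canonical isomorphic_equiv n :=
  EquivRel (@isomorphic n)
    (@isomorphic_refl n) (@isomorphic_sym n) (@isomorphic_trans n).

Definition tclass (n : nat) := {eq_quot @isomorphic n}%qT.

HB.instance Definition _ n := Choice.on (tclass n).
HB.instance Definition _ n := EqQuotient.on (tclass n).
HB.instance Definition _ n := Countable.copy (tclass n) (quot_type (tclass n)).
HB.instance Definition _ n :=
  isFinite.Build (tclass n) (pcan_enumP (can_pcan (@reprK _ (tclass n)))).

(* Tournaments up to isomorphism; Leibniz equality of their classes is
   isomorphism. *)
Definition tourn := {n : nat & tclass n}.

Definition tsize (T : tourn) : nat := tag T.

Definition is_edge (n : nat) (T : tournament n) : rel 'I_n :=
  fun x y => (x, y) \in edges T.

Definition strongly_connected (T : tourn) : bool :=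
  (0 < tsize T)%N &&
  [forall x, forall y, connect (is_edge (repr (tagged T))) x y].

Definition dsum_edges (m n : nat) (T1 : tournament m) (T2 : tournament n) :
    {set 'I_(m + n) * 'I_(m + n)} :=
  [set e : 'I_(m + n) * 'I_(m + n) |
     match split e.1, split e.2 with
           | inl x, inl y => (x, y) \in edges T1
           | inr x, inr y => (x, y) \in edges T2
           | inl _, inr _ => true
           | inr _, inl _ => false
           end].

Lemma dsum_edgesP m n (T1 : tournament m) (T2 : tournament n) :
  is_tournament (dsum_edges T1 T2).
Proof.
apply/forallP => x; apply/forallP => y; rewrite !inE /=.
rewrite -(inj_eq (can_inj (@splitK m n))).
case: (split x) => a; case: (split y) => b //=.
- by have /forallP/(_ a)/forallP/(_ b) := tournamentP T1.
- by have /forallP/(_ a)/forallP/(_ b) := tournamentP T2.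
Qed.

Definition dsum_tournament (m n : nat) (T1 : tournament m) (T2 : tournament n) :
  tournament (m + n) := Tournament (dsum_edgesP T1 T2).

Definition dsum (T1 T2 : tourn) : tourn :=
  Tagged tclass
    (\pi_(tclass (tsize T1 + tsize T2))
       (dsum_tournament (repr (tagged T1)) (repr (tagged T2))))%qT.

Lemma tournament0P : @is_tournament 0 set0.
Proof. by apply/forallP => -[]. Qed.

(* The tournament without vertices is only used as the empty direct sum. *)
Definition tourn0 : tourn :=
  Tagged tclass (\pi_(tclass 0) (Tournament tournament0P))%qT.

Definition letter := {C : tourn | strongly_connected C}.

(* le is a linear order in which fewer vertices come first; ties between letters
   with the same number of vertices are arbitrary. *)
Definition letter_order (le : rel letter) : Prop :=
  [/\ reflexive le, antisymmetric le, transitive le, total le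
    & forall C1 C2 : letter,
        (tsize (val C1) < tsize (val C2))%N -> le C1 C2].

(* A prefix of a word precedes it. *)
Fixpoint lexle (A : Type) (le : rel A) (u v : seq A) : bool :=
  match u, v with
  | [::], _ => true
  | _ :: _, [::] => false
  | a :: u', b :: v' => le a b && (le b a ==> lexle le u' v')
  end.

Definition lexlt (A : eqType) (le : rel A) (u v : seq A) : bool :=
  (u != v) && lexle le u v.

Definition lyndon_word (A : eqType) (le : rel A) (w : seq A) : Prop :=
  w <> [::] /\
  forall u v : seq A, w = u ++ v -> u <> [::] -> v <> [::] -> ~~ lexlt le v w.

(* The word w(T) is the unique w with T = \big[dsum/tourn0]_(C <- w) val C. *)
Definition lyndon (le : rel letter) (T : tourn) : Prop :=
  exists2 w : seq letter,
    T = \big[dsum/tourn0]_(C <- w) val C & lyndon_word le w.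

(* Classes of tournaments with at least 1 and at most k vertices; the vertex
   count of T is (tag T).+1. *)
Definition tourn_le (k : nat) := {i : 'I_k & tclass i.+1}.

Definition tourn_of (k : nat) (T : tourn_le k) : tourn :=
  existT tclass (tag T).+1 (tagged T).

HB.instance Definition _ k := Finite.on (tourn_le k).

From mathcomp Require Import all_classical all_reals all_analysis.
From mathcomp Require mpoly.
Import numFieldNormedType.Exports.
Local Open Scope classical_set_scope.

Definition lyndon_le (le : rel letter) (k : nat) :=
  {T : tourn_le k |
     (1 < tsize (tourn_of T))%N && `[< lyndon le (tourn_of T) >]}.

HB.instance Definition _ le k := Finite.on (lyndon_le le k).

Section tuple_lebesgue.
Context {R : realType}.

(* The n-fold power of the Lebesgue measure, i.e. Lebesgue measure on R^n. *)
Fixpoint tuple_lebesgue (n : nat) : set (n.-tuple R) -> \bar R :=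
  match n with
  | 0 => \d_[tuple]
  | m.+1 => pushforward (lebesgue_measure \x @tuple_lebesgue m)%E
              (fun p : R * m.-tuple R => [tuple of p.1 :: p.2])
  end.

Let pushforward_measure d d' (T : measurableType d) (U : measurableType d')
    (m : {measure set T -> \bar R}) (f : T -> U) (g : U -> T) :
  sigma_finite setT m -> measurable_fun setT f -> measurable_fun setT g -> cancel f g ->
  exists nu : {sigma_finite_measure set U -> \bar R}, pushforward m f = nu.
Proof.
move=> [F FT Ffin] mf mg fK.
pose nu_ := HB.pack_for {measure set U -> \bar R} (pushforward m f).
pose nu0 := nu_ mf.
have snu : sigma_finite setT nu0.
  exists (fun i => g @^-1` F i).
    by rewrite -preimage_bigcup -FT preimage_setT.
  move=> i; have [mF Foo] := Ffin i; split.
    by rewrite -[X in measurable X]setTI; exact: mg.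
  rewrite /nu0 /nu_ /= /pushforward -comp_preimage.
  by rewrite (_ : g \o f = id) //; apply/funext => p; exact: fK.
pose ps := Measure_isSigmaFinite.Build _ _ _ nu0 snu.
pose nu : {sigma_finite_measure set U -> \bar R} :=
  HB.pack (Measure.sort nu0) ps.
by exists nu.
Qed.

Let product_sigma_finite d d' (T : measurableType d) (U : measurableType d')
    (m1 : {sigma_finite_measure set T -> \bar R})
    (m2 : {sigma_finite_measure set U -> \bar R}) :
  sigma_finite setT (m1 \x m2)%E.
Proof.
have /sigma_finiteP[F [TF ndF Foo]] := sigma_finiteT m1.
have /sigma_finiteP[G [TG ndG Goo]] := sigma_finiteT m2.
exists (fun n => F n `*` G n).
  rewrite -setXTT TF TG predeqE => -[x y]; split.
    move=> [/= [n _ Fnx] [k _ Gky]]; exists (maxn n k) => //; split.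
    - by move: x Fnx; exact/subsetPset/ndF/leq_maxl.
    - by move: y Gky; exact/subsetPset/ndG/leq_maxr.
  by move=> [n _ []/= ? ?]; split; exists n.
move=> k; have [? ?] := Foo k; have [? ?] := Goo k.
split; first exact: measurableX.
by rewrite product_measure1E// lte_mul_pinfty// ge0_fin_numE.
Qed.

Let tuple_lebesgue_measure (n : nat) :
  exists nu : {sigma_finite_measure set (n.-tuple R) -> \bar R},
    @tuple_lebesgue n = nu.
Proof.
elim: n => [|n [mu /= ->]]; first by exists (\d_[tuple]).
apply: (@pushforward_measure _ _ _ _ (lebesgue_measure \x mu)%E _
  (fun t : n.+1.-tuple R => (thead t, [tuple of behead t]))).
- exact: product_sigma_finite.
- exact: measurable_cons.
- apply/measurable_fun_pairP; split; first exact: measurable_tnth.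
  exact: measurable_behead.
- by move=> [x t] /=; rewrite theadE; congr pair; exact: val_inj.
Qed.

Let tuple_lebesgue0 n : @tuple_lebesgue n set0 = 0%E.
Proof. by have [nu ->] := tuple_lebesgue_measure n; rewrite measure0. Qed.

Let tuple_lebesgue_ge0 n A : (0 <= @tuple_lebesgue n A)%E.
Proof. by have [nu ->] := tuple_lebesgue_measure n; exact: measure_ge0. Qed.

Let tuple_lebesgue_additive n : semi_sigma_additive (@tuple_lebesgue n).
Proof.
have [nu ->] := tuple_lebesgue_measure n.
exact: measure_semi_sigma_additive.
Qed.

HB.instance Definition _ n := isMeasure.Build _ _ _ (@tuple_lebesgue n)
  (@tuple_lebesgue0 n) (@tuple_lebesgue_ge0 n) (@tuple_lebesgue_additive n).

Let tuple_lebesgue_sigma_finite n : sigma_finite setT (@tuple_lebesgue n).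
Proof. by have [nu ->] := tuple_lebesgue_measure n; exact: sigma_finiteT. Qed.

HB.instance Definition _ n := Measure_isSigmaFinite.Build _ _ _
  (@tuple_lebesgue n) (@tuple_lebesgue_sigma_finite n).

End tuple_lebesgue.

(* Only the restriction of W to [0, 1]^2 matters; measurability is with respect
   to the Borel sigma-algebras. *)
Definition tournamenton (R : realType) (W : R * R -> R) : Prop :=
  [/\ measurable_fun ((`[0, 1] : set R) `*` (`[0, 1] : set R)) W,
      forall x y : R, 0 <= x <= 1 -> 0 <= y <= 1 -> 0 <= W (x, y) <= 1
    & forall x y : R, 0 <= x <= 1 -> 0 <= y <= 1 -> W (x, y) + W (y, x) = 1].

Definition unit_cube (R : realType) (n : nat) : set (n.-tuple R) :=
  [set x | forall i, 0 <= tnth x i <= 1].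
Arguments unit_cube : clear implicits.

Definition density (R : realType) (T : tourn) (W : R * R -> R) : R :=
  \int[@tuple_lebesgue R (tsize T)]_(x in unit_cube R (tsize T))
     \prod_(e in edges (repr (tagged T))) W (tnth x e.1, tnth x e.2).

Definition eball (R : realType) (I : finType) (x0 : {ffun I -> R}) (eps : R) :
    set {ffun I -> R} :=
  [set x | Num.sqrt (\sum_(i : I) (x i - x0 i) ^+ 2) < eps].

Definition icube (R : realType) (I : finType) : set {ffun I -> R} :=
  [set x | forall i, 0 <= x i <= 1].
Arguments icube : clear implicits.

(* Polynomials in variables indexed by I, the j-th variable being the one of
   index enum_val j. *)
Definition multipoly (R : realType) (I : finType) := mpoly.mpoly #|I| R.

Definition peval (R : realType) (I : finType) (p : multipoly R I)
    (x : {ffun I -> R}) : R :=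
  mpoly.meval (fun j : 'I_#|I| => x (enum_val j)) p.

(* Main.v *)
Require Import Defs.
From HB Require Import structures.
From mathcomp Require Import all_boot all_order all_algebra all_fingroup generic_quotient.
From mathcomp Require Import zify ring lra.
From mathcomp Require boolp.
Import Order.TTheory GRing.Theory Num.Theory.
Import Defs.
Set Implicit Arguments.
Unset Strict Implicit.
Unset Printing Implicit Defensive.
Local Open Scope ring_scope.

(** Both halves of the theorem come from the words of tournaments.  Write [T_w] for
    the direct sum of the letters of [w], and [t] for densities.

    Polynomials.  Since [W (x, y) + W (y, x) = 1], the product of two densities is
    the sum of the densities of all tournaments obtained from the disjoint union by
    orienting the cross pairs ([density_mul]).  If the two tournaments have words
    [u] and [v], such a tournament has fewer than [size u + size v] components, or
    else its word is a shuffle of [u] and [v] ([models_shuffle]).  A word [w] that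
    is not a Lyndon word splits as [u ++ v] with [v] at most every nonempty suffix
    of [u] ([non_lyndon_split]), and then [w] is the largest shuffle of [u] and [v]
    ([shuffle_max]).  So [t (T_w)] is a polynomial in densities of smaller
    tournaments, of tournaments with fewer components, and of those with a smaller
    word ([density_lyndon_polynomial]).

    Open set.  Consider step functions with values [M] on parts of measures [z],
    and form the series with coefficient [t (T_w)] at each word [w].  A strongly
    connected component cannot meet both halves of a direct sum of step functions,
    so direct sums become products of noncommutative series
    ([word_hom_kernel_sum]).  Truncated at some length, these series form a
    semigroup in a group of invertible matrices.  At a point where moving the
    weights [z] gives the tangent space of largest dimension, this tangent space,
    translated to the identity, contains all other translated tangent spaces and is
    stable under conjugation by the semigroup ([maximal_tangent]): otherwise a
    direct sum would have a larger one.  Differentiating conjugations shows that it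
    is a Lie algebra, and rescaling the weights that it is graded.  Modulo longer
    words it contains every single letter, because the densities of the strongly
    connected tournaments of a given size are linearly independent
    ([letter_independence]).  Hence it contains the iterated commutators along the
    standard factorizations of Lyndon words, and each of these has its Lyndon word
    as leading word ([lyndon_leading]).  By triangularity the differentials of
    the densities of Lyndon tournaments, the single vertex included, are linearly
    independent at this point ([lyndon_full_rank]).  A contraction argument gives
    all nearby values of these densities ([step_local_surjectivity]); prescribing
    the density of the single vertex, which is the total mass, allows to normalize
    the solution, and the normalized step function is a tournamenton with the
    wanted densities ([step_tournamenton]). *)

(** * Lexicographic order, Lyndon words and shuffles *)

Section Words.
Variables (A : eqType) (le : rel A).
Hypotheses (le_refl : reflexive le) (le_anti : antisymmetric le).
Hypotheses (le_trans : transitive le) (le_total : total le).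
Implicit Types (u v w x y s : seq A).

Lemma lexle_refl : reflexive (lexle le).
Proof. by elim=> //= a u ->; rewrite le_refl implybT. Qed.

Lemma lexle_cons a b u v : lexle le (a :: u) (b :: v) =
  (a != b) && le a b || (a == b) && lexle le u v.
Proof.
rewrite /=; case: (eqVneq a b) => [->|ab] /=; first by rewrite le_refl.
case lab: (le a b) => //=; case lba: (le b a) => //=.
by move: ab; rewrite (@le_anti a b) ?eqxx// lab.
Qed.

Arguments lexle : simpl never.

Lemma lexle_anti : antisymmetric (lexle le).
Proof.
elim=> [|a u ih] [|b v] // /andP[]; rewrite !lexle_cons.
case: (eqVneq a b) => [->|ab] /=.
  by move=> h1 h2; rewrite (ih v) // h1.
rewrite !orbF => h1 h2.
by move: ab; rewrite (@le_anti a b) ?eqxx// h1.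
Qed.

Lemma lexle_trans : transitive (lexle le).
Proof.
move=> v u; elim: u v => [|a u ih] [|b v] [|c w] //; rewrite !lexle_cons.
case: (eqVneq a b) => [->|ab] /=; case: (eqVneq b c) => [<-|bc] //=.
- exact: ih.
- by rewrite !orbF => -> _; rewrite ab.
- rewrite !orbF => h1 h2; rewrite (le_trans h1 h2) andbT.
  case: eqVneq => //= ac; move: ab.
  by rewrite (@le_anti a b) ?eqxx// h1 ac h2.
Qed.

Lemma lexle_total : total (lexle le).
Proof.
elim=> [|a u ih] [|b v] //; rewrite !lexle_cons eq_sym.
by case: (eqVneq b a) => [->|ab] /=; rewrite ?orbF //; exact: le_total.
Qed.

Lemma lexle_cat2l x u v : lexle le (x ++ u) (x ++ v) = lexle le u v.
Proof. by elim: x => //= a x ih; rewrite lexle_cons eqxx ih. Qed.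

(** Comparing two words is comparing their continuations, unless one word is a
    prefix of the other; the proofs below split along this line. *)
Lemma lexlt_prefix_or_decided x v : lexlt le x v ->
  (exists2 t, t != [::] & v = x ++ t) \/
  (forall y z, lexlt le (x ++ y) (v ++ z)).
Proof.
rewrite /lexlt; elim: x v => [|a x ih] [|b v] //.
- by move=> _; left; exists (b :: v).
- rewrite lexle_cons eqseq_cons; case: (eqVneq a b) => [->|ab] /=.
    move=> /ih [[t t0 ->]|h]; first by left; exists t.
    right=> y z; move: (h y z).
    by rewrite /= lexle_cons eqseq_cons eqxx.
  rewrite orbF => lab; right=> y z.
  by rewrite /= lexle_cons eqseq_cons (negbTE ab) /= lab.
Qed.

Lemma lexle_cat u u' v v' : size u = size u' ->
  lexle le u u' -> lexle le v v' -> lexle le (u ++ v) (u' ++ v').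
Proof.
move=> su luu' lvv'; case: (eqVneq u u') => [<-|nu]; first by rewrite lexle_cat2l.
have : lexlt le u u' by rewrite /lexlt nu.
case/lexlt_prefix_or_decided => [[t t0 E]|/(_ v v')/andP[]//].
by move: su t0; rewrite E size_cat; case: t {E} => //= a t; lia.
Qed.

Lemma lexltNge u v : lexlt le u v = ~~ lexle le v u.
Proof.
rewrite /lexlt; case: (eqVneq u v) => [->|uv] /=; first by rewrite lexle_refl.
apply/idP/idP => [luv|]; last by have := lexle_total u v => /orP[]// ->.
by apply: contra uv => lvu; rewrite (@lexle_anti u v) // luv.
Qed.

Lemma min_suffix w : w != [::] ->
  exists u v, [/\ w = u ++ v, v != [::] &
    forall x y, w = x ++ y -> y != [::] -> lexle le v y].
Proof.
elim: w => // a w ih _.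
have [->|w0] := eqVneq w [::].
  exists [::], [:: a]; split=> //= x y; case: x => [|b x] /=; first by move=> <-; rewrite lexle_refl.
  by case=> _; case: x; case: y.
have [u [v [wE v0 vmin]]] := ih w0.
have [lva|] := boolP (lexle le v (a :: w)).
  exists (a :: u), v; split=> //=; first by rewrite wE.
  by move=> [|b x] y /=; [move=> <- | case=> _; exact: vmin].
rewrite -lexltNge => /andP[_ law]; exists [::], (a :: w); split=> //.
move=> [|b x] y /=; first by move=> <-; rewrite lexle_refl.
by case=> _ E y0; apply: lexle_trans law (vmin _ _ E y0).
Qed.

Lemma lyndon_wordP w : lyndon_word le w <->
  w != [::] /\ forall u v, w = u ++ v -> v != [::] -> lexle le w v.
Proof.
split=> [[/eqP w0 h]|[w0 h]]; split=> //; last 2 first.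
- exact/eqP.
- by move=> u v E _ /eqP v0; rewrite lexltNge negbK; exact: h E v0.
move=> [|a u] v E v0; first by rewrite E lexle_refl.
by have := h _ _ E; rewrite lexltNge negbK; apply => //; exact/eqP.
Qed.

(** The standard factorization: cut a Lyndon word before its smallest proper
    suffix [v].  Suffixes of [v] are suffixes of the word, so [v] is a Lyndon
    word.  A suffix [y] of the rest [u] with [y < u] would have to be a prefix of
    [u], since otherwise [y ++ v] would be smaller than the word; cancelling this
    prefix produces a suffix smaller than [v]. *)
Lemma lyndon_factorization w : lyndon_word le w -> (1 < size w)%N ->
  exists u v, [/\ w = u ++ v, lyndon_word le u, lyndon_word le v
    & lexlt le (u ++ v) (v ++ u)].
Proof.
move=> /lyndon_wordP[w0 wL]; case: w => // a w' in w0 wL * => /= sw'.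
have w'0 : w' != [::] by rewrite -size_eq0 -lt0n.
have [u' [v [w'E v0 vmin]]] := min_suffix w'0.
have wE : a :: w' = (a :: u') ++ v by rewrite w'E.
have suf_lt x y : a :: w' = (a :: x) ++ y -> y != [::] -> lexlt le (a :: w') y.
  move=> E y0; rewrite /lexlt (wL _ _ E y0) andbT; apply/eqP => E'.
  by move: (congr1 size E); rewrite E' /= size_cat; lia.
exists (a :: u'), v; split=> //.
- apply/lyndon_wordP; split=> // -[|b x] y /=; first by move=> <-; rewrite lexle_refl.
  case=> _ uE y0.
  have [//|] := boolP (lexle le (a :: u') y); rewrite -lexltNge => yu.
  have := wL (a :: x) (y ++ v); rewrite w'E uE -catA => /(_ erefl).
  have -> : y ++ v != [::] by case: (y) y0.
  move=> /(_ isT) h.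
  case: (lexlt_prefix_or_decided yu) => [[t t0 E]|/(_ v v)]; last first.
    by rewrite lexltNge uE /= -catA h.
  move: h; have -> : a :: x ++ y ++ v = y ++ t ++ v.
    by rewrite [RHS]catA -E uE /= -catA.
  rewrite lexle_cat2l => h.
  have tE : a :: w' = (y ++ t) ++ v by rewrite wE E.
  have lvt : lexle le v (t ++ v).
    case: y y0 {yu} => [//|c y] y0 in E uE h tE *.
    apply: (vmin y); last by case: (t) t0.
    by move: tE; rewrite /= -catA => -[].
  have E2 := @lexle_anti _ _ (introT andP (conj lvt h)).
  by move: (congr1 size E2) t0; rewrite size_cat; case: (t) => //= c t1; lia.
- apply/lyndon_wordP; split=> // x y E y0; apply: (vmin (u' ++ x)) => //.
  by rewrite w'E E catA.
- rewrite -wE; have := suf_lt _ _ wE v0.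
  case/lexlt_prefix_or_decided => [[t t0 E]|/(_ [::] (a :: u'))]; last by rewrite cats0.
  by move: (congr1 size E); rewrite w'E /= !size_cat /=; lia.
Qed.

(** If a proper suffix beats the word, the smallest suffix [v] does; it then
    lies below every suffix of the rest of the word. *)
Lemma non_lyndon_split w : w != [::] -> ~ lyndon_word le w ->
  exists u v, [/\ w = u ++ v, u != [::], v != [::] &
    forall x y, u = x ++ y -> y != [::] -> lexle le v y].
Proof.
move=> w0 wNL; have [u [v [wE v0 vmin]]] := min_suffix w0.
exists u, v; split=> //.
  apply/negP => /eqP u0; apply: wNL; apply/lyndon_wordP; split=> // x y E y0.
  by rewrite {1}wE u0 /=; exact: vmin E y0.
move=> x y uE y0; have [//|] := boolP (lexle le v y); rewrite -lexltNge => yv.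
have h : lexle le v (y ++ v).
  by apply: (vmin x); [rewrite wE uE catA|case: (y) y0].
case: (lexlt_prefix_or_decided yv) => [[t t0 E]|/(_ v [::])]; last first.
  by rewrite cats0 lexltNge h.
move: h; rewrite [X in lexle _ X _]E lexle_cat2l => tv.
have vt : lexle le v t by apply: (vmin (u ++ y)) => //; rewrite wE {1}E catA.
have E2 := @lexle_anti _ _ (introT andP (conj tv vt)).
by move: (congr1 size E) y0; rewrite E2 size_cat; case: (y) => //= c y1 /eqP;
  rewrite -[X in X == _]add0n eqn_add2r.
Qed.

Inductive shuffle : seq A -> seq A -> seq A -> Prop :=
| Shuffle_nil : shuffle [::] [::] [::]
| Shuffle_l a x y s : shuffle x y s -> shuffle (a :: x) y (a :: s)
| Shuffle_r a x y s : shuffle x y s -> shuffle x (a :: y) (a :: s).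

Lemma shuffle_cat u v : shuffle u v (u ++ v).
Proof.
elim: u => [|a u ih] /=; last exact: Shuffle_l.
by elim: v => [|b v ih]; [exact: Shuffle_nil|exact: Shuffle_r].
Qed.

(** A common factor [c] may be moved in front of the smaller of two words
    without decreasing the best shuffle: a shuffle of [c ++ x] and [y] is a
    lattice path, and its mirror image spells the same word until [x] and [y]
    differ, where it gets the larger letter. *)
Lemma shuffle_exchange c x y s : lexle le y x -> shuffle (c ++ x) y s ->
  exists2 s', shuffle x (c ++ y) s' & lexle le s s'.
Proof.
move=> lyx; move E : (c ++ x) => cx sh.
elim: sh c x lyx E => {cx y s} [|a z y s sh ih|b z y s sh ih] c x lyx E.
- by case: c E => // /= ->; exists [::] => //; exact: Shuffle_nil.
- case: c E => [/= ->|a' c /= [-> E]].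
    by exists (a :: s); [exact: Shuffle_l|exact: lexle_refl].
  have [s' sh' ls] := ih c x lyx E.
  exists (a :: s'); first exact: Shuffle_r.
  by rewrite lexle_cons eqxx /= ls.
- case: x lyx E => [//|a x] lyx E.
  move: lyx; rewrite lexle_cons; case: (eqVneq b a) => [ba /= lyx|ba]; last first.
    rewrite orbF /= => lba; exists (a :: x ++ c ++ b :: y).
      by apply: Shuffle_l; exact: shuffle_cat.
    by rewrite lexle_cons ba lba.
  have [|s' sh' ls] := ih (rcons c a) x lyx; first by rewrite cat_rcons.
  move: sh'; rewrite cat_rcons => sh'.
  exists (a :: s'); first by rewrite ba; exact: Shuffle_l.
  by rewrite lexle_cons ba eqxx /= ls.
Qed.

(** When [v] lies below all suffixes of [u], the exchange lemma lets every
    letter of [u] go first. *)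
Lemma shuffle_max u v s :
  (forall x y, u = x ++ y -> y != [::] -> lexle le v y) ->
  shuffle u v s -> lexle le s (u ++ v).
Proof.
elim: u s => [|a u ih] s vmin sh.
  move E : [::] (sh) => u0 sh0; elim: sh0 E => //= b x y s' _ h E.
  by move: h; rewrite -E /= lexle_cons eqxx => ->.
have vau : lexle le v (a :: u) by exact: (vmin [::]).
have {ih} ih s' : shuffle u v s' -> lexle le (a :: s') (a :: u ++ v).
  move=> sh'; rewrite lexle_cons eqxx /=; apply: ih => // x y E.
  by apply: (vmin (a :: x)); rewrite E.
have le_s1 s' : shuffle (a :: u) v s' -> (exists t, s' = a :: t /\ shuffle u v t) \/
    exists b v' t, [/\ v = b :: v', s' = b :: t & shuffle (a :: u) v' t].
  move E : (a :: u) => au sh'; case: sh' E => //=.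
    by move=> a' x y t sh' [-> ->]; left; exists t.
  by move=> b x y t sh' _; right; exists b, y, t.
case: (le_s1 _ sh) => [[t [-> sh']]|[b [v' [t [vE -> sh']]]]]; first exact: ih.
move: vau; rewrite vE lexle_cons.
case: (eqVneq b a) => [ba /= lvu|ba]; last first.
  by rewrite orbF => /= lba; rewrite /= lexle_cons (negbTE ba) /= orbF.
have [s' sh2 ls] := @shuffle_exchange [:: a] u v' t lvu sh'.
apply: (@lexle_trans (a :: s')); first by rewrite lexle_cons ba eqxx ls.
by rewrite -vE; apply: ih; rewrite vE ba.
Qed.

End Words.

(** * Tournaments as induced substructures and their words *)

Definition edge (T : tourn) : rel 'I_(tsize T) := is_edge (repr (tagged T)).

Definition tournament_rel (V : finType) (e : rel V) :=
  forall x y, e x y = (x != y) && ~~ e y x.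

Lemma is_edge_tournament n (T : tournament n) : tournament_rel (is_edge T).
Proof.
by move=> x y; have /forallP/(_ x)/forallP/(_ y)/eqP := tournamentP T.
Qed.

Lemma edge_tournament T : tournament_rel (@edge T).
Proof. exact: is_edge_tournament. Qed.

Lemma repr_pi_perm n (T : tournament n) :
  exists s : 'S_n, forall x y,
    is_edge (repr (\pi_(tclass n) T)%qT) (s x) (s y) = is_edge T x y.
Proof.
have : isomorphic T (repr (\pi_(tclass n) T)%qT) by apply/eqmodP; rewrite reprK.
case/existsP => s /forallP h.
by exists s => x y; have /forallP/(_ y)/eqP := h x.
Qed.

Lemma tournament_of_rel n (e : rel 'I_n) : tournament_rel e ->
  is_tournament [set p | e p.1 p.2].
Proof.
by move=> he; apply/forallP => x; apply/forallP => y; rewrite !inE /= -he.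
Qed.

(** The subtournament induced on [A] is isomorphic to [T].  Stating this with an
    embedding keeps all pieces of a direct sum inside one vertex set. *)
Definition models (V : finType) (e : rel V) (A : {set V}) (T : tourn) :=
  exists g : 'I_(tsize T) -> V,
    [/\ injective g, A = [set g i | i : 'I_(tsize T)]
      & forall i j, e (g i) (g j) = edge i j].

Lemma models_self T : models (@edge T) [set: _] T.
Proof.
exists id; split=> //; apply/setP => x; rewrite inE; symmetry.
by apply/imsetP; exists x.
Qed.

Lemma card_models (V : finType) (e : rel V) A T : models e A T -> #|A| = tsize T.
Proof. by case=> g [gi -> _]; rewrite card_imset // card_ord. Qed.

Lemma models_uniq (V : finType) (e : rel V) A T1 T2 :
  models e A T1 -> models e A T2 -> T1 = T2.
Proof.
move=> m1 m2; have := card_models m1; rewrite (card_models m2).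
case: T1 m1 => n1 c1; case: T2 m2 => n2 c2; rewrite /tsize /= => m2 m1 E; subst n2.
case: m1 => g1 [gi1 A1 h1]; case: m2 => g2 [gi2 A2 h2].
rewrite /tsize /= in g1 g2 gi1 gi2 A1 A2 h1 h2 *.
have ex i : exists j, g2 j = g1 i.
  have : g1 i \in A by rewrite A1; apply/imsetP; exists i.
  by rewrite A2 => /imsetP[j _ ->]; exists j.
have [f fP] := boolp.choice ex.
have fi : injective f by move=> i j E; apply: gi1; rewrite -!fP E.
congr existT; rewrite -(reprK c1) -(reprK c2); apply/eqmodP.
apply/existsP; exists (perm fi); apply/forallP => x; apply/forallP => y.
rewrite !permE; apply/eqP; move: (h1 x y) (h2 (f x) (f y)); by rewrite !fP => -> /esym.
Qed.

Lemma models_exists (V : finType) (e : rel V) A :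
  tournament_rel e -> exists T, models e A T.
Proof.
move=> he; pose e' := [rel i j : 'I_#|A| | e (enum_val i) (enum_val j)].
have he' : tournament_rel e'.
  by move=> i j /=; rewrite he (inj_eq (@enum_val_inj _ A)).
pose T := Tournament (tournament_of_rel he').
have [s hs] := repr_pi_perm T.
exists (Tagged tclass (\pi_(tclass #|A|) T)%qT).
exists (fun i => enum_val ((s^-1)%g i)); split.
- by move=> i j /enum_val_inj/perm_inj.
- apply/setP => x; apply/idP/imsetP => [xA|[i _ ->]]; last exact: enum_valP.
  by exists (s (enum_rank_in xA x)) => //; rewrite permK enum_rankK_in.
- move=> i j; have := hs ((s^-1)%g i) ((s^-1)%g j); rewrite !permKV /edge /= => ->.
  by rewrite /is_edge inE.
Qed.

Definition dsum_rel m n (e1 : rel 'I_m) (e2 : rel 'I_n) : rel 'I_(m + n) :=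
  fun i j => match split i, split j with
             | inl x, inl y => e1 x y
             | inr x, inr y => e2 x y
             | inl _, inr _ => true
             | inr _, inl _ => false
             end.

Lemma edge_dsum T1 T2 : exists s : 'S_(tsize T1 + tsize T2),
  forall i j, @edge (dsum T1 T2) (s i) (s j) = dsum_rel (@edge T1) (@edge T2) i j.
Proof.
have [s hs] := repr_pi_perm (dsum_tournament (repr (tagged T1)) (repr (tagged T2))).
by exists s => i j; rewrite /edge hs /is_edge inE.
Qed.

Definition dominates (V : finType) (e : rel V) (A B : {set V}) :=
  forall x y, x \in A -> y \in B -> e x y.

Section Models.
Variables (V : finType) (e : rel V).
Hypothesis he : tournament_rel e.
Implicit Types (A B K : {set V}).

Lemma tournament_asym x y : e x y -> e y x -> False.
Proof. by rewrite he => /andP[_ /negP]. Qed.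

Lemma models_dsum A T1 T2 : models e A (dsum T1 T2) <->
  exists K, [/\ K \subset A, models e K T1, models e (A :\: K) T2
    & dominates e K (A :\: K)].
Proof.
have [s hs] := edge_dsum T1 T2; split.
- case=> g [gi -> hg].
  pose g1 x := g (s (lshift (tsize T2) x)); pose g2 x := g (s (rshift (tsize T1) x)).
  have g1i : injective g1 by move=> x y /gi/perm_inj/lshift_inj.
  have g2i : injective g2 by move=> x y /gi/perm_inj/rshift_inj.
  have AE : [set g i | i : 'I_(tsize (dsum T1 T2))] :\: [set g1 i | i : 'I_(tsize T1)]
      = [set g2 i | i : 'I_(tsize T2)].
    apply/setP => x; rewrite inE; apply/andP/imsetP.
      move=> [/imsetP xK /imsetP[i _ xE]]; rewrite xE.
      have : i = s ((s^-1)%g i) by rewrite permKV.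
      case: (split_ordP ((s^-1)%g i)) => j -> iE; last by exists j; rewrite ?iE.
      by case: xK; exists j; rewrite // xE iE.
    move=> [i _ ->]; split; last by apply/imsetP; exists (s (rshift (tsize T1) i)).
    apply/imsetP => -[j _ /gi/perm_inj/eqP].
    by rewrite eq_sym eq_lrshift.
  exists [set g1 i | i : 'I_(tsize T1)]; rewrite AE; split.
  + by apply/subsetP => _ /imsetP[i _ ->]; apply/imsetP; exists (s (lshift (tsize T2) i)).
  + exists g1; split=> // i j; rewrite hg hs /dsum_rel.
    by rewrite !(unsplitK (inl _)).
  + exists g2; split=> // i j; rewrite hg hs /dsum_rel.
    by rewrite !(unsplitK (inr _)).
  + move=> _ _ /imsetP[i _ ->] /imsetP[j _ ->]; rewrite hg hs /dsum_rel.
    by rewrite (unsplitK (inl _)) (unsplitK (inr _)).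
- case=> K [KA [g1 [g1i KE h1]] [g2 [g2i AE h2]] dom].
  pose g' (i : 'I_(tsize T1 + tsize T2)) :=
    match split i with inl x => g1 x | inr y => g2 y end.
  have g1K x : g1 x \in K by rewrite KE; apply/imsetP; exists x.
  have g2K x : g2 x \in A :\: K by rewrite AE; apply/imsetP; exists x.
  have ne x y : g1 x <> g2 y.
    by move=> E; have := g2K y; rewrite -E inE g1K.
  exists (fun i => g' ((s^-1)%g i)); split.
  + move=> i j; rewrite /g' => E; apply: (@perm_inj _ (s^-1)%g); move: E.
    case: (split_ordP ((s^-1)%g i)) => a ->; case: (split_ordP ((s^-1)%g j)) => b ->;
      rewrite ?(unsplitK (inl _)) ?(unsplitK (inr _)).
    * by move=> /g1i->.
    * by move/ne.
    * by move/esym/ne.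
    * by move=> /g2i->.
  + apply/setP => x; apply/idP/imsetP.
      move=> xA; have [xK|xK] := boolP (x \in K).
        move: (xK); rewrite KE => /imsetP[i _ ->].
        exists (s (lshift (tsize T2) i)) => //.
        by rewrite permK /g' (unsplitK (inl _)).
      have : x \in A :\: K by rewrite inE xK.
      rewrite AE => /imsetP[i _ ->]; exists (s (rshift (tsize T1) i)) => //.
      by rewrite permK /g' (unsplitK (inr _)).
    move=> [i _ ->]; rewrite /g'; case: split => [a|b]; last by have /setDP[] := g2K b.
    exact: (subsetP KA).
  + move=> i j; have := hs ((s^-1)%g i) ((s^-1)%g j); rewrite !permKV => ->.
    rewrite /g' /dsum_rel; case: split => a; case: split => b //.
      by apply: dom.
    by apply/negP => h; apply: (tournament_asym h); exact: dom.
Qed.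

Lemma models_set0 A T : models e A T -> (A == set0) = (tsize T == 0)%N.
Proof. by move=> /card_models <-; rewrite cards_eq0. Qed.

Definition word_tourn (w : seq letter) : tourn := \big[dsum/tourn0]_(C <- w) val C.

Lemma models_tourn0 A : models e A tourn0 <-> A = set0.
Proof.
split=> [m|->]; first by apply/eqP; rewrite (models_set0 m).
have [T mT] := models_exists set0 he.
suff <- : T = tourn0 by [].
have /esym := models_set0 mT; rewrite eqxx => /eqP.
case: T mT => -[|//] c mT _; congr existT; rewrite -(reprK c).
congr (\pi_(tclass 0) _)%qT; apply: val_inj => /=.
by apply/setP => -[[]].
Qed.

Lemma models_nil A : models e A (word_tourn [::]) <-> A = set0.
Proof. by rewrite /word_tourn big_nil; exact: models_tourn0. Qed.

Lemma models_cons A C w : models e A (word_tourn (C :: w)) <->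
  exists K, [/\ K \subset A, models e K (val C), models e (A :\: K) (word_tourn w)
    & dominates e K (A :\: K)].
Proof. by rewrite /word_tourn big_cons; exact: models_dsum. Qed.

Lemma models_word1 A C : models e A (word_tourn [:: C]) <-> models e A (val C).
Proof.
rewrite models_cons; split=> [[K [KA mK /models_nil AK _]]|mA].
  suff -> : A = K by [].
  by apply/eqP; rewrite eqEsubset KA andbT -setD_eq0 AK.
exists A; split=> //; first by apply/models_nil; rewrite setDv.
by move=> x y _; rewrite setDv inE.
Qed.

Lemma models_cat A K u v : K \subset A -> models e K (word_tourn u) ->
  models e (A :\: K) (word_tourn v) -> dominates e K (A :\: K) ->
  models e A (word_tourn (u ++ v)).
Proof.
elim: u A K => [|C u ih] A K KA /=.
  by move=> /models_nil ->; rewrite setD0.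
move=> /models_cons[B [BK mB mKB dB]] mv dK; apply/models_cons.
have DE : (A :\: B) :\: (K :\: B) = A :\: K.
  apply/setP => x; rewrite !inE; case xB: (x \in B) => //=.
  by rewrite (subsetP BK).
exists B; split=> //; first exact: subset_trans KA.
- apply: (ih _ (K :\: B)); rewrite ?DE //; first exact: setSD.
  by move=> x y /setDP[xK _] yA; exact: (dK x y).
- move=> x y xB /setDP[yA yB]; have [yK|yK] := boolP (y \in K).
    by apply: dB => //; rewrite inE yB.
  by apply: dK; [exact: (subsetP BK)|rewrite inE yK].
Qed.

Lemma letter_gt0 (C : letter) : (0 < tsize (val C))%N.
Proof. by have /andP[] := valP C. Qed.

Lemma models_letter_neq0 A (C : letter) : models e A (val C) -> exists x, x \in A.
Proof.
move=> m; apply/set0Pn; rewrite (models_set0 m) -lt0n; exact: letter_gt0.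
Qed.

Lemma path_crossing (U : finType) (r : rel U) (P : pred U) x y :
  connect r x y -> P x -> ~~ P y -> exists a b, [/\ P a, ~~ P b & r a b].
Proof.
case/connectP => p; elim: p x => [|z p ih] x /=; first by move=> _ -> ->.
case/andP=> rxz pz yE Px Py; have [Pz|Pz] := boolP (P z); first exact: (ih z).
by exists x, z.
Qed.

(** A path inside the component from a vertex outside [K] to a vertex in [K]
    would enter [K] by an edge, but the edges at the boundary of [K] leave it. *)
Lemma letter_cut A K (C : letter) : models e A (val C) ->
  dominates e K (A :\: K) -> A \subset K \/ [disjoint A & K].
Proof.
move=> [g [gi AE hg]] dom.
have [AK|/subsetPn[y yA yK]] := boolP (A \subset K); first by left.
right; apply/pred0P => x /=; apply/negbTE/negP => /andP[xA xK].
move: (xA) (yA); rewrite AE => /imsetP[i _ xE] /imsetP[j _ yE].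
have /andP[_ /forallP/(_ j)/forallP/(_ i) con] := valP C.
have [||a [b [aP bP rab]]] := path_crossing (P := fun i => g i \notin K) con.
- by rewrite -yE.
- by rewrite -xE negbK.
rewrite negbK in bP; rewrite -/(@edge (val C) a b) -hg in rab.
apply: (tournament_asym rab); apply: dom => //; rewrite inE aP AE.
by apply/imsetP; exists a.
Qed.

(** Initial cuts of a direct sum fall between its components. *)
Lemma models_cut A K u : models e A (word_tourn u) -> K \subset A ->
  dominates e K (A :\: K) ->
  exists u1 u2, [/\ u = u1 ++ u2, models e K (word_tourn u1)
    & models e (A :\: K) (word_tourn u2)].
Proof.
elim: u A K => [|C u ih] A K.
  move=> /models_nil ->; rewrite subset0 => /eqP -> _.
  by exists [::], [::]; rewrite setDv; split=> //; exact/models_nil.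
move=> mA KA dK; have /models_cons[B [BA mB mAB dB]] := mA.
have dKB : dominates e K (B :\: K).
  by move=> x y xK /setDP[yB yK]; apply: dK; rewrite // inE yK (subsetP BA).
case: (letter_cut mB dKB) => [BK|BK].
  have DE : (A :\: B) :\: (K :\: B) = A :\: K.
    apply/setP => x; rewrite !inE; case xB: (x \in B) => //=.
    by rewrite (subsetP BK).
  have [||u1 [u2 [-> m1 m2]]] := ih _ (K :\: B) mAB; first exact: setSD.
    by rewrite DE => x y /setDP[xK _]; exact: dK.
  exists (C :: u1), u2; split=> //; last by rewrite -DE.
  apply/models_cons; exists B; split=> // x y xB /setDP[yK yB].
  by apply: dB => //; rewrite inE yB (subsetP KA).
have K0 : K = set0.
  apply/eqP; rewrite -subset0; apply/subsetP => x xK.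
  have [y yB] := models_letter_neq0 mB.
  have xB : x \notin B by apply: contraL xK => /(disjointFr BK) ->.
  have yK : y \notin K by rewrite (disjointFr BK).
  case: (@tournament_asym x y).
    by apply: dK; rewrite // inE yK (subsetP BA).
  by apply: dB; rewrite // inE xB (subsetP KA).
exists [::], (C :: u); rewrite K0 setD0; split=> //; exact/models_nil.
Qed.

(** Splitting the vertices in two, each component of the whole meets each half
    in a run of consecutive components of that half.  Hence there are at most as
    many components as in the halves together, and in case of equality no two
    components have merged. *)
Lemma models_shuffle A B u v w : B \subset A ->
  models e B (word_tourn u) -> models e (A :\: B) (word_tourn v) ->
  models e A (word_tourn w) ->
  (size w <= size u + size v)%N /\
  (size w = (size u + size v)%N -> shuffle u v w).
Proof.
elim: w A B u v => [|C w ih] A B u v BA mu mv.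
  move=> /models_nil A0; move: BA mu mv; rewrite A0 subset0 => /eqP ->.
  rewrite setDv; case: u => [|a u].
    case: v => [|b v]; first by split=> // _; exact: Shuffle_nil.
    move=> _ /models_cons[K []]; rewrite subset0 => /eqP -> /models_letter_neq0[x].
    by rewrite inE.
  move=> /models_cons[K []]; rewrite subset0 => /eqP -> /models_letter_neq0[x].
  by rewrite inE.
move=> /models_cons[K [KA mK mAK dK]].
have [||u1 [u2 [uE mu1 mu2]]] := @models_cut B (B :&: K) u mu; first exact: subsetIl.
  move=> x y /setIP[_ xK]; rewrite !inE => /andP[+ yB]; rewrite yB => /= yK.
  by apply: dK; rewrite // inE yK (subsetP BA).
have [||v1 [v2 [vE mv1 mv2]]] := @models_cut (A :\: B) ((A :\: B) :&: K) v mv.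
- exact: subsetIl.
- move=> x y /setIP[_ xK]; rewrite !inE => /andP[+ /andP[yB yA]].
  by rewrite yB yA => /= yK; apply: dK; rewrite // inE yK.
have DB : B :\: B :&: K = B :\: K.
  by apply/setP => x; rewrite !inE; case: (x \in B); rewrite ?andbF ?andbT.
have DA : (A :\: B) :\: (A :\: B) :&: K = (A :\: K) :\: (B :\: K).
  apply/setP => x; rewrite !inE.
  by case: (x \in B); case: (x \in A); case: (x \in K).
have [||||h1 h2] := ih (A :\: K) (B :\: K) u2 v2 => //; first exact: setSD.
- by rewrite -DB.
- by rewrite -DA.
have [x xK] := models_letter_neq0 mK.
have nz : (0 < size u1 + size v1)%N.
  case: u1 uE mu1 => // uE /models_nil B0; case: v1 vE mv1 => // vE /models_nil A0.
  have xA := subsetP KA _ xK; move/setP/(_ x): A0; move/setP/(_ x): B0.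
  by rewrite !inE xK xA andbT => ->.
rewrite uE vE !size_cat /=; split; first by lia.
move=> E.
have {}E : (size u1 + size v1 = 1)%N /\ size w = (size u2 + size v2)%N by lia.
case: E => E1 /h2 sh.
have KE : K = (B :&: K) :|: ((A :\: B) :&: K).
  apply/setP => y; rewrite !inE; have := subsetP KA y.
  by case: (y \in K); case: (y \in B); rewrite ?andbF ?andbT //= => ->.
case: u1 v1 E1 {uE vE nz} mu1 mv1 => [|a [|//]] [|b [|//]] //= _.
  move=> /models_nil B0; move: KE; rewrite B0 set0U => <- /models_word1 mb.
  suff <- : b = C by exact: Shuffle_r.
  by apply: val_inj; exact: models_uniq mb mK.
move=> + /models_nil A0; move: KE; rewrite A0 setU0 => <- /models_word1 ma.
suff <- : a = C by exact: Shuffle_l.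
by apply: val_inj; exact: models_uniq ma mK.
Qed.

(** If [A] is not strongly connected, the vertices that can be reached from a
    suitable vertex are cut off from the others, which dominate them. *)
Lemma models_word_exists A : exists w, models e A (word_tourn w).
Proof.
move En : #|A| => n; elim: n {-2}n (leqnn n) A En => [|n ih] m mn A Am.
  exists [::]; apply/models_nil/eqP; rewrite -cards_eq0 Am; lia.
have [A0|A0] := eqVneq A set0; first by exists [::]; exact/models_nil.
have [T mT] := models_exists A he.
have [scT|] := boolP (strongly_connected T).
  by exists [:: exist _ T scT]; apply/models_word1.
rewrite negb_and -leqNgt leqn0 -(models_set0 mT) (negbTE A0) /=.
case/forallPn => i /forallPn[j nij]; have [g [gi AE hg]] := mT.
pose B := [set g y | y in connect (@edge T) i].
have BA : B \subset A.
  by apply/subsetP => x /imsetP[y _ ->]; rewrite AE; apply/imsetP; exists y.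
have giB : g i \in B by apply/imsetP; exists i => //; exact: connect0.
have gjA : g j \in A :\: B.
  rewrite inE AE; apply/andP; split; last by apply/imsetP; exists j.
  by apply: contra nij => /imsetP[y hy /gi ->].
have DB : A :\: (A :\: B) = B.
  apply/setP => x; rewrite !inE negb_and negbK.
  by case xB: (x \in B) => /=; [rewrite (subsetP BA)|case: (x \in A)].
have dom : dominates e (A :\: B) B.
  move=> x y /setDP[+ xB]; rewrite AE => /imsetP[a _ xE] /imsetP[b bB yE].
  rewrite he; apply/andP; split.
    by apply: contraNneq xB => ->; apply/imsetP; exists b.
  apply: contra xB; rewrite xE yE hg => ba; apply/imsetP; exists a => //.
  by apply: connect_trans bB _; exact: connect1.
have cB := cardsD A B; rewrite (setIidPr BA) in cB.
have : (0 < #|B|)%N by apply/card_gt0P; exists (g i).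
have := subset_leq_card BA.
have : (0 < #|A :\: B|)%N by apply/card_gt0P; exists (g j).
move=> p1 p2 p3.
have [|w1 m1] := ih #|A :\: B| _ (A :\: B) erefl; first by lia.
have [|w2 m2] := ih #|B| _ B erefl; first by lia.
exists (w1 ++ w2); apply: (@models_cat A (A :\: B)); rewrite ?DB //.
exact: subsetDl.
Qed.

End Models.

Lemma word_tourn_exists T : exists w, T = word_tourn w.
Proof.
have [w mw] := models_word_exists (@edge_tournament T) [set: _].
by exists w; exact: models_uniq (models_self T) mw.
Qed.

Lemma tsize_word_tourn w : tsize (word_tourn w) = (\sum_(C <- w) tsize (val C))%N.
Proof.
by rewrite /word_tourn; elim/big_rec2: _ => // C n T _ <-.
Qed.

(** * Densities in weighted step kernels *)

(** The density of [e] in the step function with values [M] on parts of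
    measures [z].  The total mass is arbitrary, and so is the ring: polynomial
    weights serve to differentiate. *)
Definition hom (K : comNzRingType) (U : finType) (M : U -> U -> K) (z : U -> K)
    (V : finType) (e : rel V) : K :=
  \sum_(f : {ffun V -> U})
     (\prod_v z (f v)) * \prod_x \prod_(y | e x y) M (f x) (f y).

Definition sum_rel (V1 V2 : finType) (e1 : rel V1) (e2 : rel V2) : rel (V1 + V2) :=
  fun a b => match a, b with
             | inl x, inl y => e1 x y
             | inr x, inr y => e2 x y
             | inl _, inr _ => true
             | inr _, inl _ => false
             end.

Section Hom.
Variable K : comNzRingType.

Section Basics.
Variables (U : finType) (M : U -> U -> K) (z : U -> K).

Lemma eq_hom (M' : U -> U -> K) z' (V : finType) (e : rel V) :
  M =2 M' -> z =1 z' -> hom M z e = hom M' z' e.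
Proof.
move=> EM Ez; apply: eq_bigr => f _; congr (_ * _).
  by apply: eq_bigr => v _; rewrite Ez.
by apply: eq_bigr => x _; apply: eq_bigr => y _; rewrite EM.
Qed.

Lemma hom_bij (V V' : finType) (e : rel V) (e' : rel V') (h : V -> V') :
  bijective h -> (forall x y, e' (h x) (h y) = e x y) -> hom M z e' = hom M z e.
Proof.
move=> [g hK gK] he; rewrite /hom.
rewrite (reindex (fun f : {ffun V -> U} => [ffun x => f (g x)])) /=; last first.
  exists (fun f : {ffun V' -> U} => [ffun x => f (h x)]) => f _;
    by apply/ffunP => x; rewrite !ffunE ?hK ?gK.
have bh : bijective h by exists g.
apply: eq_bigr => f _; congr (_ * _).
  by rewrite (reindex h (onW_bij _ bh)) /=; apply: eq_bigr => x _; rewrite ffunE hK.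
rewrite (reindex h (onW_bij _ bh)) /=; apply: eq_bigr => x _.
rewrite (reindex h (onW_bij _ bh)) /=; apply: eq_big => [y|y _]; first exact: he.
by rewrite !ffunE !hK.
Qed.

(** Once the first summand has been placed, its edges to the second summand only
    modify the weights that the second summand sees. *)
Lemma hom_sum_rel (V1 V2 : finType) (e1 : rel V1) (e2 : rel V2) :
  hom M z (sum_rel e1 e2) =
  \sum_(f : {ffun V1 -> U})
    (\prod_v z (f v)) * (\prod_x \prod_(y | e1 x y) M (f x) (f y)) *
    hom M (fun u => z u * \prod_x M (f x) u) e2.
Proof.
pose glue (p : {ffun V1 -> U} * {ffun V2 -> U}) : {ffun (V1 + V2)%type -> U} :=
  [ffun a => match a with inl x => p.1 x | inr y => p.2 y end].
rewrite /hom (reindex glue) /=; last first.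
  exists (fun f => ([ffun x => f (inl x)], [ffun x => f (inr x)])).
    by move=> [f1 f2] _; congr pair; apply/ffunP => x; rewrite !ffunE.
  by move=> f _; apply/ffunP => -[x|x]; rewrite !ffunE.
under [RHS]eq_bigr => f1 _ do rewrite big_distrr /=.
rewrite pair_big /=; apply: eq_bigr => -[f1 f2] _ /=.
rewrite !big_sumType /=.
have -> : \prod_(v : V1) z (glue (f1, f2) (inl v)) = \prod_v z (f1 v).
  by apply: eq_bigr => v _; rewrite ffunE.
have -> : \prod_(v : V2) z (glue (f1, f2) (inr v)) = \prod_v z (f2 v).
  by apply: eq_bigr => v _; rewrite ffunE.
have -> : \prod_(x : V1) \prod_(y | sum_rel e1 e2 (inl x) y)
      M (glue (f1, f2) (inl x)) (glue (f1, f2) y) =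
    (\prod_x \prod_(y | e1 x y) M (f1 x) (f1 y)) * \prod_y \prod_x M (f1 x) (f2 y).
  rewrite [X in _ = _ * X]exchange_big -big_split /=; apply: eq_bigr => x _.
  rewrite big_sumType /=; congr (_ * _); apply: eq_bigr => y _; by rewrite !ffunE.
have -> : \prod_(x : V2) \prod_(y | sum_rel e1 e2 (inr x) y)
      M (glue (f1, f2) (inr x)) (glue (f1, f2) y) =
    \prod_x \prod_(y | e2 x y) M (f2 x) (f2 y).
  apply: eq_bigr => x _; rewrite big_sumType /= big_pred0_eq mul1r.
  by apply: eq_bigr => y _; rewrite !ffunE.
by rewrite [in RHS]big_split /=; ring.
Qed.

Lemma hom_dsum T1 T2 : hom M z (@edge (dsum T1 T2)) =
  hom M z (sum_rel (@edge T1) (@edge T2)).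
Proof.
have [s hs] := edge_dsum T1 T2.
have sb : bijective s by exists (s^-1)%g; [exact: permK|exact: permKV].
rewrite (hom_bij sb hs); symmetry; apply: (@hom_bij _ _ _ _ (@split _ _)).
  by exists (@unsplit _ _); [exact: splitK|exact: unsplitK].
by [].
Qed.

Lemma hom_set0 (V : finType) (e : rel V) : #|V| = 0%N -> hom M z e = 1.
Proof.
move=> V0; rewrite /hom (big_pred1 (ffun0 V0 : {ffun V -> U})) => [|f /=]; last first.
  by apply/esym/eqP/ffunP => x; have /card0_eq/(_ x) := V0.
have noV (x : V) : False by have /card0_eq/(_ x) := V0.
by rewrite !big1 ?mulr1 // => x; case: (noV x).
Qed.

Lemma hom_scale (V : finType) (e : rel V) s :
  hom M (fun u => s * z u) e = s ^+ #|V| * hom M z e.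
Proof.
rewrite /hom big_distrr /=; apply: eq_bigr => f _.
by rewrite big_split /= prodr_const mulrA.
Qed.

Definition word_hom (w : seq letter) := hom M z (@edge (word_tourn w)).

Lemma word_hom_nil : word_hom [::] = 1.
Proof. by apply: hom_set0; rewrite card_ord tsize_word_tourn big_nil. Qed.

End Basics.

Lemma word_hom_cons (U : finType) (M : U -> U -> K) (z : U -> K) C w : word_hom M z (C :: w) =
  \sum_(f : {ffun 'I_(tsize (val C)) -> U})
    (\prod_v z (f v)) * (\prod_x \prod_(y | @edge (val C) x y) M (f x) (f y)) *
    word_hom M (fun u => z u * \prod_x M (f x) u) w.
Proof. by rewrite /word_hom /word_tourn big_cons hom_dsum hom_sum_rel. Qed.

Lemma word_hom_weight0 (U : finType) (M : U -> U -> K) w :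
  word_hom M (fun=> 0) w = (w == [::])%:R.
Proof.
case: w => [|C w]; first by rewrite word_hom_nil.
rewrite word_hom_cons big1 //= => f _.
by rewrite (bigD1 (Ordinal (letter_gt0 C))) //= !mul0r.
Qed.

Definition kernel_sum (U1 U2 : finType) (M1 : U1 -> U1 -> K) (M2 : U2 -> U2 -> K)
    (a b : U1 + U2) : K :=
  match a, b with
  | inl x, inl y => M1 x y
  | inr x, inr y => M2 x y
  | inl _, inr _ => 1
  | inr _, inl _ => 0
  end.

Definition weight_sum (U1 U2 : finType) (z1 : U1 -> K) (z2 : U2 -> K) (a : U1 + U2) : K :=
  match a with inl x => z1 x | inr y => z2 y end.

(** Maps from a nonempty set to a disjoint union that do not stay in one of the
    parts contribute nothing. *)
Lemma sum_ffun_sum (V U1 U2 : finType) (v0 : V) (F : {ffun V -> (U1 + U2)%type} -> K) :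
  (forall (f : {ffun V -> (U1 + U2)%type}) x y a b, f x = inl a -> f y = inr b -> F f = 0) ->
  \sum_f F f = \sum_(g : {ffun V -> U1}) F [ffun x => inl (g x)] +
               \sum_(g : {ffun V -> U2}) F [ffun x => inr (g x)].
Proof.
move=> F0.
pose L (g : {ffun V -> U1}) : {ffun V -> (U1 + U2)%type} := [ffun x => inl (g x)].
pose R (g : {ffun V -> U2}) : {ffun V -> (U1 + U2)%type} := [ffun x => inr (g x)].
have Li : injective L.
  by move=> g g' /ffunP E; apply/ffunP => x; have := E x; rewrite !ffunE => -[].
have Ri : injective R.
  by move=> g g' /ffunP E; apply/ffunP => x; have := E x; rewrite !ffunE => -[].
rewrite (bigID (mem [set L g | g : {ffun V -> U1}])) /=; congr (_ + _).
  by rewrite big_imset /=; [apply: eq_bigl => g; rewrite inE|move=> ? ? _ _ /Li].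
rewrite (bigID (mem [set R g | g : {ffun V -> U2}])) /= [X in _ + X]big1 ?addr0.
  rewrite (eq_bigl (mem [set R g | g : {ffun V -> U2}])).
    by rewrite big_imset /=; [apply: eq_bigl => g; rewrite inE|move=> ? ? _ _ /Ri].
  move=> f; rewrite inE /= andbC; case: imsetP => //= -[g _ ->].
  by apply/negP => /imsetP[g' _ /ffunP/(_ v0)]; rewrite !ffunE.
move=> f /andP[/negP nL /negP nR].
have [/forallP al|] := boolP [forall x, if f x is inl _ then true else false].
  case: nL; have : forall x, exists a, f x = inl a.
    by move=> x; have := al x; case: (f x) => // a _; exists a.
  case/fin_all_exists => g gE; apply/imsetP; exists [ffun x => g x] => //.
  by apply/ffunP => x; rewrite !ffunE.
case/forallPn => y; case fy: (f y) => [//|b] _.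
have [/forallP al|] := boolP [forall x, if f x is inr _ then true else false].
  case: nR; have : forall x, exists a, f x = inr a.
    by move=> x; have := al x; case: (f x) => // a _; exists a.
  case/fin_all_exists => g gE; apply/imsetP; exists [ffun x => g x] => //.
  by apply/ffunP => x; rewrite !ffunE.
by case/forallPn => x; case fx: (f x) => [a|//] _; apply: F0 fx fy.
Qed.

(** A word embeds in a direct sum by putting a prefix in the first summand and
    the rest in the second one: a strongly connected component cannot meet both
    summands. *)
Lemma word_hom_kernel_sum (U1 U2 : finType) (M1 : U1 -> U1 -> K) (M2 : U2 -> U2 -> K)
    z1 z2 w :
  word_hom (kernel_sum M1 M2) (weight_sum z1 z2) w =
  \sum_(i < (size w).+1) word_hom M1 z1 (take i w) * word_hom M2 z2 (drop i w).
Proof.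
elim: w z1 z2 => [|C w ih] z1 z2.
  by rewrite big_ord1 /= !word_hom_nil mulr1.
have v0 : 'I_(tsize (val C)) := Ordinal (letter_gt0 C).
rewrite word_hom_cons big_ord_recl [take 0 _]/= word_hom_nil mul1r addrC.
rewrite (sum_ffun_sum v0); last first.
  move=> f x y a b fx fy.
  have /andP[_ /forallP/(_ y)/forallP/(_ x) con] := valP C.
  have [||c [d [fc fd ecd]]] :=
      path_crossing (P := fun i => if f i is inr _ then true else false) con.
  - by rewrite fy.
  - by rewrite fx.
  rewrite -/(@edge (val C) c d) in ecd.
  rewrite [X in _ * X * _](bigD1 c) //= [X in _ * (X * _) * _](bigD1 d) //=.
  by case: (f c) fc => // c' _; case: (f d) fd => //= d' _; rewrite !(mul0r, mulr0).
congr (_ + _).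
  under [RHS]eq_bigr => i _ do rewrite /= word_hom_cons big_distrl /=.
  rewrite exchange_big /=; apply: eq_bigr => g _.
  under [RHS]eq_bigr => i _ do rewrite -mulrA.
  rewrite -big_distrr -ih /=; congr (_ * _ * _).
  - by apply: eq_bigr => v _; rewrite ffunE.
  - by apply: eq_bigr => x _; apply: eq_bigr => y _; rewrite !ffunE.
  - apply: eq_hom => // -[u|u] /=; last first.
      by rewrite big1 ?mulr1 // => x _; rewrite ffunE.
    by congr (_ * _); apply: eq_bigr => x _; rewrite ffunE.
rewrite /= word_hom_cons; apply: eq_bigr => g _; congr (_ * _ * _).
- by apply: eq_bigr => v _; rewrite ffunE.
- by apply: eq_bigr => x _; apply: eq_bigr => y _; rewrite !ffunE.
- transitivity (word_hom (kernel_sum M1 M2)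
    (weight_sum (fun=> 0) (fun u => z2 u * \prod_x M2 (g x) u)) w).
    apply: eq_hom => // -[u|u] /=.
      by rewrite (bigD1 v0) //= ffunE mul0r mulr0.
    by congr (_ * _); apply: eq_bigr => x _; rewrite ffunE.
  rewrite ih big_ord_recl take0 drop0 word_hom_weight0 eqxx mul1r.
  rewrite big1 ?addr0 // => i _; rewrite word_hom_weight0.
  suff -> : (take (lift ord0 i) w == [::]) = false by rewrite mul0r.
  by apply/negbTE; rewrite -size_eq0 size_takel //=; have := ltn_ord i; rewrite /bump; lia.
Qed.

End Hom.

Lemma hom_rmorph (K L : comNzRingType) (phi : {rmorphism K -> L}) (U : finType) M
    (z : U -> K) (V : finType) (e : rel V) :
  phi (hom M z e) = hom (fun a b => phi (M a b)) (phi \o z) e.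
Proof.
rewrite /hom rmorph_sum; apply: eq_bigr => f _; rewrite rmorphM !rmorph_prod.
by congr (_ * _); apply: eq_bigr => x _; rewrite rmorph_prod.
Qed.

(** * Truncated noncommutative power series as matrices *)

Section Series.
Variables (A : finType) (k : nat).

Definition conv (K : pzSemiRingType) (a b : seq A -> K) (w : seq A) : K :=
  \sum_(i < (size w).+1) a (take i w) * b (drop i w).

Definition unit_series (K : pzSemiRingType) (w : seq A) : K := (w == [::])%:R.

Local Notation X := (k.-bseq A).

(** Multiplication by the series [a] on the words of length at most [k]; this
    represents the series truncated beyond length [k]. *)
Definition toep (K : pzSemiRingType) (a : seq A -> K) : 'M[K]_#|{: X}| :=
  \matrix_(i, j)
    if prefix (enum_val i : X) (enum_val j : X) then
      a (drop (size (enum_val i : X)) (enum_val j : X)) else 0.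

Definition coef (K : pzSemiRingType) (m : 'M[K]_#|{: X}|) (w : seq A) : K :=
  m (enum_rank [bseq]) (enum_rank (insub_bseq k w)).

Section Ring.
Variable K : comNzRingType.
Implicit Types (a b c : seq A -> K).

Lemma coef_toep a w : (size w <= k)%N -> coef (toep a) w = a w.
Proof.
move=> sw; rewrite /coef mxE !enum_rankK prefix0s drop0 /insub_bseq /insubd.
by rewrite insubT.
Qed.

Lemma eq_toep a b : (forall w, (size w <= k)%N -> a w = b w) -> toep a = toep b.
Proof.
move=> E; apply/matrixP => i j; rewrite !mxE; case: ifP => // _.
by apply: E; rewrite size_drop (leq_trans (leq_subr _ _)) // size_bseq.
Qed.

Lemma toep_linear x a b : toep (fun w => x * a w + b w) = x *: toep a + toep b.
Proof. by apply/matrixP => i j; rewrite !mxE; case: ifP => // _; rewrite mulr0 addr0. Qed.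

Lemma toepB a b : toep (fun w => a w - b w) = toep a - toep b.
Proof. by apply/matrixP => i j; rewrite !mxE; case: ifP => // _; rewrite subr0. Qed.

Lemma toep_sum n (F : 'I_n -> seq A -> K) :
  toep (fun w => \sum_i F i w) = \sum_i toep (F i).
Proof.
apply/matrixP => i j; rewrite summxE mxE; case: ifP => pij.
  by apply: eq_bigr => l _; rewrite mxE pij.
by rewrite big1 // => l _; rewrite mxE pij.
Qed.

Lemma toep1 : toep (@unit_series K) = 1%:M.
Proof.
apply/matrixP => i j; rewrite !mxE /unit_series.
have [<-|ij] := eqVneq i j; first by rewrite prefix_refl drop_size eqxx.
case: prefixP => //= -[t E]; rewrite E drop_size_cat //.
case: t E => //= E; case/eqP: ij; apply: enum_val_inj; apply: val_inj => /=.
by rewrite E cats0.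
Qed.

Lemma toepM a b : toep (conv a b) = toep a *m toep b.
Proof.
apply/matrixP => i j; rewrite !mxE.
set x : X := enum_val i; set w : X := enum_val j.
transitivity (\sum_(y : X | prefix x y && prefix y w)
    a (drop (size x) y) * b (drop (size y) w)); last first.
  rewrite big_mkcond /= big_enum_val /=; apply: eq_bigr => l _.
  rewrite !mxE -/x -/w; case: ifP => [/andP[-> ->] //|].
  by case: ifP => // _; case: ifP => // _; rewrite ?mul0r ?mulr0.
case: prefixP => [[t wE]|nxw]; last first.
  rewrite big_pred0 // => y; apply/negP => /andP[h1 h2]; apply: nxw.
  exact/prefixP/(prefix_trans h1 h2).
have sw : (size x + size t <= k)%N by rewrite -size_cat -wE size_bseq.
have st (l : 'I_(size t).+1) : (size (x ++ take l t) <= k)%N.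
  rewrite size_cat; apply: leq_trans sw; rewrite leq_add2l size_take_min.
  exact: geq_minr.
pose h (l : 'I_(size t).+1) : X := Bseq (st l).
rewrite wE drop_size_cat // /conv.
rewrite (reindex_onto h (fun y : X => inord (size y - size x))) /=; last first.
  move=> y /andP[/prefixP[p yE] /prefixP[q]]; rewrite yE -catA => /eqP.
  rewrite eqseq_cat // eqxx /= => /eqP tE; apply: val_inj => /=.
  rewrite yE size_cat addKn inordK; last by rewrite tE size_cat ltnS leq_addr.
  by rewrite tE take_size_cat.
have sz (l : 'I_(size t).+1) : size (take l t) = l.
  by rewrite size_takel // -ltnS ltn_ord.
apply: eq_big => [l|l _].
  rewrite prefix_prefix prefix_catr // eqxx prefix_take /=.
  by rewrite size_cat addKn sz inord_val eqxx.
rewrite drop_size_cat // size_cat sz.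
by rewrite addnC -drop_drop drop_size_cat.
Qed.

Definition conv_pow a n := iter n (conv a) (@unit_series K).

Lemma conv_pow_small a n w : a [::] = 0 -> (size w < n)%N -> conv_pow a n w = 0.
Proof.
move=> a0; elim: n w => // n ih w sw; rewrite /conv_pow /= /conv big1 // => i _.
case: (posnP i) => [->|i0]; first by rewrite take0 a0 mul0r.
by rewrite -/(conv_pow a n) ih ?mulr0 // size_drop; have := ltn_ord i; lia.
Qed.

Lemma toep_pow a n : toep (conv_pow a n) = toep a ^+ n.
Proof.
elim: n => [|n ih]; first by rewrite toep1.
by rewrite /conv_pow /= toepM -/(conv_pow a n) ih exprS.
Qed.

(** Geometric series: a series with constant term 1 is invertible. *)
Lemma toep_inv a : a [::] = 1 ->
  exists b, [/\ b [::] = 1, toep a *m toep b = 1%:M & toep b *m toep a = 1%:M].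
Proof.
move=> a1; pose c w := unit_series K w - a w.
have c0 : c [::] = 0 by rewrite /c /unit_series a1 eqxx subrr.
exists (fun w => \sum_(i < k.+1) conv_pow c i w).
have cE : toep a = 1 - toep c by rewrite /c toepB toep1 opprB addrC subrK.
have nil : toep c ^+ k.+1 = 0.
  rewrite -toep_pow; apply/matrixP => i j; rewrite !mxE; case: ifP => // _.
  by rewrite conv_pow_small // ltnS size_drop (leq_trans (leq_subr _ _)) // size_bseq.
have E : toep (fun w => \sum_(i < k.+1) conv_pow c i w) = \sum_(i < k.+1) toep c ^+ i.
  by rewrite toep_sum; apply: eq_bigr => i _; rewrite toep_pow.
rewrite E cE; split.
- rewrite big_ord_recl big1 ?addr0 // => i _.
  by rewrite /conv_pow /= /conv big_ord1 /= c0 mul0r.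
- have := subrX1 (toep c) k.+1; rewrite nil sub0r => /(congr1 -%R).
  by rewrite opprK -mulNr opprB.
- have : GRing.comm (toep c) (\sum_(i < k.+1) toep c ^+ i).
    by apply: commr_sum => i _; apply: commrX.
  move=> com; have := subrX1 (toep c) k.+1; rewrite nil sub0r => /(congr1 -%R).
  rewrite opprK -mulNr opprB => E1; rewrite [RHS]E1.
  by rewrite -[LHS]/(_ * _) mulrBr mulr1 mulrBl mul1r com.
Qed.

End Ring.

Lemma map_toep (K L : comNzRingType) (phi : K -> L) (a : seq A -> K) : phi 0 = 0 ->
  map_mx phi (toep a) = toep (phi \o a).
Proof. by move=> p0; apply/matrixP => i j; rewrite !mxE; case: ifP. Qed.

(** ** Leading words *)

Section Leading.
Variables (deg : A -> nat) (le : rel A).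
Hypothesis deg_gt0 : forall x, (0 < deg x)%N.
Hypotheses (le_refl : reflexive le) (le_anti : antisymmetric le).
Hypotheses (le_trans : transitive le) (le_total : total le).

Definition word_deg (w : seq A) := (\sum_(x <- w) deg x)%N.

Lemma word_deg_cat u v : word_deg (u ++ v) = (word_deg u + word_deg v)%N.
Proof. by rewrite /word_deg big_cat. Qed.

Lemma word_deg_take_drop i w : (word_deg (take i w) + word_deg (drop i w))%N = word_deg w.
Proof. by rewrite -word_deg_cat cat_take_drop. Qed.

(** Degree and length come before the lexicographic order to make the order
    compatible with concatenation, and to put the corrections of higher degree or
    greater length that occur in tangent vectors above the words of interest. *)
Definition word_le (u w : seq A) : bool :=
  (word_deg u < word_deg w)%N || (word_deg u == word_deg w) &&
  ((size u < size w)%N || (size u == size w) && lexle le u w).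

Lemma word_le_refl : reflexive word_le.
Proof. by move=> u; rewrite /word_le !eqxx lexle_refl // !orbT. Qed.

Lemma word_le_anti u v : word_le u v -> word_le v u -> u = v.
Proof.
rewrite /word_le => /orP[d1|/andP[/eqP d1 /orP[s1|/andP[/eqP s1 l1]]]]
  /orP[d2|/andP[/eqP d2 /orP[s2|/andP[/eqP s2 l2]]]]; try by exfalso; lia.
by apply: (lexle_anti le_refl le_anti); rewrite l1.
Qed.

Lemma word_le_trans : transitive word_le.
Proof.
move=> v u w; rewrite /word_le => /orP[d1|/andP[/eqP d1 /orP[s1|/andP[/eqP s1 l1]]]]
  /orP[d2|/andP[/eqP d2 /orP[s2|/andP[/eqP s2 l2]]]]; try by lia.
by rewrite d1 d2 s1 s2 !eqxx (lexle_trans le_refl le_anti le_trans l1 l2) !orbT.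
Qed.

Lemma word_le_cat u u' v v' : word_le u u' -> word_le v v' -> word_le (u ++ v) (u' ++ v').
Proof.
rewrite /word_le !word_deg_cat !size_cat.
move=> /orP[d1|/andP[/eqP d1 /orP[s1|/andP[/eqP s1 l1]]]]
  /orP[d2|/andP[/eqP d2 /orP[s2|/andP[/eqP s2 l2]]]]; try by lia.
by rewrite d1 d2 s1 s2 !eqxx lexle_cat // !orbT.
Qed.

Definition leading (K : comNzRingType) (u : seq A) (a : seq A -> K) :=
  a u = 1 /\ forall w, a w <> 0 -> word_le u w.

Section LeadingRing.
Variable K : comNzRingType.
Implicit Types (a b : seq A -> K).

Lemma leading_conv u v a b : leading u a -> leading v b -> leading (u ++ v) (conv a b).
Proof.
move=> [a1 aw] [b1 bw]; split.
  have si : (size u < (size (u ++ v)).+1)%N by rewrite ltnS size_cat leq_addr.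
  rewrite /conv (bigD1 (Ordinal si)) //= take_size_cat // drop_size_cat // a1 b1 mulr1.
  rewrite big1 ?addr0 // => i /eqP ni.
  have [-> //|/eqP na] := eqVneq (a (take i (u ++ v))) 0; first by rewrite mul0r.
  have [-> //|/eqP nb] := eqVneq (b (drop i (u ++ v))) 0; first by rewrite mulr0.
  have h1 := aw _ na; have h2 := bw _ nb; case: ni; apply: val_inj => /=.
  have := word_deg_take_drop i (u ++ v); rewrite word_deg_cat.
  have /= si' := ltn_ord i; rewrite ltnS in si'.
  move: h1 h2; rewrite /word_le size_takel // size_drop; have := size_cat u v.
  move=> ? /orP[?|/andP[/eqP ? /orP[?|/andP[/eqP ? ?]]]]
    /orP[?|/andP[/eqP ? /orP[?|/andP[/eqP ? ?]]]] ?; lia.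
move=> w nw; have [i ni] : exists i : 'I_(size w).+1, a (take i w) * b (drop i w) <> 0.
  apply/boolp.not_existsP => h; apply: nw; rewrite /conv big1 // => i _.
  by have [//|/eqP /(h i)] := eqVneq (a (take i w) * b (drop i w)) 0.
rewrite -(cat_take_drop i w); apply: word_le_cat.
  by apply: aw => E; apply: ni; rewrite E mul0r.
by apply: bw => E; apply: ni; rewrite E mulr0.
Qed.

(** The words [u ++ v] and [v ++ u] have the same degree and length, so if the
    latter is lexicographically larger, the second product in the commutator does
    not affect the leading term of the first one. *)
Lemma leading_bracket u v a b : leading u a -> leading v b ->
  lexlt le (u ++ v) (v ++ u) ->
  leading (u ++ v) (fun w => conv a b w - conv b a w).
Proof.
move=> la lb /andP[ne lt]; have [c1 cw] := leading_conv la lb.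
have [d1 dw] := leading_conv lb la.
have le1 : word_le (u ++ v) (v ++ u).
  by rewrite /word_le !word_deg_cat !size_cat addnC eqxx [(size v + _)%N]addnC eqxx lt !orbT.
split=> [|w].
  rewrite c1; have [->|/eqP n0] := eqVneq (conv b a (u ++ v)) 0; first by rewrite subr0.
  by case/eqP: ne; apply: word_le_anti le1 (dw _ n0).
have [->|/eqP n0 _] := eqVneq (conv b a w) 0; first by rewrite subr0; exact: cw.
exact: word_le_trans le1 (dw _ n0).
Qed.

End LeadingRing.
End Leading.
End Series.

(** * Tangent spaces of a semigroup of matrices *)

Lemma invmx_uniq (F : fieldType) n (M N : 'M[F]_n) : M *m N = 1%:M -> invmx M = N.
Proof. by move=> MN; have [Mu _] := mulmx1_unit MN; rewrite -(mulKmx Mu N) MN mulmx1. Qed.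

(** Let [P g V] say that some family of matrices passes through [g] with tangent
    space [V], and suppose that products of such families are such families.
    At a point [g] where [V] has the largest dimension, translating [V] to the
    identity gives a space [H] that contains every other translated tangent
    space and is stable under conjugation by the whole semigroup. *)
Section MaximalTangent.
Variables (F : fieldType) (n : nat) (P : 'M[F]_n -> {vspace 'M[F]_n} -> Prop).
Hypothesis Pex : exists g V, P g V.
Hypothesis Punit : forall g V, P g V -> g \in unitmx.
Hypothesis PM : forall g V g' V', P g V -> P g' V' ->
  exists W, [/\ P (g *m g') W, forall v, v \in V -> v *m g' \in W
    & forall v, v \in V' -> g *m v \in W].

Lemma maximal_dimension : exists g V, P g V /\
  forall g' V', P g' V' -> (\dim V' <= \dim V)%N.
Proof.
pose Q d := boolp.asbool (exists g V, P g V /\ \dim V = d).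
have Qex : exists d, Q d.
  by have [g [V PV]] := Pex; exists (\dim V); apply/boolp.asboolP; exists g, V.
have Qb d : Q d -> (d <= \dim {:'M[F]_n})%N.
  by move=> /boolp.asboolP[g [V [_ <-]]]; exact: dimvS (subvf V).
case: (ex_maxnP Qex Qb) => d /boolp.asboolP[g [V [PV <-]]] dmax.
exists g, V; split=> // g' V' PV'; apply: dmax; apply/boolp.asboolP.
by exists g', V'.
Qed.

Lemma dim_img_inj (f : 'End('M[F]_n)) (V : {vspace 'M[F]_n}) :
  (forall m, f m = 0 -> m = 0) -> \dim (f @: V)%VS = \dim V.
Proof.
move=> fi; apply: limg_dim_eq; apply/eqP; rewrite -subv0; apply/subvP => m.
by rewrite memv_cap memv_ker memv0 => /andP[_ /eqP/fi ->].
Qed.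

Lemma maximal_tangent : exists g V (H : {vspace 'M[F]_n}),
  [/\ P g V, forall h, (h \in H) = (g *m h \in V),
    forall g' V' v, P g' V' -> v \in V' -> v *m invmx g' \in H,
    forall g' V' h, P g' V' -> h \in H -> g' *m h *m invmx g' \in H
  & forall h, h \in H -> exists2 u, u \in V & h = u *m invmx g].
Proof.
have [g [V [PV maxV]]] := maximal_dimension.
have gU := Punit PV.
have lE (a m : 'M[F]_n) : linfun (mulmx a) m = a *m m by rewrite lfunE.
have rE (a m : 'M[F]_n) : linfun (mulmxr a) m = m *m a by rewrite lfunE.
pose H := (linfun (mulmx g) @^-1: V)%VS.
have HE h : (h \in H) = (g *m h \in V) by rewrite -memv_preim lE.
have tan g' V' v : P g' V' -> v \in V' -> v *m invmx g' \in H.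
  move=> PV' vV'; have g'U := Punit PV'; rewrite HE.
  have [W [PW WV WV']] := PM PV PV'.
  have VW : (linfun (mulmxr g') @: V <= W)%VS.
    by apply/subvP => _ /memv_imgP[u uV ->]; rewrite rE; exact: WV.
  have dV : \dim (linfun (mulmxr g') @: V)%VS = \dim V.
    apply: dim_img_inj => m; rewrite rE => /(congr1 (mulmxr (invmx g'))) /=.
    by rewrite mulmxK // mul0mx.
  have : (linfun (mulmxr g') @: V == W)%VS by rewrite eqEdim VW dV (maxV _ _ PW).
  move=> /eqP E; have := WV' _ vV'; rewrite -E => /memv_imgP[u uV].
  by rewrite rE mulmxA => ->; rewrite mulmxK.
pose cj := linfun (mulmxr (invmx g) \o mulmx g) : 'End('M[F]_n).
have cjE m : cj m = g *m m *m invmx g by rewrite lfunE.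
have HgE h : h \in H -> exists2 u, u \in V & h = u *m invmx g.
  move=> hH; suff : h \in (cj @: H)%VS.
    by case/memv_imgP => m; rewrite HE => mV ->; exists (g *m m).
  suff /eqP -> : (cj @: H == H)%VS by [].
  rewrite eqEdim; apply/andP; split.
    by apply/subvP => _ /memv_imgP[m mH ->]; rewrite cjE; apply: tan PV _; rewrite -HE.
  rewrite dim_img_inj // => m; rewrite cjE => /(congr1 (mulmxr g))/=.
  rewrite mulmxKV // mul0mx => /(congr1 (mulmx (invmx g))).
  by rewrite mulKmx // mulmx0.
exists g, V, H; split=> // g' V' h PV' hH; have g'U := Punit PV'.
have [u uV ->] := HgE _ hH.
have [W [PW _ WV]] := PM PV' PV.
have : invmx (g' *m g) = invmx g *m invmx g'.
  by apply: invmx_uniq; rewrite mulmxA mulmxK // mulmxV.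
by move=> E; have := tan _ _ _ PW (WV _ uV); rewrite E !mulmxA.
Qed.

End MaximalTangent.

Section PolynomialCurves.
Variable R : realFieldType.

Lemma poly_zero_interval (p : {poly R}) (t0 : R) : 0 < t0 ->
  (forall t, 0 < t < t0 -> p.[t] = 0) -> p = 0.
Proof.
move=> t0_gt0 h; apply/eqP; apply: contraT => p0.
pose rs := [seq t0 / (j.+2)%:R | j <- iota 0 (size p)].
have : (size rs < size p)%N; last by rewrite size_map size_iota ltnn.
apply: max_poly_roots p0 _ _.
  apply/allP => _ /mapP[j _ ->]; apply/rootP/h; rewrite divr_gt0 ?ltr0n //=.
  by rewrite ltr_pdivrMr ?ltr0n // ltr_pMr // ltr1n.
rewrite map_inj_uniq ?iota_uniq // => i j /(mulfI (lt0r_neq0 t0_gt0))/invr_inj/eqP.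
by rewrite eqr_nat => /eqP[].
Qed.

Lemma horner_mx_coef m n (Q : 'M[{poly R}]_(m, n)) t N :
  (forall i j, (size (Q i j) <= N)%N) ->
  map_mx (horner^~ t) Q = \sum_(l < N) t ^+ l *: map_mx (fun p : {poly R} => p`_l) Q.
Proof.
move=> sN; apply/matrixP => i j; rewrite summxE mxE (horner_coef_wide _ (sN i j)).
by apply: eq_bigr => l _; rewrite !mxE mulrC.
Qed.

(** Project along the subspace: the coordinates of the projected curve are
    polynomials that vanish on an interval. *)
Lemma coef_mem_subspace n (H : {vspace 'M[R]_n}) (Q : 'M[{poly R}]_n) t0 : 0 < t0 ->
  (forall t, 0 < t < t0 -> map_mx (horner^~ t) Q \in H) ->
  forall l, map_mx (fun p : {poly R} => p`_l) Q \in H.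
Proof.
move=> t0_gt0 QH.
pose f := (\1 - projv H)%VF : 'End('M[R]_n).
have fH m : (f m == 0) = (m \in H).
  rewrite /f !lfunE /= lfunE /= !lfunE /= subr_eq0; apply/eqP/idP => [->|mH].
    exact: memv_proj.
  by rewrite projv_id.
pose N := (\sum_i \sum_j size (Q i j))%N.
have sN i j : (size (Q i j) <= N)%N.
  by rewrite /N (bigD1 i) //= (bigD1 j) //= -addnA leq_addr.
pose c l := map_mx (fun p : {poly R} => p`_l) Q.
move=> l; have [lN|Nl] := ltnP l N; last first.
  suff -> : map_mx (fun p : {poly R} => p`_l) Q = 0 by exact: mem0v.
  by apply/matrixP => i j; rewrite !mxE nth_default // (leq_trans (sN i j)).
rewrite -fH; apply/eqP/matrixP => i j; rewrite [RHS]mxE.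
pose p := \poly_(l < N) (f (c l) i j).
have : p = 0.
  apply: (poly_zero_interval t0_gt0) => t ht.
  have := QH t ht; rewrite -fH => /eqP; rewrite (horner_mx_coef t sN) linear_sum /=.
  move=> /matrixP/(_ i j); rewrite summxE [RHS]mxE => E; rewrite horner_poly -[RHS]E.
  by apply: eq_bigr => l' _; rewrite linearZ mxE mulrC.
by move=> /polyP/(_ l); rewrite coef_poly lN coef0.
Qed.

End PolynomialCurves.

(** * Directional derivatives of densities in step kernels *)

Section StepDerivative.
Variable R : realFieldType.

(** Up to normalization of the total mass, these are the data of a step
    tournamenton; weights are strictly positive so that they can be moved in all
    directions. *)
Definition step_data (U : finType) (M : U -> U -> R) (z : U -> R) :=
  [/\ forall a b, M a b + M b a = 1, forall a b, 0 <= M a b <= 1 & forall u, 0 < z u].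

Definition poly_kernel (U : finType) (M : U -> U -> R) a b : {poly R} := (M a b)%:P.
Definition poly_weight (U : finType) (z d : U -> R) u : {poly R} := (z u)%:P + d u *: 'X.

(** A formal directional derivative: the weights move along the line [z + 'X d],
    and the coefficient of ['X] is taken. *)
Definition hom_deriv (U : finType) (M : U -> U -> R) (z d : U -> R)
    (V : finType) (e : rel V) : R :=
  (hom (poly_kernel M) (poly_weight z d) e)`_1.

Section OneKernel.
Variables (U : finType) (M : U -> U -> R).
Implicit Types (z d : U -> R).

Lemma horner_hom z d (V : finType) (e : rel V) t :
  (hom (poly_kernel M) (poly_weight z d) e).[t] = hom M (fun u => z u + t * d u) e.
Proof.
rewrite -[LHS]/(horner_eval t _) hom_rmorph; apply: eq_hom => [a b|u].
  by rewrite /= /horner_eval /poly_kernel hornerC.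
by rewrite /= /horner_eval /poly_weight hornerD hornerC hornerZ hornerX mulrC.
Qed.

Lemma coef0_hom z d (V : finType) (e : rel V) :
  (hom (poly_kernel M) (poly_weight z d) e)`_0 = hom M z e.
Proof.
by rewrite -horner_coef0 horner_hom; apply: eq_hom => // u; rewrite mul0r addr0.
Qed.

Lemma coef1M (p q : {poly R}) : (p * q)`_1 = p`_1 * q`_0 + p`_0 * q`_1.
Proof. by rewrite coefM big_ord_recl big_ord1 /= addrC. Qed.

Lemma coef_prod_weight_linear z d1 d2 c (V : finType) (f : V -> U) :
  (\prod_v poly_weight z (fun u => c * d1 u + d2 u) (f v))`_1 =
  c * (\prod_v poly_weight z d1 (f v))`_1 + (\prod_v poly_weight z d2 (f v))`_1.
Proof.
pose K (p q r : {poly R}) := [/\ p`_1 = c * q`_1 + r`_1, p`_0 = q`_0 & p`_0 = r`_0].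
suff [] : K (\prod_v poly_weight z (fun u => c * d1 u + d2 u) (f v))
  (\prod_v poly_weight z d1 (f v)) (\prod_v poly_weight z d2 (f v)) by [].
rewrite /K; elim/big_rec3: _ => [|v p q r _ [h1 h2 h3]].
  by rewrite !coef1 /= mulr0 addr0.
rewrite !coef1M !coefM !big_ord1 /= h1 -h2 -h3 /poly_weight.
by rewrite !coefD !coefZ !coefC !coefX /=; split; ring.
Qed.

Lemma hom_derivE z d (V : finType) (e : rel V) : hom_deriv M z d e =
  \sum_(f : {ffun V -> U}) (\prod_v poly_weight z d (f v))`_1 *
     \prod_x \prod_(y | e x y) M (f x) (f y).
Proof.
rewrite /hom_deriv /hom coef_sum; apply: eq_bigr => f _.
rewrite -coefMC rmorph_prod /=; congr (nth 0 (polyseq (_ * _)) 1); apply: eq_bigr => x _.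
by rewrite rmorph_prod.
Qed.

Lemma hom_deriv_linear z d1 d2 c (V : finType) (e : rel V) :
  hom_deriv M z (fun u => c * d1 u + d2 u) e =
  c * hom_deriv M z d1 e + hom_deriv M z d2 e.
Proof.
rewrite !hom_derivE big_distrr -big_split /=; apply: eq_bigr => f _.
by rewrite coef_prod_weight_linear mulrDl mulrA.
Qed.

Lemma eq_hom_deriv z d1 d2 (V : finType) (e : rel V) :
  d1 =1 d2 -> hom_deriv M z d1 e = hom_deriv M z d2 e.
Proof.
by move=> E; rewrite /hom_deriv; congr (nth 0 (polyseq _) 1); apply: eq_hom => // u; rewrite /poly_weight E.
Qed.

Lemma hom_deriv0 z (V : finType) (e : rel V) : hom_deriv M z (fun=> 0) e = 0.
Proof.
have := hom_deriv_linear z (fun=> 0) (fun=> 0) 1 e.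
rewrite (@eq_hom_deriv z _ (fun=> 0)) => [|u]; last by rewrite mulr0 addr0.
by rewrite mul1r => /esym/eqP; rewrite -subr_eq0 addrK => /eqP.
Qed.

Lemma hom_deriv_scale z d s (V : finType) (e : rel V) :
  s ^+ #|V| * hom_deriv M z d e = hom_deriv M (fun u => s * z u) (fun u => s * d u) e.
Proof.
rewrite /hom_deriv; transitivity (s%:P ^+ #|V| * hom (poly_kernel M) (poly_weight z d) e)`_1.
  by rewrite -polyC_exp coefCM.
rewrite -hom_scale; congr (nth 0 (polyseq _) 1); apply: eq_hom => // u.
by rewrite /poly_weight mulrDr -polyCM -[in RHS]scalerA -[in RHS]mul_polyC.
Qed.

(** Euler's identity: densities are homogeneous in the weights. *)
Lemma hom_deriv_self z (V : finType) (e : rel V) :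
  hom_deriv M z z e = #|V|%:R * hom M z e.
Proof.
rewrite /hom_deriv.
have -> : hom (poly_kernel M) (poly_weight z z) e = (1 + 'X) ^+ #|V| * (hom M z e)%:P.
  rewrite (@hom_rmorph _ _ polyC) -hom_scale; apply: eq_hom => // u.
  by rewrite /poly_weight mulrDl mul1r -mul_polyC mulrC.
rewrite coefMC; congr (_ * _).
suff [] : ((1 + 'X : {poly R}) ^+ #|V|)`_1 = #|V|%:R /\ ((1 + 'X : {poly R}) ^+ #|V|)`_0 = 1.
  by [].
elim: #|V| => [|n [ih1 ih0]]; first by rewrite expr0 !coef1.
rewrite exprS coef1M coefM big_ord1 /= ih1 ih0 !coefD !coef1 !coefX /=.
by split; rewrite -?natr1; ring.
Qed.

End OneKernel.
End StepDerivative.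

(** * The semigroup of step series and its tangent vectors *)

Section TangentLie.
Variables (R : realFieldType) (A : finType) (iota : A -> letter) (k : nat).
Hypothesis iota_inj : injective iota.

(** The generating series of the densities of all words.  By
    [word_hom_kernel_sum], direct sums of kernels become products of series. *)
Definition series (K : comNzRingType) (U : finType) (M : U -> U -> K) (z : U -> K)
  (w : seq A) : K := word_hom M z (map iota w).

Definition series_deriv (U : finType) (M : U -> U -> R) (z d : U -> R) (w : seq A) : R :=
  hom_deriv M z d (@edge (word_tourn (map iota w))).

Definition letter_deg (C : A) : nat := tsize (val (iota C)).

Lemma letter_deg_gt0 C : (0 < letter_deg C)%N.
Proof. exact: letter_gt0. Qed.

Lemma card_word_tourn w : #|'I_(tsize (word_tourn (map iota w)))| = word_deg letter_deg w.
Proof. by rewrite card_ord tsize_word_tourn big_map. Qed.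

Lemma series_nil (K : comNzRingType) (U : finType) (M : U -> U -> K) (z : U -> K) :
  series M z [::] = 1.
Proof. exact: word_hom_nil. Qed.

Lemma series_sum (K : comNzRingType) (U1 U2 : finType) (M1 : U1 -> U1 -> K)
    (M2 : U2 -> U2 -> K) z1 z2 w :
  series (kernel_sum M1 M2) (weight_sum z1 z2) w = conv (series M1 z1) (series M2 z2) w.
Proof.
rewrite /series word_hom_kernel_sum size_map; apply: eq_bigr => i _.
by rewrite map_take map_drop.
Qed.

Lemma series_deriv_sum (U1 U2 : finType) (M1 : U1 -> U1 -> R)
    (M2 : U2 -> U2 -> R) z1 z2 d1 d2 w :
  series_deriv (kernel_sum M1 M2) (weight_sum z1 z2) (weight_sum d1 d2) w =
  conv (series_deriv M1 z1 d1) (series M2 z2) w +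
  conv (series M1 z1) (series_deriv M2 z2 d2) w.
Proof.
have -> : series_deriv (kernel_sum M1 M2) (weight_sum z1 z2) (weight_sum d1 d2) w =
    (series (kernel_sum (poly_kernel M1) (poly_kernel M2))
      (weight_sum (poly_weight z1 d1) (poly_weight z2 d2)) w)`_1.
  by congr (nth 0 (polyseq _) 1); apply: eq_hom => [[a|a] [b|b]|[a|a]].
rewrite series_sum /conv coef_sum -big_split /=; apply: eq_bigr => i _.
by rewrite coef1M /series /word_hom !coef0_hom.
Qed.

(** The points of the semigroup of series of step kernels, each with the vectors
    obtained by moving its weights. *)
Definition tangent_point (g : 'M[R]_#|{: k.-bseq A}|) (V : {vspace 'M[R]_#|{: k.-bseq A}|}) :=
  exists (U : finType) (M : U -> U -> R) (z : U -> R),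
    [/\ step_data M z, g = toep k (series M z)
      & forall m, m \in V <-> exists d, m = toep k (series_deriv M z d)].

Lemma tangent_space_exists (U : finType) (M : U -> U -> R) (z : U -> R) :
  exists V : {vspace 'M[R]_#|{: k.-bseq A}|},
    forall m, m \in V <-> exists d, m = toep k (series_deriv M z d).
Proof.
pose f (x : 'rV[R]_#|U|) := toep k (series_deriv M z (fun u => x 0 (enum_rank u))).
have f_lin : linear f.
  move=> c x y; rewrite /f -toep_linear; apply: eq_toep => w _.
  by rewrite /series_deriv -hom_deriv_linear; apply: eq_hom_deriv => u; rewrite !mxE.
pose fl := HB.pack_for {linear 'rV[R]_#|U| -> 'M[R]_#|{: k.-bseq A}|} f
  (GRing.isLinear.Build R _ _ _ f f_lin).
exists (limg (linfun fl)) => m; split=> [/memv_imgP[x _ ->]|[d ->]].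
  by exists (fun u => x 0 (enum_rank u)); rewrite lfunE.
have -> : toep k (series_deriv M z d) = linfun fl (\row_i d (enum_val i)).
  rewrite lfunE /= /f; apply: eq_toep => w _; apply: eq_hom_deriv => u.
  by rewrite mxE enum_rankK.
exact: memv_img (memvf _).
Qed.

Lemma toep_series_unit (U : finType) (M : U -> U -> R) (z : U -> R) :
  toep k (series M z) \in unitmx.
Proof.
have [b [_ gb _]] := toep_inv k (series_nil M z).
by have [] := mulmx1_unit gb.
Qed.

Lemma step_data_sum (U1 U2 : finType) (M1 : U1 -> U1 -> R) (M2 : U2 -> U2 -> R) z1 z2 :
  step_data M1 z1 -> step_data M2 z2 ->
  step_data (kernel_sum M1 M2) (weight_sum z1 z2).
Proof.
move=> [s1 b1 p1] [s2 b2 p2]; split.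
- by move=> [a|a] [b|b] //=; rewrite ?addr0 ?add0r.
- by move=> [a|a] [b|b] //=; rewrite ?lexx ?ler01.
- by move=> [a|a] /=.
Qed.

(** In a direct sum the weights of both summands can be moved. *)
Lemma tangent_point_mul g V g' V' : tangent_point g V -> tangent_point g' V' ->
  exists W, [/\ tangent_point (g *m g') W, forall v, v \in V -> v *m g' \in W
    & forall v, v \in V' -> g *m v \in W].
Proof.
move=> [U1 [M1 [z1 [s1 -> V1]]]] [U2 [M2 [z2 [s2 -> V2]]]].
have [W WE] := tangent_space_exists (kernel_sum M1 M2) (weight_sum z1 z2).
exists W; split.
- exists _, (kernel_sum M1 M2), (weight_sum z1 z2); split=> //.
    exact: step_data_sum.
  by rewrite -toepM; apply: eq_toep => w _; rewrite series_sum.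
- move=> v /V1[d ->]; apply/WE; exists (weight_sum d (fun=> 0)).
  rewrite -toepM; apply: eq_toep => w _; rewrite series_deriv_sum.
  rewrite [X in _ = _ + X]/conv [X in _ = _ + X]big1 ?addr0 // => i _.
  by rewrite /series_deriv hom_deriv0 mulr0.
- move=> v /V2[d ->]; apply/WE; exists (weight_sum (fun=> 0) d).
  rewrite -toepM; apply: eq_toep => w _; rewrite series_deriv_sum.
  rewrite [X in _ = X + _]/conv [X in _ = X + _]big1 ?add0r // => i _.
  by rewrite /series_deriv hom_deriv0 mul0r.
Qed.

Lemma tangent_point_exists : exists g V, tangent_point g V.
Proof.
pose M (a b : void) : R := 0; pose z (a : void) : R := 0.
have [V VE] := tangent_space_exists M z.
by exists (toep k (series M z)), V, void, M, z; split=> //; split=> -[].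
Qed.

Lemma step_weights_open (U : finType) (z d : U -> R) : (forall u, 0 < z u) ->
  exists2 t0 : R, 0 < t0 & forall t, 0 < t < t0 -> forall u, 0 < z u + t * d u.
Proof.
move=> z0; pose s := 1 + \sum_u `|d u| / z u.
have s1 u : `|d u| / z u < s.
  rewrite /s (bigD1 u) //= addrCA ltrDl ltr_pwDl ?ltr01 // sumr_ge0 // => v _.
  by rewrite divr_ge0 // ltW.
have s0 : 0 < s.
  rewrite /s ltr_pwDl ?ltr01 // sumr_ge0 // => v _; by rewrite divr_ge0 // ltW.
exists s^-1; first by rewrite invr_gt0.
move=> t /andP[t0 ts] u.
have h : t * `|d u| < z u.
  rewrite -(divfK (lt0r_neq0 (z0 u)) `|d u|) mulrA -[ltRHS]mul1r ltr_pM2r //.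
  apply: (lt_trans (y := t * s)); first by rewrite ltr_pM2l.
  by rewrite -ltr_pdivlMr // div1r.
have : - `|t * d u| <= t * d u by rewrite lerNl -normrN ler_norm.
rewrite normrM (gtr0_norm t0); lra.
Qed.

End TangentLie.

(** * Linear independence of strongly connected tournaments of a given size *)

Lemma word_hom1 (K : comNzRingType) (U : finType) (M : U -> U -> K) (z : U -> K) C :
  word_hom M z [:: C] = hom M z (@edge (val C)).
Proof.
rewrite word_hom_cons /hom; apply: eq_bigr => f _.
by rewrite word_hom_nil mulr1.
Qed.

Section LetterIndependence.
Variable R : realFieldType.

(** The value 1/2 inside a part is forced by the symmetry condition. *)
Definition tourn_kernel (T : tourn) (a b : 'I_(tsize T)) : R :=
  if a == b then 2^-1 else (edge a b)%:R.

Lemma tourn_kernel_sym T (a b : 'I_(tsize T)) : tourn_kernel a b + tourn_kernel b a = 1.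
Proof.
rewrite /tourn_kernel eq_sym; case: eqVneq => [_|ab].
  by rewrite -div1r -splitr.
by rewrite (edge_tournament a b) eq_sym ab /=; case: edge; rewrite ?addr0 ?add0r.
Qed.

Lemma tourn_kernel_ge0 T (a b : 'I_(tsize T)) : 0 <= tourn_kernel a b.
Proof. by rewrite /tourn_kernel; case: eqP => _; rewrite ?invr_ge0 ?ler0n. Qed.

Lemma tourn_kernel_step T (z : 'I_(tsize T) -> R) : (forall u, 0 < z u) ->
  step_data (@tourn_kernel T) z.
Proof.
move=> z0; split=> // [a b|a b]; first exact: tourn_kernel_sym.
by rewrite tourn_kernel_ge0 -(tourn_kernel_sym a b) lerDl tourn_kernel_ge0.
Qed.

(** Take for [M] the kernel of [C0] and look at the coefficient of the product of
    all weights in the relation: it comes from the surjective maps from [C] to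
    [C0].  As both have [n] vertices, these maps are bijective, and they have a
    nonzero contribution only if they are isomorphisms. *)
Lemma letter_independence (A : finType) (iota : A -> letter) (n : nat) (lam : A -> R) :
  injective iota ->
  (forall (U : finType) (M : U -> U -> R) z, step_data M z ->
    \sum_(C | letter_deg iota C == n) lam C * word_hom M z [:: iota C] = 0) ->
  forall C, letter_deg iota C = n -> lam C = 0.
Proof.
move=> iota_inj rel C0 C0n; set T0 := val (iota C0).
pose U : finType := 'I_(tsize T0).
pose M := @tourn_kernel T0.
pose cf (C : A) (f : {ffun 'I_(letter_deg iota C) -> U}) :=
  \prod_x \prod_(y | @edge (val (iota C)) x y) M (f x) (f y).
pose wt (z : U -> R) (C : A) (f : {ffun 'I_(letter_deg iota C) -> U}) := \prod_v z (f v).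
have rel0 (z : U -> R) :
    \sum_(C | letter_deg iota C == n) lam C * hom M z (@edge (val (iota C))) = 0.
  pose t := 1 + \sum_u `|z u|.
  have t0 u : 0 < z u + t.
    have h : `|z u| < t.
      rewrite /t (bigD1 u) //= addrCA ltrDl ltr_pwDl ?ltr01 // sumr_ge0 //.
    have := ler_norm (- z u); rewrite normrN; lra.
  pose p := \sum_(C | letter_deg iota C == n)
    lam C *: hom (poly_kernel M) (poly_weight (fun u => z u + t) (fun=> 1))
      (@edge (val (iota C))).
  have pE s : p.[s] = \sum_(C | letter_deg iota C == n)
      lam C * hom M (fun u => z u + t + s) (@edge (val (iota C))).
    rewrite /p horner_sum; apply: eq_bigr => C _; rewrite hornerZ horner_hom.
    by congr (_ * _); apply: eq_hom => // u; rewrite mulr1.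
  have p0 : p = 0.
    apply: (poly_zero_interval (t0 := 1)) => // s /andP[s0 _]; rewrite pE.
    rewrite -[RHS](rel U M (fun u => z u + t + s)); last first.
      by apply: tourn_kernel_step => u; rewrite addr_gt0.
    by apply: eq_bigr => C _; rewrite word_hom1.
  have := pE (- t); rewrite p0 horner0 => /esym E; rewrite -[RHS]E.
  by apply: eq_bigr => C _; congr (_ * _); apply: eq_hom => // u; rewrite addrK.
(* Restricting to maps whose image contains a given vertex amounts to
   subtracting the relation where this vertex has weight 0. *)
have relS (S : seq U) (z : U -> R) : \sum_(C | letter_deg iota C == n) lam C *
    \sum_(f : {ffun 'I_(letter_deg iota C) -> U} | all [in codom f] S) wt z C f * cf C f = 0.
  elim: S z => [|u S ih] z.
    by rewrite -[RHS](rel0 z); apply: eq_bigr => C _.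
  have := ih (fun v => if v == u then 0 else z v) => E1; have := ih z.
  rewrite -[X in _ = X -> _]E1 => /eqP; rewrite -subr_eq0 -sumrB => /eqP E.
  rewrite -[RHS]E; apply: eq_bigr => C _; rewrite -mulrBr; congr (_ * _).
  rewrite -sumrB /= (bigID (fun f : {ffun 'I_(letter_deg iota C) -> U} => u \in codom f)) /=.
  rewrite [in RHS](bigID (fun f : {ffun 'I_(letter_deg iota C) -> U} => u \in codom f)) /=.
  rewrite [X in _ + X]big_pred0 => [|f]; last by case: (u \in codom f); rewrite ?andbF.
  rewrite [X in _ = _ + X]big1 => [|f /andP[_ uf]]; last first.
    apply/eqP; rewrite -mulrBl mulf_eq0 subr_eq0; apply/orP; left; apply/eqP.
    apply: eq_bigr => v _; case: eqP => // fv.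
    by rewrite -fv codom_f in uf.
  rewrite !addr0; apply: eq_big => [f|f /andP[/andP[uf _] _]].
    by case: (u \in codom f); rewrite ?andbT ?andbF.
  have /codomP[v uE] := uf.
  by rewrite [X in _ = _ - X * _]/wt (bigD1 v) //= -uE eqxx !mul0r subr0.
have := relS (enum U) (fun=> 1).
rewrite (bigD1 C0) ?C0n //= [X in _ + X]big1 => [|C /andP[/eqP Cn CC0]]; last first.
  rewrite big1 ?mulr0 // => f /allP fsurj; have [->|cf0] := eqVneq (cf C f) 0.
    by rewrite mulr0.
  case/eqP: CC0; apply: iota_inj; apply: val_inj.
  have fs u : u \in codom f by apply: fsurj; rewrite mem_enum.
  have fi : injective f.
    apply/injectiveP; rewrite /injectiveb /dinjectiveb.
    have : (size (codom f) <= size (enum U))%N.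
      rewrite size_codom -cardE !card_ord Cn /T0 -C0n; exact: leqnn.
    by move=> h; have := leq_size_uniq (enum_uniq U) (fun x _ => fs x) h.
  apply: (@models_uniq _ (@edge T0) [set: _]); last exact: models_self.
  exists f; split=> //.
    apply/setP => u; rewrite inE; symmetry; apply/imsetP.
    by have /codomP[v ->] := fs u; exists v.
  have edgef i j : @edge (val (iota C)) i j -> edge (f i) (f j).
    move=> ij; have : M (f i) (f j) != 0.
      apply: contra cf0 => /eqP E; rewrite /cf (bigD1 i) //= (bigD1 j) //= E.
      by rewrite !mul0r.
    rewrite /M /tourn_kernel; case: (eqVneq (f i) (f j)) => [/fi E|_].
      by move: ij; rewrite E (edge_tournament j j) eqxx.
    by case: edge; rewrite ?eqxx.
  move=> i j; apply/idP/idP; last exact: edgef.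
  rewrite (edge_tournament i j) (edge_tournament (f i) (f j)) (inj_eq fi).
  by case/andP=> -> /= h; apply: contra h; exact: edgef.
rewrite addr0 => /eqP; rewrite mulf_eq0 => /orP[/eqP //|/eqP E]; exfalso.
have id_ok : all [in codom [ffun x : 'I_(letter_deg iota C0) => x : U]] (enum U).
  apply/allP => u _; apply/codomP; exists u; by rewrite ffunE.
move: E; rewrite (bigD1 [ffun x => x]) //=.
apply/eqP; rewrite gt_eqF // ltr_pwDl //.
  rewrite /wt big1 // mul1r /cf big1 ?ltr01 // => x _; rewrite big1 // => y xy.
  rewrite !ffunE /M /tourn_kernel.
  case: (eqVneq x y) => [E|_]; last exact: (congr1 (fun b : bool => b%:R : R) xy).
  by move: xy; rewrite E (edge_tournament y y) eqxx.
apply: sumr_ge0 => f _; rewrite /wt big1 // mul1r /cf.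
by apply: prodr_ge0 => x _; apply: prodr_ge0 => y _; exact: tourn_kernel_ge0.
Qed.

End LetterIndependence.

(** * The Lie algebra of infinitesimal direct sums *)

(** [H] is the space of tangent vectors at a point of maximal dimension,
    translated to the identity. *)
Section LieAlgebra.
Variables (R : realFieldType) (A : finType) (iota : A -> letter) (k : nat).
Hypothesis iota_inj : injective iota.
Hypothesis k_gt0 : (0 < k)%N.
Local Notation mat := 'M[R]_#|{: k.-bseq A}|.
Variables (g : mat) (V H : {vspace mat}).
Hypothesis PV : tangent_point iota g V.
Hypothesis HE : forall h, (h \in H) = (g *m h \in V).
Hypothesis Htan : forall g' V' v, tangent_point iota g' V' -> v \in V' ->
  v *m invmx g' \in H.
Hypothesis Hconj : forall g' V' h, tangent_point iota g' V' -> h \in H ->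
  g' *m h *m invmx g' \in H.
Hypothesis HgE : forall h, h \in H -> exists2 u, u \in V & h = u *m invmx g.
Local Notation deg := (letter_deg iota).

Lemma tangent_step (U : finType) (M : U -> U -> R) (z d : U -> R) : step_data M z ->
  toep k (series_deriv iota M z d) *m invmx (toep k (series iota M z)) \in H.
Proof.
move=> Mz; have [W WE] := tangent_space_exists iota k M z.
apply: (Htan (V' := W)); last by apply/WE; exists d.
by exists U, M, z.
Qed.

Lemma tangent_conj (U : finType) (M : U -> U -> R) (z : U -> R) h : step_data M z ->
  h \in H ->
  toep k (series iota M z) *m h *m invmx (toep k (series iota M z)) \in H.
Proof.
move=> Mz; have [W WE] := tangent_space_exists iota k M z.
by apply: (Hconj (V' := W)); exists U, M, z.
Qed.

Lemma tangent_stepE h : h \in H -> exists (U : finType) (M : U -> U -> R) (z d : U -> R),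
  [/\ step_data M z, g = toep k (series iota M z)
    & h = toep k (series_deriv iota M z d) *m invmx (toep k (series iota M z))].
Proof.
have [U [M [z [Mz gE VE]]]] := PV.
by move=> /HgE[u /VE[d ->] ->]; exists U, M, z, d; rewrite gE.
Qed.

Lemma tangent_toep h : h \in H -> exists a, h = toep k a.
Proof.
move=> /tangent_stepE[U [M [z [d [_ _ ->]]]]].
have [b [_ gb _]] := toep_inv k (series_nil iota M z).
by exists (conv (series_deriv iota M z d) b); rewrite (invmx_uniq gb) toepM.
Qed.

(** Scaling all weights by [s] multiplies the coefficient of each word by a power
    of [s], so [H] is a graded subspace. *)
Definition rescale (s : R) (a : seq A -> R) (w : seq A) : R := s ^+ word_deg deg w * a w.

Lemma conv_rescale s a b w : conv (rescale s a) (rescale s b) w = rescale s (conv a b) w.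
Proof.
rewrite /rescale /conv big_distrr /=; apply: eq_bigr => i _.
by rewrite -(word_deg_take_drop deg i w) exprD mulrACA.
Qed.

Lemma tangent_rescale s a : 0 < s -> toep k a \in H -> toep k (rescale s a) \in H.
Proof.
move=> s0 /tangent_stepE[U [M [z [d [[M1 M2 z0] _ aE]]]]].
have [b [_ gb _]] := toep_inv k (series_nil iota M z).
have szE : toep k (series iota M (fun u => s * z u)) = toep k (rescale s (series iota M z)).
  by apply: eq_toep => w _; rewrite /series /word_hom hom_scale card_word_tourn.
have sb : toep k (rescale s (series iota M z)) *m toep k (rescale s b) = 1%:M.
  rewrite -toepM -[RHS]toep1; apply: eq_toep => w sw; rewrite conv_rescale.
  have := congr1 (fun m => coef m w) gb; rewrite -toepM -toep1 !coef_toep // /rescale => ->.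
  rewrite /unit_series; case: eqP => [->|_]; last by rewrite mulr0.
  by rewrite /word_deg big_nil expr0 mulr1.
rewrite (invmx_uniq gb) -toepM in aE.
have -> : toep k (rescale s a) =
    toep k (series_deriv iota M (fun u => s * z u) (fun u => s * d u)) *m
    invmx (toep k (series iota M (fun u => s * z u))).
  rewrite szE (invmx_uniq sb) -toepM; apply: eq_toep => w sw.
  rewrite /rescale; have := congr1 (fun m => coef m w) aE; rewrite !coef_toep // => ->.
  rewrite -/(rescale s (conv (series_deriv iota M z d) b) w) -conv_rescale.
  apply: eq_bigr => i _; congr (_ * _).
  by rewrite /series_deriv -hom_deriv_scale card_word_tourn.
by apply: tangent_step; split=> // u; rewrite mulr_gt0.
Qed.

Lemma tangent_graded a n : toep k a \in H ->
  toep k (fun w => if n == word_deg deg w then a w else 0) \in H.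
Proof.
move=> aH; pose q (w : seq A) : {poly R} := a w *: 'X^(word_deg deg w).
have := @coef_mem_subspace _ _ H (toep k q) 1 ltr01 _ n.
rewrite map_toep ?coef0 // => h.
rewrite (_ : toep k _ = toep k ((fun p : {poly R} => p`_n) \o q)).
  apply: h => t /andP[t0 _]; rewrite map_toep ?horner0 //.
  rewrite (_ : toep k _ = toep k (rescale t a)); first exact: tangent_rescale.
  by apply: eq_toep => w _; rewrite /= /q hornerZ hornerXn mulrC.
apply: eq_toep => w _; rewrite /= /q coefZ coefXn.
by case: eqP => _; rewrite ?mulr1 ?mulr0.
Qed.

(** Conjugate by a point that moves in the direction of [x], and differentiate. *)
Lemma tangent_bracket x h : x \in H -> h \in H -> x *m h - h *m x \in H.
Proof.
move=> /tangent_stepE[U [M [z [d [Mz gE xE]]]]] hH.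
have gU := toep_series_unit iota k M z.
rewrite -gE in xE gU; set u := toep k (series_deriv _ _ _ _) in xE.
pose h' := invmx g *m h *m g.
have h'H : h' \in H.
  rewrite HE /h' !mulmxA mulmxV // mul1mx.
  by have [v vV ->] := HgE hH; rewrite mulmxKV.
pose G : 'M[{poly R}]_#|{: k.-bseq A}| :=
  toep k (series iota (poly_kernel M) (poly_weight z d)).
have [b [_ Gb bG]] : exists b, [/\ b [::] = 1, G *m toep k b = 1%:M & toep k b *m G = 1%:M].
  by apply: toep_inv; exact: series_nil.
set B := toep k b in Gb bG.
pose c l (Q : 'M[{poly R}]_#|{: k.-bseq A}|) := map_mx (fun p : {poly R} => p`_l) Q.
have c1M (P Q : 'M[{poly R}]_#|{: k.-bseq A}|) :
    c 1%N (P *m Q) = c 1%N P *m c 0%N Q + c 0%N P *m c 1%N Q.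
  apply/matrixP => i j; rewrite !mxE coef_sum -big_split /=; apply: eq_bigr => l _.
  by rewrite coef1M !mxE.
have c0M (P Q : 'M[{poly R}]_#|{: k.-bseq A}|) : c 0%N (P *m Q) = c 0%N P *m c 0%N Q.
  apply/matrixP => i j; rewrite !mxE coef_sum; apply: eq_bigr => l _.
  by rewrite coefM big_ord1 !mxE.
have cC l (m : mat) : c l (map_mx polyC m) = if l == 0%N then m else 0.
  by apply/matrixP => i j; rewrite !mxE coefC; case: (l == 0%N); rewrite ?mxE.
have c1 l : c l 1%:M = if l == 0%N then 1%:M else 0.
  by rewrite -cC map_mx1.
have cG0 : c 0%N G = g.
  by rewrite /c map_toep ?coef0 // gE; apply: eq_toep => w _; exact: coef0_hom.
have cG1 : c 1%N G = u by rewrite /c map_toep ?coef0.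
have cB0 : c 0%N B = invmx g.
  by apply/esym/invmx_uniq; rewrite -cG0 -c0M Gb c1.
have cB1 : c 1%N B = - (invmx g *m u *m invmx g).
  have := congr1 (c 1%N) Gb; rewrite c1M c1 cG0 cG1 cB0 /= => /eqP.
  rewrite addrC addr_eq0 => /eqP/(congr1 (mulmx (invmx g))).
  by rewrite mulKmx // mulmxN mulmxA.
pose Q := G *m map_mx polyC h' *m B.
have [t0 t0_gt0 zt] := step_weights_open d (let: And3 _ _ z0 := Mz in z0).
have : c 1%N Q \in H.
  apply: (coef_mem_subspace t0_gt0) => t ht.
  have -> : map_mx (horner^~ t) Q = map_mx (horner_eval t) Q by [].
  rewrite /Q 2!map_mxM /=; set zt' := fun v => z v + t * d v.
  have Gt : map_mx (horner_eval t) G = toep k (series iota M zt').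
    rewrite /G map_toep; last exact: rmorph0.
    by apply: eq_toep => w _; exact: horner_hom.
  have -> : map_mx (horner_eval t) B = invmx (toep k (series iota M zt')).
    by apply/esym/invmx_uniq; rewrite -Gt -map_mxM Gb map_mx1.
  have -> : map_mx (horner_eval t) (map_mx polyC h') = h'.
    by apply/matrixP => i j; rewrite !mxE /horner_eval hornerC.
  rewrite Gt; apply: tangent_conj => //.
  by case: Mz => ? ? _; split=> // v; exact: zt.
rewrite /Q !c1M !c0M !cC /= mulmx0 addr0 cG0 cG1 cB0 cB1 /h'.
rewrite mulmxN !mulmxA mulmxV // mul1mx xE !mulmxA.
rewrite -[X in X + _]mulmxA mulmxV // mulmx1.
by rewrite -[h *m g *m invmx g]mulmxA mulmxV // mulmx1.
Qed.

Lemma tangent_conv_bracket a b : toep k a \in H -> toep k b \in H ->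
  toep k (fun w => conv a b w - conv b a w) \in H.
Proof. by move=> aH bH; rewrite toepB !toepM; exact: tangent_bracket. Qed.

(** A linear relation between the coefficients of single letters on [H] is one
    between the densities themselves, by Euler's identity. *)
Lemma tangent_letter_relation (n : nat) (lam : A -> R) :
  (forall h, h \in H -> \sum_(C | deg C == n) lam C * coef h [:: C] = 0) ->
  forall (U : finType) (M : U -> U -> R) z, step_data M z ->
    (0 < n)%N -> \sum_(C | deg C == n) lam C * series iota M z [:: C] = 0.
Proof.
move=> rel U M z Mz n0; have [b [b1 gb _]] := toep_inv k (series_nil iota M z).
have := rel _ (tangent_step z Mz).
rewrite (invmx_uniq gb) -toepM => E.
have : n%:R * \sum_(C | deg C == n) lam C * series iota M z [:: C] = 0.
  rewrite -[RHS]E big_distrr /=; apply: eq_bigr => C /eqP Cn.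
  rewrite coef_toep // /conv big_ord_recl big_ord1 /= b1 mulr1.
  rewrite /series_deriv !hom_deriv_self !card_word_tourn /word_deg big_nil mul0r mul0r add0r.
  by rewrite big_seq1 Cn /series /word_hom; ring.
by move/eqP; rewrite mulf_eq0 pnatr_eq0 -(negbK (n == 0%N)) -lt0n n0 => /eqP.
Qed.

Variable le : rel A.
Hypotheses (le_refl : reflexive le) (le_anti : antisymmetric le).
Hypotheses (le_trans : transitive le) (le_total : total le).

(** By [letter_independence] no linear functional separates a letter from the
    letter coefficients of [H]; then keep the component of the right degree. *)
Lemma letter_leading C : exists2 a : seq A -> R, toep k a \in H &
  leading deg le [:: C] a.
Proof.
pose n := deg C.
pose psi (h : mat) : 'rV[R]_#|A| :=
  \row_i (if deg (enum_val i) == n then coef h [:: enum_val i] else 0).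
have psi_lin : linear psi.
  move=> c x y; apply/rowP => i; rewrite !mxE.
  by case: ifP => _; rewrite ?mulr0 ?addr0 // /coef !mxE.
pose fl := HB.pack_for {linear mat -> 'rV[R]_#|A|} psi
  (GRing.isLinear.Build R _ _ _ psi psi_lin).
have flE m : linfun fl m = psi m by rewrite lfunE.
pose eC : 'rV[R]_#|A| := delta_mx 0 (enum_rank C).
have : eC \in (linfun fl @: H)%VS.
  (* Otherwise some functional vanishes on the image but not at [eC]. *)
  apply/negPn/negP => neC; set S := (linfun fl @: H)%VS in neC.
  pose f := (\1 - projv S)%VF : 'End('rV[R]_#|A|).
  have fS m : (f m == 0) = (m \in S).
    rewrite /f !lfunE /= lfunE /= !lfunE /= subr_eq0; apply/eqP/idP => [->|mS].
      exact: memv_proj.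
    by rewrite projv_id.
  have : f eC != 0 by rewrite fS.
  case/rV0Pn => b; apply/negP; rewrite negbK.
  pose lam D := f (delta_mx 0 (enum_rank D)) 0 b.
  apply/eqP; rewrite -/(lam C).
  apply: (@letter_independence R A iota n lam iota_inj) => // U M z Mz.
  apply: (tangent_letter_relation _ Mz (letter_deg_gt0 iota C)).
  move=> h hH; have : f (linfun fl h) == 0 by rewrite fS memv_img.
  rewrite flE (row_sum_delta (psi h)) linear_sum /= => /eqP/rowP/(_ b).
  rewrite summxE [RHS]mxE => E; rewrite -[RHS]E.
  rewrite [LHS]big_mkcond /= (big_enum_val (A := A)) /=.
  apply: eq_bigr => i _; rewrite linearZ mxE /lam enum_valK mxE.
  by case: ifP => _; rewrite ?mul0r // mulrC.
case/memv_imgP => h hH; rewrite flE => hE.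
have [a aE] := tangent_toep hH; rewrite aE in hH.
exists (fun w => if n == word_deg deg w then a w else 0).
  exact: tangent_graded.
have aD D : deg D = n -> a [:: D] = (D == C)%:R.
  move=> Dn; move/rowP/(_ (enum_rank D)): hE; rewrite !mxE enum_rankK Dn eqxx aE.
  by rewrite coef_toep // eqxx /= (inj_eq (@enum_rank_inj _)) => <-.
have d1 D : word_deg deg [:: D] = deg D by rewrite /word_deg big_seq1.
split; first by rewrite d1 eqxx aD // eqxx.
move=> w; case: ifP => // /eqP nw aw; rewrite /word_le d1 -nw eqxx ltnn /=.
case: w nw aw => [|D [|E w]] //=.
  by rewrite /word_deg big_nil => E; move: (letter_deg_gt0 iota C); rewrite -/n E.
by rewrite d1 => /esym Dn; rewrite aD //; case: eqP => // -> _; rewrite le_refl.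
Qed.

(** Iterated commutators of elements with prescribed leading letters, bracketed
    by the standard factorization. *)
Lemma lyndon_leading l : lyndon_word le l ->
  exists2 a : seq A -> R, toep k a \in H & leading deg le l a.
Proof.
move En : (size l) => n; elim: n {-2}n (leqnn n) l En => [|n ih] m mn l ml lL.
  by case: lL => + _; case: l ml => // a l /= ml; exfalso; lia.
have [l1|l1] := leqP (size l) 1.
  case: l ml lL l1 => [|C [|//]] ml lL _; first by case: lL.
  exact: letter_leading.
have [u [v [lE uL vL uv]]] := lyndon_factorization le_refl le_anti le_trans le_total lL l1.
have su : (0 < size u)%N by case: (u) uL => // -[].
have sv : (0 < size v)%N by case: (v) vL => // -[].
have sl := size_cat u v; rewrite -lE in sl.
have [|a aH la] := ih (size u) _ u erefl uL; first lia.
have [|b bH lb] := ih (size v) _ v erefl vL; first lia.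
exists (fun w => conv a b w - conv b a w).
  exact: tangent_conv_bracket.
by rewrite lE; exact: leading_bracket.
Qed.

(** Multiplication by the series [g] goes from [H] back to [V], and changes the
    leading words by that of [g], which is empty. *)
Lemma tangent_point_leading l : lyndon_word le l ->
  exists2 a : seq A -> R, toep k a \in V & leading deg le l a.
Proof.
move=> lL; have [a aH la] := lyndon_leading lL.
have [U [M [z [Mz gE VE]]]] := PV.
exists (conv (series iota M z) a).
  by rewrite toepM -gE -HE.
rewrite -[l]cat0s; apply: leading_conv => //; split; first exact: series_nil.
move=> w _; rewrite /word_le /word_deg big_nil.
case: w => [|D w]; first by rewrite big_nil.
by rewrite big_cons (leq_trans (letter_deg_gt0 iota D)) ?leq_addr.
Qed.

End LieAlgebra.

(** * Densities of Lyndon tournaments have independent differentials *)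

Section FullRank.
Variables (R : realFieldType) (A : finType) (iota : A -> letter).
Hypothesis iota_inj : injective iota.
Variable le : rel A.
Hypotheses (le_refl : reflexive le) (le_anti : antisymmetric le).
Hypotheses (le_trans : transitive le) (le_total : total le).

(** The tangent vectors with leading words [w i] form a triangular system in the
    coordinates [w i]; a relation [phi] is refuted at its largest word. *)
Lemma lyndon_full_rank_alphabet (I : finType) (w : I -> seq A) : injective w ->
  (forall i, lyndon_word le (w i)) ->
  exists (U : finType) (M : U -> U -> R) (z : U -> R), step_data M z /\
    forall phi : I -> R,
      (forall d, \sum_i phi i * series_deriv iota M z d (w i) = 0) ->
      forall i, phi i = 0.
Proof.
move=> w_inj wL; pose k := (\sum_i size (w i)).+1.
have wk i : (size (w i) <= k)%N.
  by rewrite /k (bigD1 i) //= -addnS leq_addr.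
have [|||g [V [H [PV HE Htan Hconj HgE]]]] :=
  @maximal_tangent R _ (tangent_point iota (k := k)).
- exact: tangent_point_exists.
- by move=> g V [U [M [z [_ -> _]]]]; exact: toep_series_unit.
- exact: tangent_point_mul.
have [U [M [z [Mz gE VE]]]] := PV.
exists U, M, z; split=> // phi rel i; apply/eqP; apply: contraT => phi_i.
pose wle i j := word_le (letter_deg iota) le (w i) (w j).
pose cnt i := #|[pred j | wle j i]|.
case: (@arg_maxnP _ i (fun i => phi i != 0) cnt phi_i) => {phi_i}i phi_i imax.
have [a aV [a1 aw]] := tangent_point_leading iota_inj (isT : (0 < k)%N)
  PV HE Htan Hconj HgE le_refl le_anti le_trans le_total (wL i).
have /VE[d aE] := aV.
have := rel d; rewrite (bigD1 i) //= big1 => [|j ji].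
  have -> : series_deriv iota M z d (w i) = 1.
    by rewrite -(coef_toep _ (wk i)) -aE coef_toep.
  by rewrite mulr1 addr0 => /eqP; rewrite (negbTE phi_i).
rewrite -(coef_toep _ (wk j)) -aE coef_toep //.
have [->|/eqP/aw ij] := eqVneq (a (w j)) 0; first by rewrite mulr0.
have [->|phi_j] := eqVneq (phi j) 0; first by rewrite mul0r.
have : (cnt j <= cnt i)%N := imax j phi_j; rewrite leqNgt => /negP[]; apply: proper_card.
apply/properP; split.
  by apply/subsetP => l; rewrite !inE => h; apply: word_le_trans h ij.
exists j; rewrite !inE /wle ?word_le_refl //; apply/negP => h.
by case/eqP: ji; apply: w_inj; apply: word_le_anti h ij.
Qed.

End FullRank.

Theorem lyndon_full_rank (R : realFieldType) (le : rel letter) (I : finType)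
    (w : I -> seq letter) :
  reflexive le -> antisymmetric le -> transitive le -> total le ->
  injective w -> (forall i, lyndon_word le (w i)) ->
  exists (U : finType) (M : U -> U -> R) (z : U -> R), step_data M z /\
    forall phi : I -> R,
      (forall d, \sum_i phi i * hom_deriv M z d (@edge (word_tourn (w i))) = 0) ->
      forall i, phi i = 0.
Proof.
move=> le_refl le_anti le_trans le_total w_inj wL.
pose s := flatten [seq w i | i : I].
pose iota (x : seq_sub s) : letter := ssval x.
have iota_inj : injective iota by exact: val_inj.
have sub i x : x \in w i -> x \in s.
  by move=> xw; apply/flattenP; exists (w i) => //; apply/codomP; exists i.
have lift i : exists v : seq (seq_sub s), map iota v = w i.
  elim: (w i) (@sub i) => [|x v ih] h; first by exists [::].
  have [|v' <-] := ih; first by move=> y yv; apply: h; rewrite inE yv orbT.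
  by exists (SeqSub (h x (mem_head _ _)) :: v').
have [v vE] := boolp.choice lift.
have v_inj : injective v by move=> i j E; apply: w_inj; rewrite -!vE E.
pose le' := relpre iota le.
have lexE x y : lexle le' x y = lexle le (map iota x) (map iota y).
  by elim: x y => [|a x ih] [|b y] //=; rewrite ih.
have vL i : lyndon_word le' (v i).
  have [wi0 wi] := wL i; split=> [vi0|x y vi x0 y0].
    by apply: wi0; rewrite -vE vi0.
  have /(wi _ _) : w i = map iota x ++ map iota y by rewrite -vE vi map_cat.
  rewrite /lexlt -vE lexE (inj_eq (inj_map iota_inj)); apply.
    by case: (x) x0.
  by case: (y) y0.
have le'_anti : antisymmetric le' by move=> a b /le_anti/iota_inj.
have le'_trans : transitive le' by move=> a b c; exact: le_trans.
have le'_refl : reflexive le' by move=> a; exact: le_refl.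
have le'_total : total le' by move=> a b; exact: le_total.
have [U [M [z [Mz rank]]]] := lyndon_full_rank_alphabet R iota_inj le'_refl
  le'_anti le'_trans le'_total v_inj vL.
exists U, M, z; split=> // phi rel; apply: rank => d; rewrite -[RHS](rel d).
by apply: eq_bigr => i _; rewrite /series_deriv vE.
Qed.

From mathcomp Require Import all_classical all_reals all_analysis.
From mathcomp Require Import measurable_realfun.
From mathcomp Require mpoly.
Import numFieldNormedType.Exports.
Import Defs.
Local Open Scope classical_set_scope.
Local Open Scope ring_scope.

(** * Local surjectivity *)

HB.instance Definition _ (R : realType) m n :=
  Complete.copy 'M[R]_(m, n) 'M[R]_(m, n).

Section LocalSurjectivity.
Variables (R : realType) (N : nat).
Local Notation vec := 'rV[R]_N.
Implicit Types (y h : vec) (p : vec -> {poly R}).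

Lemma coord_le_norm y j : `|y 0 j| <= `|y|.
Proof.
rewrite [`|y|]/Num.norm /= mx_normrE.
by rewrite (bigmaxD1 (0, j)) //= le_max lexx.
Qed.

Lemma norm_le_coord y c : 0 <= c -> (forall j, `|y 0 j| <= c) -> `|y| <= c.
Proof.
move=> c0 yc; rewrite [`|y|]/Num.norm /= mx_normrE.
by apply: bigmax_le => // -[i j] _ /=; rewrite (ord1 i).
Qed.

(** The polynomial [p h] is the restriction to the line through [h] of the
    function [y |-> (p y).[1]], whose linear part at 0 is thus [(p h)`_1].  The
    last condition is a Lipschitz estimate for the quadratic remainder. *)
Definition quadratic_remainder (C : R) p :=
  [/\ 0 <= C, forall h, (p h)`_0 = (p 0).[1], forall h, `|(p h)`_1| <= C * `|h|,
    forall y, `|y| <= 1 -> `|(p y).[1]| <= C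
  & forall (rho : R) y y', 0 <= rho <= 1 -> `|y| <= rho -> `|y'| <= rho ->
      `|(p y).[1] - (p y').[1] - (p (y - y'))`_1| <= C * rho * `|y - y'|].

Lemma quadratic_remainder_near0 C p y : quadratic_remainder C p -> `|y| <= 1 ->
  `|(p y).[1] - (p 0).[1]| <= 2 * C * `|y|.
Proof.
move=> [C0 _ p1 _ pq] y1; have n0 : `|(0 : vec)| <= `|y| by rewrite normr0.
have h01 : 0 <= `|y| <= 1 by rewrite normr_ge0.
have := pq _ _ _ h01 (lexx _) n0; rewrite subr0 => h.
have h2 := p1 y; have h3 := ler_normD ((p y).[1] - (p 0).[1] - (p y)`_1) (p y)`_1.
rewrite subrK in h3.
have h4 : C * `|y| * `|y| <= C * `|y|.
  by rewrite -[leRHS]mulr1 ler_wpM2l ?mulr_ge0.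
lra.
Qed.

Lemma quadratic_remainderD C1 C2 p1 p2 :
  quadratic_remainder C1 p1 -> quadratic_remainder C2 p2 ->
  quadratic_remainder (C1 + C2) (fun h => p1 h + p2 h).
Proof.
move=> [c1 a1 b1 d1 e1] [c2 a2 b2 d2 e2]; split.
- exact: addr_ge0.
- by move=> h; rewrite coefD hornerD a1 a2.
- by move=> h; rewrite coefD mulrDl (le_trans (ler_normD _ _)) // lerD.
- by move=> y y1; rewrite hornerD (le_trans (ler_normD _ _)) // lerD ?d1 ?d2.
- move=> rho y y' r01 yr y'r; rewrite !hornerD coefD !mulrDl.
  have -> : (p1 y).[1] + (p2 y).[1] - ((p1 y').[1] + (p2 y').[1]) -
      ((p1 (y - y'))`_1 + (p2 (y - y'))`_1) =
    ((p1 y).[1] - (p1 y').[1] - (p1 (y - y'))`_1) +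
    ((p2 y).[1] - (p2 y').[1] - (p2 (y - y'))`_1) by ring.
  by rewrite (le_trans (ler_normD _ _)) // lerD ?e1 ?e2.
Qed.

Lemma quadratic_remainderM C1 C2 p1 p2 :
  quadratic_remainder C1 p1 -> quadratic_remainder C2 p2 ->
  quadratic_remainder (6 * (C1 * C2)) (fun h => p1 h * p2 h).
Proof.
move=> q1 q2; have [c1 a1 b1 d1 e1] := q1; have [c2 a2 b2 d2 e2] := q2.
have c12 : 0 <= C1 * C2 by rewrite mulr_ge0.
have n0 : `|(0 : vec)| <= 1 by rewrite normr0.
split.
- by rewrite mulr_ge0.
- by move=> h; rewrite coefM big_ord1 hornerM a1 a2.
- move=> h; rewrite coef1M a1 a2 (le_trans (ler_normD _ _)) // !normrM.
  have h1 := ler_pM (normr_ge0 _) (normr_ge0 _) (b1 h) (d2 _ n0).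
  have h2 := ler_pM (normr_ge0 _) (normr_ge0 _) (d1 _ n0) (b2 h).
  have h0 : 0 <= C1 * C2 * `|h| by rewrite mulr_ge0.
  apply: (le_trans (lerD h1 h2)); lra.
- move=> y y1; rewrite hornerM normrM.
  apply: (le_trans (ler_pM (normr_ge0 _) (normr_ge0 _) (d1 _ y1) (d2 _ y1))); lra.
- move=> rho y y' r01 yr y'r; have /andP[r0 r1] := r01.
  rewrite !hornerM coef1M a1 a2; set D := `|y - y'|.
  have -> : (p1 y).[1] * (p2 y).[1] - (p1 y').[1] * (p2 y').[1] -
      ((p1 (y - y'))`_1 * (p2 0).[1] + (p1 0).[1] * (p2 (y - y'))`_1) =
    (p1 y).[1] * ((p2 y).[1] - (p2 y').[1] - (p2 (y - y'))`_1) +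
    (p2 y').[1] * ((p1 y).[1] - (p1 y').[1] - (p1 (y - y'))`_1) +
    (((p1 y).[1] - (p1 0).[1]) * (p2 (y - y'))`_1 +
     ((p2 y').[1] - (p2 0).[1]) * (p1 (y - y'))`_1) by ring.
  have y1 := le_trans yr r1; have y'1 := le_trans y'r r1.
  have D0 : 0 <= D by exact: normr_ge0.
  have k1 := ler_pM (normr_ge0 _) (normr_ge0 _) (d1 _ y1) (e2 _ _ _ r01 yr y'r).
  have k2 := ler_pM (normr_ge0 _) (normr_ge0 _) (d2 _ y'1) (e1 _ _ _ r01 yr y'r).
  have near (C : R) q v : quadratic_remainder C q -> `|v| <= rho ->
      `|(q v).[1] - (q 0).[1]| <= 2 * C * rho.
    move=> qq vr; apply: (le_trans (quadratic_remainder_near0 qq (le_trans vr r1))).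
    by rewrite ler_wpM2l // mulr_ge0 //; case: qq.
  have k3 := ler_pM (normr_ge0 _) (normr_ge0 _) (near _ _ _ q1 yr) (b2 (y - y')).
  have k4 := ler_pM (normr_ge0 _) (normr_ge0 _) (near _ _ _ q2 y'r) (b1 (y - y')).
  rewrite -!normrM -/D in k1 k2 k3 k4.
  apply: (le_trans (ler_normD _ _)).
  apply: (le_trans (lerD (ler_normD _ _) (ler_normD _ _))).
  apply: (le_trans (lerD (lerD k1 k2) (lerD k3 k4))).
  rewrite le_eqVlt; apply/orP; left; apply/eqP; ring.
Qed.

Lemma quadratic_remainder_const c : quadratic_remainder `|c| (fun=> c%:P).
Proof.
split=> // [h|h|y _|rho y y' /andP[r0 _] _ _].
- by rewrite hornerC coefC.
- by rewrite coefC normr0 mulr_ge0.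
- by rewrite hornerC.
- by rewrite !hornerC coefC !subrr normr0 !mulr_ge0.
Qed.

Lemma quadratic_remainder_affine c (b : 'I_N -> R) :
  quadratic_remainder (`|c| + \sum_j `|b j|)
    (fun h => c%:P + (\sum_j h 0 j * b j) *: 'X).
Proof.
have bound h : `|\sum_j h 0 j * b j| <= (\sum_j `|b j|) * `|h|.
  rewrite big_distrl /= (le_trans (ler_norm_sum _ _ _)) //; apply: ler_sum => j _.
  by rewrite normrM mulrC ler_wpM2l // coord_le_norm.
have s0 : 0 <= \sum_j `|b j| by apply: sumr_ge0.
have E h : (c%:P + (\sum_j h 0 j * b j) *: 'X).[1] = c + \sum_j h 0 j * b j.
  by rewrite !hornerE.
split=> [|h|h|y y1|rho y y' /andP[r0 _] _ _].
- exact: addr_ge0.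
- rewrite E [X in _ = _ + X]big1 => [|j _]; last by rewrite mxE mul0r.
  by rewrite !coefE mulr0 !addr0.
- rewrite !coefE /= add0r mulr1 (le_trans (bound h)) // ler_wpM2r //.
  by rewrite lerDr.
- rewrite E (le_trans (ler_normD _ _)) // lerD // (le_trans (bound y)) //.
  by rewrite -[leRHS]mulr1 ler_wpM2l.
- rewrite !E !coefE /= add0r mulr1.
  have -> : \sum_j (y - y') 0 j * b j = \sum_j y 0 j * b j - \sum_j y' 0 j * b j.
    by rewrite -sumrB; apply: eq_bigr => j _; rewrite !mxE mulrBl.
  rewrite (_ : _ - _ = 0); last by ring.
  by rewrite normr0 !mulr_ge0 // addr_ge0.
Qed.

Lemma quadratic_remainder_ext C p q : p =1 q -> quadratic_remainder C p ->
  quadratic_remainder C q.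
Proof. by move=> /funext ->. Qed.

Lemma quadratic_remainder_sum (I : finType) (P : pred I) (F : I -> vec -> {poly R}) :
  (forall i, exists C, quadratic_remainder C (F i)) ->
  exists C, quadratic_remainder C (fun h => \sum_(i | P i) F i h).
Proof.
move=> FC; elim: (index_enum I) => [|i s [C qC]].
  exists `|0 : R|; apply: quadratic_remainder_ext (quadratic_remainder_const 0).
  by move=> h; rewrite big_nil.
have [C' qC'] := FC i; case Pi: (P i).
  exists (C' + C); apply: quadratic_remainder_ext (quadratic_remainderD qC' qC).
  by move=> h; rewrite big_cons Pi.
by exists C; apply: quadratic_remainder_ext qC => h; rewrite big_cons Pi.
Qed.

Lemma quadratic_remainder_prod (I : finType) (P : pred I) (F : I -> vec -> {poly R}) :
  (forall i, exists C, quadratic_remainder C (F i)) ->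
  exists C, quadratic_remainder C (fun h => \prod_(i | P i) F i h).
Proof.
move=> FC; elim: (index_enum I) => [|i s [C qC]].
  exists `|1 : R|; apply: quadratic_remainder_ext (quadratic_remainder_const 1).
  by move=> h; rewrite big_nil.
have [C' qC'] := FC i; case Pi: (P i).
  exists (6 * (C' * C)); apply: quadratic_remainder_ext (quadratic_remainderM qC' qC).
  by move=> h; rewrite big_cons Pi.
by exists C; apply: quadratic_remainder_ext qC => h; rewrite big_cons Pi.
Qed.

(** If the linear parts of [N] functions are the coordinates, then
    [y |-> y - (Phi y - x)] is a contraction of a small ball for [x] close to
    [Phi 0]; its fixed point solves [Phi y = x]. *)
Lemma quadratic_remainder_surjective (F : 'I_N -> vec -> {poly R}) (C rho0 : R) :
  (forall i, quadratic_remainder C (F i)) -> (forall i h, (F i h)`_1 = h 0 i) ->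
  0 < rho0 ->
  exists2 eps : R, 0 < eps & forall x : 'I_N -> R,
    (forall i, `|x i - (F i 0).[1]| <= eps) ->
    exists2 y, `|y| <= rho0 & forall i, (F i y).[1] = x i.
Proof.
move=> FC Flin rho0_gt0.
pose C1 : R := `|C| + 1; pose rho : R := Num.min rho0 (Num.min 1 (2 * C1)^-1).
have C1_gt0 : 0 < C1 by rewrite ltr_wpDl.
have rho_gt0 : 0 < rho by rewrite !lt_min rho0_gt0 ltr01 invr_gt0 mulr_gt0.
have rho_le0 : rho <= rho0 by rewrite ge_min lexx.
have rho_le1 : rho <= 1 by rewrite !ge_min lexx !orbT.
have rhoC : C1 * rho <= 2^-1.
  have : rho <= (2 * C1)^-1 by rewrite !ge_min lexx !orbT.
  move=> /(ler_wpM2l (ltW C1_gt0)); rewrite invfM mulrCA mulfV ?lt0r_neq0 //.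
  by rewrite mulr1.
exists (rho / 2); first by rewrite divr_gt0.
move=> x xF; pose T y : vec := \row_i (y 0 i - ((F i y).[1] - x i)).
have Tlip y y' : `|y| <= rho -> `|y'| <= rho -> `|T y - T y'| <= 2^-1 * `|y - y'|.
  move=> yr y'r; apply: norm_le_coord => [|i]; first by rewrite mulr_ge0.
  have [C0 _ _ _ Fq] := FC i.
  have := Fq rho y y'; rewrite rho_le1 ltW // => /(_ isT yr y'r).
  rewrite Flin !mxE => h; rewrite distrC in h.
  rewrite (_ : _ - _ = y 0 i - y' 0 i - ((F i y).[1] - (F i y').[1])); last by ring.
  apply: (le_trans h); rewrite ler_wpM2r //; apply: le_trans rhoC.
  apply: ler_wpM2r; first exact: ltW.
  by rewrite /C1 (le_trans (ler_norm C)) // lerDl.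
have T0 : `|T 0| <= rho / 2.
  apply: norm_le_coord => [|i]; first by rewrite divr_ge0 // ltW.
  by rewrite !mxE sub0r opprB xF.
pose U : set vec := closed_ball 0 rho.
have UE y : U y <-> `|y| <= rho.
  by rewrite /U closed_ballE //= /closed_ball_ /= sub0r normrN.
have TU : set_fun U U T.
  move=> y /UE yr; apply/UE; rewrite -[T y](subrK (T 0)).
  apply: (le_trans (ler_normD _ _)).
  have n0 : `|(0 : vec)| <= rho by rewrite normr0 ltW.
  have := Tlip y 0 yr n0; rewrite subr0; lra.
have ctr : is_contraction (mkfun_fun TU).
  have h2 : 0 <= 2^-1 :> R by rewrite invr_ge0.
  exists (NngNum h2); split; first by rewrite /= invf_lt1 ?ltr1n.
  by move=> [y y'] [/UE yr /UE y'r]; exact: Tlip.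
have [||y /UE yr yE] :=
  @banach_fixed_point R vec U (mkfun_fun TU) ctr.
- exact: closed_ball_closed.
- by exists 0; apply/UE; rewrite normr0 ltW.
exists y; first exact: le_trans rho_le0.
move=> i; move/rowP/(_ i): yE; rewrite /= mxE => /eqP.
by rewrite -subr_eq0 opprB addrCA subrr addr0 subr_eq0 => /eqP.
Qed.

End LocalSurjectivity.

Lemma quadratic_remainder_le (R : realType) N (C C' : R) (p : 'rV[R]_N -> {poly R}) :
  C <= C' -> quadratic_remainder C p -> quadratic_remainder C' p.
Proof.
move=> CC' [a1 a2 a3 a4 a5]; split=> //.
- exact: le_trans CC'.
- by move=> h; rewrite (le_trans (a3 h)) // ler_wpM2r.
- by move=> y y1; exact: le_trans (a4 y y1) CC'.
- move=> rho y y' r01 yr y'r; rewrite (le_trans (a5 _ _ _ r01 yr y'r)) //.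
  by case/andP: r01 => r0 _; rewrite ler_wpM2r // ler_wpM2r.
Qed.

Lemma hom_deriv_comb (R : realFieldType) (U V : finType) (M : U -> U -> R) z (e : rel V)
    n (c : 'I_n -> R) (D : 'I_n -> U -> R) :
  hom_deriv M z (fun u => \sum_j c j * D j u) e = \sum_j c j * hom_deriv M z (D j) e.
Proof.
elim: n c D => [|n ih] c D.
  rewrite big_ord0 -[RHS](hom_deriv0 M z e); apply: eq_hom_deriv => u.
  by rewrite big_ord0.
rewrite big_ord_recl -ih -hom_deriv_linear; apply: eq_hom_deriv => u.
by rewrite big_ord_recl.
Qed.

(** Independent differentials have dual directions; in the coordinates along
    these directions the linear part of the densities is the identity. *)
Lemma step_local_surjectivity (R : realType) (U : finType) (M : U -> U -> R) z
    (I : finType) (V : I -> finType) (e : forall i, rel (V i)) :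
  (forall u, 0 < z u) ->
  (forall phi : I -> R,
    (forall d, \sum_i phi i * hom_deriv M z d (@e i) = 0) -> forall i, phi i = 0) ->
  exists2 eps : R, 0 < eps & forall x : I -> R,
    (forall i, `|x i - hom M z (@e i)| <= eps) ->
    exists2 z', (forall u, 0 < z' u) & forall i, hom M z' (@e i) = x i.
Proof.
move=> z_gt0 rank.
pose ei (i : 'I_#|I|) := @e (enum_val i).
pose delta (u : 'I_#|U|) (v : U) : R := (v == enum_val u)%:R.
pose J : 'M[R]_(#|I|, #|U|) := \matrix_(i, u) hom_deriv M z (delta u) (@ei i).
have derivE i d : hom_deriv M z d (@ei i) = \sum_u d (enum_val u) * J i u.
  under eq_bigr => u _ do rewrite mxE.
  rewrite -hom_deriv_comb; apply: eq_hom_deriv => v.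
  rewrite (bigD1 (enum_rank v)) //= /delta enum_rankK eqxx mulr1 big1 ?addr0 // => u uv.
  by case: eqP => [vE|_]; rewrite ?mulr0 //; case/eqP: uv; rewrite vE enum_valK.
have : row_free J.
  apply: inj_row_free => v vJ; apply/rowP => i; rewrite mxE.
  rewrite -(enum_valK i); apply: (rank (fun i => v 0 (enum_rank i))) => d.
  rewrite (reindex (@enum_val I predT)) /=; last exact/onW_bij/enum_val_bij.
  under eq_bigr => j _ do rewrite enum_valK -/(ei j) derivE big_distrr /=.
  rewrite exchange_big /= big1 // => u _; move/rowP/(_ u): vJ; rewrite !mxE => vJu.
  under eq_bigr => j _ do rewrite mulrCA.
  by rewrite -big_distrr /= vJu mulr0.
case/row_freeP => B JB.
pose dir (h : 'rV[R]_#|I|) (v : U) := \sum_j h 0 j * B (enum_rank v) j.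
pose F i (h : 'rV[R]_#|I|) := hom (poly_kernel M) (poly_weight z (dir h)) (@ei i).
have Flin i h : (F i h)`_1 = h 0 i.
  rewrite -[LHS]/(hom_deriv M z (dir h) (@ei i)) hom_deriv_comb.
  rewrite (bigD1 i) //= big1 => [|j ji]; last first.
    rewrite derivE; move/matrixP/(_ i j): JB; rewrite !mxE eq_sym (negbTE ji) => E.
    under eq_bigr => u _ do rewrite enum_valK mulrC.
    by rewrite E mulr0.
  rewrite derivE; move/matrixP/(_ i i): JB; rewrite !mxE eqxx => E.
  under eq_bigr => u _ do rewrite enum_valK mulrC.
  by rewrite E mulr1 addr0.
have FE i y : (F i y).[1] = hom M (fun u => z u + dir y u) (@ei i).
  by rewrite horner_hom; apply: eq_hom => // u; rewrite mul1r.
have FC i : exists C, quadratic_remainder C (F i).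
  apply: quadratic_remainder_sum => f.
  have [|C1 q1] := @quadratic_remainder_prod R _ _ predT
      (fun v (h : 'rV_#|I|) => poly_weight z (dir h) (f v)).
    by move=> v; eexists; exact: quadratic_remainder_affine.
  have [|C2 q2] := @quadratic_remainder_prod R #|I| _ predT
      (fun x _ => \prod_(y | @ei i x y) poly_kernel M (f x) (f y)).
    move=> x; apply: quadratic_remainder_prod => y.
    by eexists; exact: quadratic_remainder_const.
  by exists (6 * (C1 * C2)); exact: quadratic_remainderM.
have [C qC] := choice FC.
have C0 i : 0 <= C i by case: (qC i).
have qC' i : quadratic_remainder (\sum_i C i) (F i).
  by apply: quadratic_remainder_le (qC i); rewrite (bigD1 i) //= lerDl sumr_ge0.
have [t0 t0_gt0 zt] := step_weights_open (fun v => - \sum_j `|B (enum_rank v) j|) z_gt0.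
have t2 : 0 < t0 / 2 by rewrite divr_gt0.
have [eps eps_gt0 sur] := quadratic_remainder_surjective qC' Flin t2.
exists eps => // x xF; have [|y yr yx] := sur (fun i => x (enum_val i)).
  move=> i; rewrite FE; apply: le_trans (xF (enum_val i)).
  rewrite (_ : hom M _ (@ei i) = hom M z (@ei i)) //; apply: eq_hom => // u.
  by rewrite /dir big1 ?addr0 // => j _; rewrite mxE mul0r.
exists (fun u => z u + dir y u) => [u|i].
  have tt : 0 < t0 / 2 < t0 by rewrite t2 /=; lra.
  have := zt _ tt u.
  have : `|dir y u| <= t0 / 2 * \sum_j `|B (enum_rank u) j|.
    rewrite /dir big_distrr /= (le_trans (ler_norm_sum _ _ _)) //.
    apply: ler_sum => j _; rewrite normrM ler_wpM2r //.
    exact: le_trans (coord_le_norm _ _) yr.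
  have := ler_norm (- dir y u); rewrite normrN mulrN; lra.
by have := yx (enum_rank i); rewrite FE /ei enum_rankK.
Qed.

(** * Lebesgue measure on tuples *)

Section TupleLebesgue.
Variable R : realType.
Local Open Scope ereal_scope.
Local Notation mu := lebesgue_measure.

Definition box n (A : 'I_n -> set R) : set (n.-tuple R) :=
  [set x | forall i, A i (tnth x i)].

Lemma measurable_box n (A : 'I_n -> set R) :
  (forall i, measurable (A i)) -> measurable (box A).
Proof.
move=> mA; rewrite (_ : box A = \bigcap_(i in [set: 'I_n]) ((tnth (T:=R))^~ i @^-1` A i)).
  apply: fin_bigcap_measurable; first exact: finite_finset.
  by move=> i _; rewrite -[X in measurable X]setTI; exact: measurable_tnth.
by apply/seteqP; split=> x /= h i; [move=> _; exact: h|exact: h].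
Qed.

Lemma tuple_lebesgue_box n (A : 'I_n -> set R) : (forall i, measurable (A i)) ->
  tuple_lebesgue (box A) = \prod_(i < n) mu (A i).
Proof.
elim: n A => [|n ih] A mA.
  rewrite big_ord0 /= diracE (_ : _ \in _ = true) //.
  by apply/mem_set => -[].
rewrite big_ord_recl -ih // -product_measure1E;
  [|exact: mA|exact: measurable_box].
rewrite /= /pushforward; congr (_ _); apply/seteqP; split=> [[a t]|[a t]] /=.
  move=> h; split=> /=; first exact: (h ord0).
  by move=> i; have := h (lift ord0 i); rewrite tnthS.
move=> [/= h0 h] i; case: (unliftP ord0 i) => [j|] ->; last by [].
by rewrite tnthS; exact: h.
Qed.

(** Boxes generate the measurable sets and are stable under intersection. *)
Lemma tuple_measure_unique n (m1 m2 : {measure set (n.-tuple R) -> \bar R}) :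
  (forall A, (forall i, measurable (A i)) -> m1 (box A) = \prod_(i < n) mu (A i)) ->
  (forall A, (forall i, measurable (A i)) -> m2 (box A) = \prod_(i < n) mu (A i)) ->
  forall B, measurable B -> m1 B = m2 B.
Proof.
move=> m1E m2E.
pose G : set (set (n.-tuple R)) :=
  [set B | exists2 A, (forall i, measurable (A i)) & B = box A].
pose J (l : nat) : set R := `[(- l%:R)%R, (l%:R)%R]%classic.
pose g (l : nat) : set (n.-tuple R) := box (fun=> J l).
apply: (measure_unique G g).
- apply/seteqP; split.
    apply: smallest_sub; first exact: smallest_sigma_algebra.
    move=> B; rewrite -bigcup_seq => -[/= i _ [C mC <-]].
    apply: sub_sigma_algebra; exists (fun j => if j == i then C else setT).
      by move=> j; case: ifP.
    apply/seteqP; split=> [x [_ /= xC] j|x xC].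
      by case: eqP => [->|].
    by split=> //=; have := xC i; rewrite eqxx.
  apply: smallest_sub; first exact: sigma_algebra_measurable.
  by move=> _ [A mA ->]; exact: measurable_box.
- move=> _ _ [A mA ->] [B mB ->]; exists (fun i => A i `&` B i).
    by move=> i; exact: measurableI.
  apply/seteqP; split=> [x [xA xB] i|x xAB]; first by split.
  by split=> i; case: (xAB i).
- by move=> l; exists (fun=> J l) => // i; exact: measurable_itv.
- apply/seteqP; split=> // x _.
  pose s : R := (\sum_i `|tnth x i|)%R.
  exists (Num.truncn s).+1 => //= i; rewrite /J /= in_itv /= -ler_norml.
  have : (`|tnth x i| <= s)%R.
    by rewrite /s (bigD1 i) //= lerDl sumr_ge0.
  move=> /le_trans; apply; apply: ltW; exact: truncnS_gt.
- by move=> _ [A mA ->]; rewrite m1E // m2E.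
- move=> l; rewrite m1E => [|i]; last exact: measurable_itv.
  have fin : 0 <= mu (J l) < +oo.
    rewrite /J lebesgue_measure_itv /=; case: ifP => h; last by rewrite lexx ltry.
    by rewrite -EFinB lee_fin subr_ge0 ltry andbT ltW // -lte_fin.
  suff /andP[] : 0 <= \prod_(i < n) mu (J l) < +oo by [].
  apply: (big_ind (fun x => 0 <= x < +oo)) => //; first by rewrite lee_fin ltry ler01.
  move=> x y /andP[x0 xoo] /andP[y0 yoo]; rewrite mule_ge0 //=.
  by rewrite lte_mul_pinfty // ge0_fin_numE.
Qed.

End TupleLebesgue.

(** * Densities in tournamentons *)

Section LabelledDensity.
Variable R : realType.
Local Notation unitI := (`[0%R, 1%R]%classic : set R).

(** The integrand of a density; the indicator replaces the unit cube as domain of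
    integration, and makes the integrand multiplicative. *)
Definition integrand n (e : rel 'I_n) (W : R * R -> R) (x : n.-tuple R) : R :=
  (\prod_i \1_unitI (tnth x i)) * \prod_i \prod_(j | e i j) W (tnth x i, tnth x j).

Definition labelled_density n (e : rel 'I_n) (W : R * R -> R) : \bar R :=
  (\int[@tuple_lebesgue R n]_x (integrand e W x)%:E)%E.

Lemma prod_indic n (x : n.-tuple R) :
  \prod_i \1_unitI (tnth x i) = \1_(unit_cube R n) x :> R.
Proof.
rewrite !indicE; have [xC|xC] := boolP (x \in unit_cube R n).
  rewrite big1 // => i _; rewrite indicE mem_set //= in_itv /=.
  by move/set_mem: xC; apply.
have [i xi] : exists i, ~ unitI (tnth x i).
  apply/existsNP => h; move/negP: xC; apply; apply/mem_set => i.
  by have := h i; rewrite /= in_itv.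
by rewrite (bigD1 i) //= indicE memNset // mul0r.
Qed.

Lemma density_labelled (T : tourn) (W : R * R -> R) :
  density T W = fine (labelled_density (@edge T) W).
Proof.
rewrite /density /Rintegral /labelled_density; congr fine.
rewrite integral_mkcond; apply: eq_integral => x _.
rewrite /integrand prod_indic indicE patchE; case: ifP => _; last by rewrite mul0r.
rewrite mul1r pair_big_dep /=; congr (_%:E); apply: eq_bigl => -[i j].
by rewrite /edge /is_edge.
Qed.

Lemma eq_labelled_density n (e : rel 'I_n) (W W' : R * R -> R) :
  (forall x y, unitI x -> unitI y -> W (x, y) = W' (x, y)) ->
  labelled_density e W = labelled_density e W'.
Proof.
move=> E; apply: eq_integral => x _; rewrite /integrand prod_indic indicE.
have [xC|xC] := boolP (x \in unit_cube R n); last by rewrite !mul0r.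
rewrite !mul1r; congr (_%:E); apply: eq_bigr => i _; apply: eq_bigr => j _.
by move/set_mem: xC => xC; apply: E; rewrite /= in_itv /=; exact: xC.
Qed.

(** A tournamenton only matters on the unit square; extended by 0 it is
    measurable and bounded everywhere. *)
Definition kernel_fun (W : R * R -> R) :=
  [/\ measurable_fun setT W, forall p, 0 <= W p <= 1
    & forall x y, unitI x -> unitI y -> W (x, y) + W (y, x) = 1].

Lemma tournamenton_kernel (W : R * R -> R) : tournamenton W ->
  exists2 W', kernel_fun W' &
    forall n (e : rel 'I_n), labelled_density e W = labelled_density e W'.
Proof.
move=> [mW W01 W1]; pose D := unitI `*` unitI.
have WD x y : unitI x -> unitI y -> (W \_ D) (x, y) = W (x, y).
  by move=> x01 y01; rewrite patchE mem_set.
exists (W \_ D).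
  split.
  - apply/(measurable_restrictT W); last exact: mW.
    by apply: measurableX; exact: measurable_itv.
  - move=> [x y]; rewrite patchE; case: ifP => [/set_mem[/= x01 y01]|_].
      by apply: W01; move: x01 y01; rewrite !in_itv.
    by rewrite lexx ler01.
  - move=> x y x01 y01; rewrite !WD //.
    by apply: W1; move: x01 y01; rewrite /= !in_itv.
move=> n e; apply: eq_labelled_density => x y x01 y01; by rewrite WD.
Qed.

Section Kernel.
Variable W : R * R -> R.
Hypothesis kW : kernel_fun W.

Lemma integrand_ge0 n (e : rel 'I_n) x : 0 <= integrand e W x.
Proof.
have [_ W01 _] := kW; rewrite /integrand prod_indic mulr_ge0 // ?indicE ?ler0n //.
by apply: prodr_ge0 => i _; apply: prodr_ge0 => j _; case/andP: (W01 (tnth x i, tnth x j)).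
Qed.

Lemma integrand_le n (e : rel 'I_n) x : integrand e W x <= \1_(unit_cube R n) x.
Proof.
have [_ W01 _] := kW; rewrite /integrand prod_indic -[leRHS]mulr1.
rewrite ler_wpM2l ?indicE ?ler0n //; apply: prodr_ile1 => i _.
rewrite prodr_ge0 /=; last by move=> j _; case/andP: (W01 (tnth x i, tnth x j)).
by apply: prodr_ile1 => j _; exact: W01.
Qed.

Lemma measurable_integrand n (e : rel 'I_n) : measurable_fun setT (integrand e W).
Proof.
have [mW _ _] := kW; apply: measurable_funM.
  apply: measurable_prod => i _.
  have mI : measurable_fun setT (\1_unitI : R -> R) by exact: measurable_indic.
  exact: (measurableT_comp mI (measurable_tnth i)).
apply: measurable_prod => i _; under eq_fun do rewrite big_mkcond.
apply: measurable_prod => j _; case: (e i j); last exact: measurable_cst.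
apply: measurableT_comp => //.
by apply: measurable_fun_pair; exact: measurable_tnth.
Qed.

Lemma measurable_EFin_integrand n (e : rel 'I_n) :
  measurable_fun setT (EFin \o integrand e W).
Proof. by apply/measurable_EFinP; exact: measurable_integrand. Qed.

Lemma tuple_lebesgue_cube n : tuple_lebesgue (unit_cube R n) = 1%E.
Proof.
have -> : unit_cube R n = box (fun=> unitI).
  by apply/seteqP; split=> x h i; have := h i; rewrite /= in_itv.
rewrite tuple_lebesgue_box => [|i]; last exact: measurable_itv.
rewrite big1 // => i _; rewrite lebesgue_measure_itv /= lte_fin ltr01.
by rewrite oppr0 adde0.
Qed.

Lemma measurable_cube n : measurable (unit_cube R n).
Proof.
have -> : unit_cube R n = box (fun=> unitI).
  by apply/seteqP; split=> x h i; have := h i; rewrite /= in_itv.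
by apply: measurable_box => i; exact: measurable_itv.
Qed.

Lemma labelled_density01 n (e : rel 'I_n) : (0 <= labelled_density e W <= 1)%E.
Proof.
rewrite integral_ge0 /=; last by move=> x _; rewrite lee_fin integrand_ge0.
rewrite -(tuple_lebesgue_cube n) -[X in tuple_lebesgue X]setIT.
rewrite -integral_indic //; last exact: measurable_cube.
apply: ge0_le_integral => //.
- by move=> x _; rewrite lee_fin integrand_ge0.
- exact: measurable_EFin_integrand.
- by apply/measurable_EFinP; apply: measurable_indic; exact: measurable_cube.
- by move=> x _; rewrite lee_fin integrand_le.
Qed.

Lemma labelled_density_fin n (e : rel 'I_n) : labelled_density e W \is a fin_num.
Proof.
have /andP[ge0 le1] := labelled_density01 e.
by rewrite ge0_fin_numE // (le_lt_trans le1) // ltry.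
Qed.

(** Relabelling the vertices permutes the coordinates, which preserves the
    measure of boxes. *)
Lemma labelled_density_perm n (e e' : rel 'I_n) (s : 'S_n) :
  (forall i j, e' (s i) (s j) = e i j) -> labelled_density e' W = labelled_density e W.
Proof.
move=> he; pose phi (x : n.-tuple R) := [tuple tnth x (s i) | i < n].
have mphi : measurable_fun setT phi.
  apply/measurable_fun_tnthP => i.
  rewrite (_ : _ \o _ = fun x => tnth x (s i)); first exact: measurable_tnth.
  by apply/funext => x /=; rewrite tnth_mktuple.
have sb : bijective s by exists (s^-1)%g; [exact: permK|exact: permKV].
pose nu := HB.pack_for {measure set (n.-tuple R) -> \bar R}
  (pushforward (@tuple_lebesgue R n) phi).
have nuE B : measurable B -> nu mphi B = tuple_lebesgue B.
  apply: tuple_measure_unique => A mA; last exact: tuple_lebesgue_box.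
  rewrite /nu /= /pushforward.
  have -> : phi @^-1` box A = box (fun i => A ((s^-1)%g i)).
    apply/seteqP; split=> x /= h i.
      by have := h ((s^-1)%g i); rewrite tnth_mktuple permKV.
    by rewrite tnth_mktuple; have := h (s i); rewrite permK.
  rewrite tuple_lebesgue_box // (reindex s) /=; last exact: onW_bij.
  by apply: eq_bigr => i _; rewrite permK.
have -> : labelled_density e W = (\int[nu mphi]_x (integrand e W x)%:E)%E.
  apply: eq_measure_integral => B mB _; exact/esym/nuE.
rewrite /nu /= ge0_integral_pushforward //.
- rewrite preimage_setT; apply: eq_integral => x _ /=; congr (_%:E).
  rewrite /integrand; congr (_ * _).
    by rewrite (reindex s (onW_bij _ sb)); apply: eq_bigr => i _; rewrite tnth_mktuple.
  rewrite (reindex s (onW_bij _ sb)); apply: eq_bigr => i _.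
  rewrite (reindex s (onW_bij _ sb)); apply: eq_big => [j|j _]; first exact: he.
  by rewrite !tnth_mktuple.
- exact: measurable_EFin_integrand.
- by move=> x _; rewrite lee_fin integrand_ge0.
Qed.

End Kernel.

Lemma density01 (T : tourn) (W : R * R -> R) : tournamenton W -> 0 <= density T W <= 1.
Proof.
move=> /tournamenton_kernel[W' kW' E]; rewrite density_labelled E.
have /andP[ge0 le1] := labelled_density01 kW' (@edge T).
by rewrite -!lee_fin fineK ?labelled_density_fin // ge0.
Qed.

End LabelledDensity.

(** * Products of densities *)

Section DensityProduct.
Variables (R : realType) (W : R * R -> R).
Hypothesis kW : kernel_fun W.
Variables (m n : nat) (e1 : rel 'I_m) (e2 : rel 'I_n).
Local Notation unitI := (`[0%R, 1%R]%classic : set R).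

(** The tournaments that extend the disjoint union of [e1] and [e2]; [X] tells
    which cross pairs are directed from the first part to the second one. *)
Definition cross_rel (X : {ffun 'I_m * 'I_n -> bool}) : rel 'I_(m + n) :=
  fun i j => match fintype.split i, fintype.split j with
             | inl a, inl b => e1 a b
             | inr a, inr b => e2 a b
             | inl a, inr b => X (a, b)
             | inr b, inl a => ~~ X (a, b)
             end.

Definition left_part (z : (m + n).-tuple R) := [tuple tnth z (lshift n i) | i < m].
Definition right_part (z : (m + n).-tuple R) := [tuple tnth z (rshift m i) | i < n].

Lemma measurable_left_part : measurable_fun setT left_part.
Proof.
apply/measurable_fun_tnthP => i.
rewrite (_ : _ \o _ = fun z => tnth z (lshift n i)); first exact: measurable_tnth.
by apply/funext => z /=; rewrite tnth_mktuple.
Qed.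

Lemma measurable_right_part : measurable_fun setT right_part.
Proof.
apply/measurable_fun_tnthP => i.
rewrite (_ : _ \o _ = fun z => tnth z (rshift m i)); first exact: measurable_tnth.
by apply/funext => z /=; rewrite tnth_mktuple.
Qed.

(** Exactly one of the two orientations of each cross pair is chosen in each
    term: expand the product of the factors [W(x, y) + W(y, x) = 1]. *)
Lemma integrand_cross z :
  integrand e1 W (left_part z) * integrand e2 W (right_part z) =
  \sum_X integrand (cross_rel X) W z.
Proof.
have [_ _ W1] := kW.
pose t i := tnth z i; pose l i := t (lshift n i); pose r i := t (rshift m i).
pose E1 := \prod_i \prod_(j | e1 i j) W (l i, l j).
pose E2 := \prod_i \prod_(j | e2 i j) W (r i, r j).
pose C (X : {ffun 'I_m * 'I_n -> bool}) :=
  \prod_p (if X p then W (l p.1, r p.2) else W (r p.2, l p.1)).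
have XE X : integrand (cross_rel X) W z =
    (\prod_i \1_unitI (t i)) * (E1 * E2 * C X).
  rewrite /integrand; congr (_ * _); rewrite big_split_ord /=.
  have -> : \prod_(i < m) \prod_(j | cross_rel X (lshift n i) j)
      W (tnth z (lshift n i), tnth z j) =
      E1 * \prod_i \prod_j (if X (i, j) then W (l i, r j) else 1).
    rewrite -big_split; apply: eq_bigr => i _ /=.
    rewrite big_mkcond big_split_ord /= [in RHS]big_mkcond /=.
    by congr (_ * _); apply: eq_bigr => j _;
      rewrite /cross_rel ?(unsplitK (inl _)) ?(unsplitK (inr _)).
  have -> : \prod_(i < n) \prod_(j | cross_rel X (rshift m i) j)
      W (tnth z (rshift m i), tnth z j) =
      (\prod_i \prod_j (if X (i, j) then 1 else W (r j, l i))) * E2.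
    rewrite exchange_big -big_split; apply: eq_bigr => i _ /=.
    rewrite big_mkcond big_split_ord /= [X in _ = _ * X]big_mkcond /=.
    congr (_ * _); apply: eq_bigr => j _;
      rewrite /cross_rel ?(unsplitK (inl _)) ?(unsplitK (inr _)) //.
    by case: (X _).
  rewrite [LHS](_ : _ = E1 * E2 *
      ((\prod_i \prod_j (if X (i, j) then W (l i, r j) else 1)) *
       \prod_i \prod_j (if X (i, j) then 1 else W (r j, l i)))); last by ring.
  have -> : C X = \prod_i \prod_j (if X (i, j) then W (l i, r j) else W (r j, l i)).
    by rewrite pair_big; apply: eq_bigr => -[i j].
  congr (_ * _); rewrite -big_split; apply: eq_bigr => i _; rewrite -big_split /=; apply: eq_bigr => j _.
  by case: (X _); rewrite ?mulr1 ?mul1r.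
under eq_bigr => X _ do rewrite XE.
rewrite -big_distrr -big_distrr /=.
have -> : integrand e1 W (left_part z) * integrand e2 W (right_part z) =
    (\prod_i \1_unitI (t i)) * (E1 * E2).
  have -> : integrand e1 W (left_part z) = (\prod_i \1_unitI (l i)) * E1.
    rewrite /integrand; congr (_ * _); apply: eq_bigr => i _; first by rewrite tnth_mktuple.
    by apply: eq_bigr => j _; rewrite !tnth_mktuple.
  have -> : integrand e2 W (right_part z) = (\prod_i \1_unitI (r i)) * E2.
    rewrite /integrand; congr (_ * _); apply: eq_bigr => i _; first by rewrite tnth_mktuple.
    by apply: eq_bigr => j _; rewrite !tnth_mktuple.
  rewrite big_split_ord /= -/l -/r; ring.
have [zI|] := boolP [forall i, t i \in unitI].
  rewrite [X in _ = _ * (_ * X)](_ : _ = 1) ?mulr1 //.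
  transitivity (\prod_p \sum_b (if b then W (l p.1, r p.2) else W (r p.2, l p.1))).
    by rewrite bigA_distr_bigA.
  rewrite big1 // => p _; rewrite big_bool /=.
  by move/forallP: zI => zI; apply: W1; apply/set_mem/zI.
case/forallPn => i ti; rewrite (bigD1 i) //= indicE (negbTE ti).
by rewrite !mul0r.
Qed.

(** Concatenation of tuples carries the product of the measures to the measure on
    longer tuples, as can be checked on boxes. *)
Lemma labelled_density_mul :
  (labelled_density e1 W * labelled_density e2 W)%E =
  (\int[@tuple_lebesgue R (m + n)]_z
    (integrand e1 W (left_part z) * integrand e2 W (right_part z))%:E)%E.
Proof.
pose phi (p : m.-tuple R * n.-tuple R) : (m + n).-tuple R := [tuple of p.1 ++ p.2].
have phil p i : tnth (phi p) (lshift n i) = tnth p.1 i by rewrite tnth_lshift.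
have phir p i : tnth (phi p) (rshift m i) = tnth p.2 i by rewrite tnth_rshift.
have mphi : measurable_fun setT phi.
  apply/measurable_fun_tnthP => i; case: (split_ordP i) => j ->.
    rewrite (_ : _ \o _ = (fun x => tnth x j) \o fst); last first.
      by apply/funext => p /=; rewrite phil.
    by apply: measurableT_comp => //; exact: measurable_tnth.
  rewrite (_ : _ \o _ = (fun x => tnth x j) \o snd); last first.
    by apply/funext => p /=; rewrite phir.
  by apply: measurableT_comp => //; exact: measurable_tnth.
pose mun : {sigma_finite_measure set (n.-tuple R) -> \bar R} := @tuple_lebesgue R n.
pose nu := HB.pack_for {measure set ((m + n).-tuple R) -> \bar R}
  (pushforward (@tuple_lebesgue R m \x mun)%E phi).
have nuE B : measurable B -> nu mphi B = tuple_lebesgue B.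
  apply: tuple_measure_unique => A mA; last exact: tuple_lebesgue_box.
  rewrite /nu /= /pushforward.
  have -> : phi @^-1` box A =
      box (fun i => A (lshift n i)) `*` box (fun i => A (rshift m i)).
    apply/seteqP; split=> [x /= h|x [/= h1 h2] i].
      by split=> /= i; [rewrite -phil|rewrite -phir]; exact: h.
    by case: (split_ordP i) => j ->; [rewrite phil|rewrite phir].
  rewrite product_measure1E; [|exact: measurable_box..].
  by rewrite [in LHS]/= !tuple_lebesgue_box // big_split_ord.
have mI1 := measurable_integrand kW e1; have mI2 := measurable_integrand kW e2.
have -> : (\int[@tuple_lebesgue R (m + n)]_z
    (integrand e1 W (left_part z) * integrand e2 W (right_part z))%:E =
    \int[nu mphi]_z
    (integrand e1 W (left_part z) * integrand e2 W (right_part z))%:E)%E.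
  by apply: eq_measure_integral => B mB _; exact/esym/nuE.
rewrite /nu /= ge0_integral_pushforward //; last 2 first.
- apply/measurable_EFinP/measurable_funM.
    by apply: measurableT_comp => //; exact: measurable_left_part.
  by apply: measurableT_comp => //; exact: measurable_right_part.
- by move=> z _; rewrite lee_fin mulr_ge0 // integrand_ge0.
rewrite preimage_setT.
have -> : (EFin \o (fun z => integrand e1 W (left_part z) * integrand e2 W (right_part z)))
    \o phi = fun p => (integrand e1 W p.1 * integrand e2 W p.2)%:E.
  apply/funext => p /=; congr (_ * _)%:E; congr (integrand _ W).
    by apply: eq_from_tnth => i; rewrite tnth_mktuple phil.
  by apply: eq_from_tnth => i; rewrite tnth_mktuple phir.
rewrite fubini_tonelli1 /=; last 2 first.
- apply/measurable_EFinP/measurable_funM.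
    by apply: measurableT_comp.
  by apply: measurableT_comp.
- by move=> p; rewrite lee_fin mulr_ge0 // integrand_ge0.
rewrite /labelled_density /fubini_F /=.
under [RHS]eq_integral => x _.
  under eq_integral => y _ do rewrite EFinM.
  rewrite ge0_integralZl ?lee_fin ?integrand_ge0 //; last 2 first.
    exact: measurable_EFin_integrand.
    by move=> y _; rewrite lee_fin integrand_ge0.
  over.
rewrite ge0_integralZr //.
- exact: measurable_EFin_integrand.
- by move=> x _; rewrite lee_fin integrand_ge0.
- by apply: integral_ge0 => x _; rewrite lee_fin integrand_ge0.
Qed.

Lemma labelled_density_mul_sum :
  fine (labelled_density e1 W) * fine (labelled_density e2 W) =
  \sum_X fine (labelled_density (cross_rel X) W).
Proof.
rewrite -fineM ?labelled_density_fin // labelled_density_mul.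
under eq_integral => z _ do rewrite integrand_cross -sumEFin.
rewrite ge0_integral_sum //; last 2 first.
- by move=> X; exact: measurable_EFin_integrand.
- by move=> X z _; rewrite lee_fin integrand_ge0.
rewrite (eq_bigr (fun X => (fine (labelled_density (cross_rel X) W))%:E)) => [|X _].
  by rewrite sumEFin.
by rewrite fineK // labelled_density_fin.
Qed.

End DensityProduct.

(** * Step kernels are tournamentons *)

Section StepTournamenton.
Variables (R : realType) (U : finType).
Local Notation unitI := (`[0%R, 1%R]%classic : set R).
Local Notation leb := (@lebesgue_measure R).

(** Cut the line at [a], [a + z u1], [a + z u1 + z u2] and so on, and return the
    part of [x]; the last part is unbounded. *)
Fixpoint locate (z : U -> R) (u : U) (s : seq U) (a x : R) : U :=
  match s with
  | [::] => u
  | v :: s' => if x < a + z u then u else locate z v s' (a + z u) x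
  end.

Lemma locate_mem z u s a x : locate z u s a x \in u :: s.
Proof.
elim: s u a => [|v s ih] u a /=; first exact: mem_head.
by case: ifP => _; rewrite inE ?eqxx // ih orbT.
Qed.

Lemma measurable_locate z u s a w : measurable [set x | locate z u s a x = w].
Proof.
elim: s u a => [|v s ih] u a /=.
  have [->|uw] := eqVneq u w.
    by rewrite (_ : [set _ | _] = setT) //; exact/seteqP.
  rewrite (_ : [set _ | _] = set0) //; apply/seteqP; split=> x //=.
  by move/eqP; rewrite (negbTE uw).
rewrite (_ : [set _ | _] = (`]-oo, (a + z u)[%classic `&` [set _ | u = w]) `|`
  (`[(a + z u), +oo[%classic `&` [set x | locate z v s (a + z u) x = w])).
  apply: measurableU; apply: measurableI; rewrite ?ih //; try exact: measurable_itv.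
  have [->|uw] := eqVneq u w.
    by rewrite (_ : [set _ | _] = setT) //; exact/seteqP.
  rewrite (_ : [set _ | _] = set0) //; apply/seteqP; split=> x //=.
  by move/eqP; rewrite (negbTE uw).
apply/seteqP; split=> x /=; rewrite !in_itv /= ?andbT.
  by case: ltP => h E; [left|right].
by case: ltP => h [[]|[]].
Qed.

Lemma measure_locate z u s a w : (forall v, 0 <= z v) -> uniq (u :: s) -> w \in u :: s ->
  leb (`[a, a + \sum_(v <- u :: s) z v]%classic `&` [set x | locate z u s a x = w]) = (z w)%:E.
Proof.
move=> z0; elim: s u a => [|v s ih] u a.
  rewrite mem_seq1 big_seq1 => _ /eqP -> /=.
  rewrite (_ : _ `&` _ = `[a, a + z u]%classic); last first.
    by apply/seteqP; split=> x //= [].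
  rewrite lebesgue_measure_itv /= lte_fin ltrDl lt0r z0 andbT.
  by case: eqVneq => [->|_] //=; rewrite -EFinB addrC addKr.
move=> /[dup] us /andP[uN us']; rewrite inE => /predU1P[->|ws].
  rewrite (_ : _ `&` _ = `[a, a + z u[%classic); last first.
    apply/seteqP; split=> x /=; rewrite !in_itv /=.
      move=> [/andP[-> _]]; case: ltP => //= _ E.
      by move: uN; rewrite -E locate_mem.
    move=> /andP[-> h]; rewrite h; split=> //=; apply: ltW.
    by rewrite big_cons (lt_le_trans h) // lerD2l lerDl sumr_ge0.
  rewrite lebesgue_measure_itv /= lte_fin ltrDl lt0r z0 andbT.
  by case: eqVneq => [->|_] //=; rewrite -EFinB addrC addKr.
rewrite -(ih v (a + z u)) //; congr (leb _); apply/seteqP; split=> x /=.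
  rewrite !in_itv /= big_cons addrA => -[/andP[h1 h2]]; case: ltP => // h3 E.
  by move: uN; rewrite E ws.
rewrite !in_itv /= [\sum_(_ <- u :: _) _]big_cons addrA => -[/andP[h1 h2] E].
by rewrite h2 ltNge h1 (le_trans _ h1) // lerDl.
Qed.

Lemma step_partition (z : U -> R) : (forall v, 0 < z v) -> \sum_v z v = 1 ->
  exists c : R -> U, forall w, measurable [set x | c x = w] /\
    leb (unitI `&` [set x | c x = w]) = (z w)%:E.
Proof.
move=> z0 z1; have [u0 _] : exists u : U, True.
  have [u _|h] := pickP (fun _ : U => true); first by exists u.
  by move: z1; rewrite big_pred0 // => /eqP; rewrite eq_sym oner_eq0.
case E : (enum U) (mem_enum U u0) => [|u s] //= _.
exists (locate z u s 0) => w; split; first exact: measurable_locate.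
rewrite -(measure_locate (u := u) (s := s) 0) => [|v||].
- by rewrite -E big_enum /= z1 add0r.
- exact: ltW.
- by rewrite -E enum_uniq.
- by rewrite -E mem_enum.
Qed.

Variables (M : U -> U -> R) (z : U -> R).
Hypotheses (Mz : step_data M z) (z1 : \sum_u z u = 1).

(** The integrand is constant on the boxes of points whose coordinates lie in
    prescribed parts. *)
Theorem step_tournamenton : exists2 W : R * R -> R, tournamenton W &
  forall T : tourn, density T W = hom M z (@edge T).
Proof.
have [M1 M01 z0] := Mz; have [c cP] := step_partition z0 z1.
pose W (p : R * R) := M (c p.1) (c p.2).
have mc w : measurable [set x | c x = w] by case: (cP w).
have mW : measurable_fun setT W.
  rewrite (_ : W = fun p => \sum_u \sum_v M u v *
      (\1_[set x | c x = u] p.1 * \1_[set x | c x = v] p.2)); last first.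
    apply/funext => p; rewrite (bigD1 (c p.1)) //= (bigD1 (c p.2)) //=.
    rewrite !indicE !mem_set // !mulr1 !big1 ?addr0 // => [u uc|v vc].
      rewrite big1 // => v _; rewrite !indicE memNset ?mul0r ?mulr0 // => /= E.
      by case/eqP: uc.
    rewrite !indicE (@memNset _ [set x | c x = v] p.2) ?mulr0 // => /= E.
    by case/eqP: vc.
  apply: measurable_sum => u; apply: measurable_sum => v.
  apply: measurable_funM; first exact: measurable_cst.
  have mI w : measurable_fun setT (\1_[set x | c x = w] : R -> R).
    exact: measurable_indic.
  by apply: measurable_funM; apply: measurableT_comp.
exists W.
  split.
  - exact: measurable_funTS.
  - by move=> x y _ _; exact: M01.
  - by move=> x y _ _; exact: M1.
move=> T; rewrite density_labelled; set n := tsize T.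
pose B (f : {ffun 'I_n -> U}) := box (fun i => unitI `&` [set x | c x = f i]).
pose K (f : {ffun 'I_n -> U}) := \prod_i \prod_(j | @edge T i j) M (f i) (f j).
have mA (f : {ffun 'I_n -> U}) i : measurable (unitI `&` [set x | c x = f i]).
  by apply: measurableI => //; exact: measurable_itv.
have K0 f : 0 <= K f.
  by apply: prodr_ge0 => i _; apply: prodr_ge0 => j _; case/andP: (M01 (f i) (f j)).
have IE x : integrand (@edge T) W x = \sum_f K f * \1_(B f) x.
  pose f0 : {ffun 'I_n -> U} := [ffun i => c (tnth x i)].
  rewrite (bigD1 f0) //= big1 ?addr0 => [|f ff0]; last first.
    rewrite indicE memNset ?mulr0 // => xB; case/eqP: ff0; apply/ffunP => i.
    by rewrite ffunE; have [_ /= ->] := xB i.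
  rewrite /integrand prod_indic mulrC; congr (_ * _).
    by apply: eq_bigr => i _; apply: eq_bigr => j _; rewrite /W /= !ffunE.
  rewrite !indicE; congr (_%:R); congr nat_of_bool; apply/idP/idP.
    move=> /set_mem xC; apply/mem_set => i; split; last by rewrite /= ffunE.
    by rewrite /= in_itv /=; exact: xC.
  move=> /set_mem xB; apply/mem_set => i; have [+ _] := xB i.
  by rewrite /= in_itv.
rewrite /labelled_density; under eq_integral => x _ do rewrite IE -sumEFin.
have mB f : measurable (B f) by exact: measurable_box.
rewrite ge0_integral_sum //; last 2 first.
- move=> f; apply/measurable_EFinP; apply: measurable_funM; first exact: measurable_cst.
  exact: measurable_indic.
- by move=> f x _; rewrite lee_fin mulr_ge0 // indicE ler0n.
rewrite (eq_bigr (fun f => (K f * \prod_i z (f i))%:E)) => [|f _].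
  by rewrite sumEFin /= /hom; apply: eq_bigr => f _; rewrite mulrC.
under eq_integral => x _ do rewrite EFinM.
rewrite ge0_integralZl ?lee_fin //; last first.
  by apply/measurable_EFinP; exact: measurable_indic.
rewrite integral_indic // setIT EFinM; congr (_ * _)%E.
apply: (etrans (tuple_lebesgue_box (mA f))); rewrite -prodEFin; apply: eq_bigr => i _.
by case: (cP (f i)).
Qed.

End StepTournamenton.

(** * An open set of Lyndon density vectors *)

Lemma vertex_letter : exists C : letter, tsize (val C) = 1%N.
Proof.
have P : @is_tournament 1 finset.set0.
  by apply/forallP => x; apply/forallP => y; rewrite !inE (ord1 x) (ord1 y) eqxx.
pose T : tourn := Tagged tclass (\pi_(tclass 1) (Tournament P))%qT.
have sT : strongly_connected T.
  apply/andP; split=> //; apply/forallP => x; apply/forallP => y.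
  have -> : x = y by rewrite (ord1 x) (ord1 y).
  exact: connect0.
by exists (exist _ T sT).
Qed.

Lemma tourn_size1_vertex (T : tourn) : tsize T = 1%N ->
  exists v0 : 'I_(tsize T), forall v, v = v0.
Proof.
rewrite /tsize; case: T => n c /= E; rewrite E; exists ord0 => v; exact: ord1.
Qed.

Lemma hom_vertex (K : comNzRingType) (U : finType) (M : U -> U -> K) z (T : tourn) :
  tsize T = 1%N -> hom M z (@edge T) = \sum_u z u.
Proof.
move=> /tourn_size1_vertex[v0 v0E]; rewrite /hom.
rewrite (reindex (fun u => [ffun _ : 'I_(tsize T) => u])) /=; last first.
  exists (fun f : {ffun 'I_(tsize T) -> U} => f v0) => [u _|f _]; first by rewrite ffunE.
  by apply/ffunP => v; rewrite ffunE (v0E v).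
apply: eq_bigr => u _; rewrite (bigD1 v0) //= ffunE big1 ?mulr1 => [|v]; last first.
  by rewrite (v0E v) eqxx.
rewrite big1 ?mulr1 // => x _; rewrite big_pred0 // => y.
by rewrite (v0E x) (v0E y) (edge_tournament v0 v0) eqxx.
Qed.

Lemma eball_coord (R : realType) (I : finType) (x0 x : {ffun I -> R}) eps i :
  eball x0 eps x -> `|x i - x0 i| < eps.
Proof.
rewrite /eball /= => h; apply: le_lt_trans h; rewrite -sqrtr_sqr ler_wsqrtr //.
by rewrite (bigD1 i) //= lerDl sumr_ge0 // => j _; exact: sqr_ge0.
Qed.

Lemma tourn_of_inj k : injective (@tourn_of k).
Proof.
move=> [i c] [j d] /= E; have [ij] := congr1 tag E.
have {}ij : i = j by exact: val_inj.
subst j; congr existT.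
exact: (eq_from_Tagged E).
Qed.

(** The density of the single vertex is the total mass; it is solved for together
    with the others, so that the solution can be normalized. *)
Theorem lyndon_densities_open (R : realType) (le : rel letter) (hle : letter_order le)
    (k : nat) :
  exists x0 : {ffun lyndon_le le k -> R}, exists eps : R,
    [/\ icube R (lyndon_le le k) x0, 0 < eps,
        eball x0 eps `<=` icube R (lyndon_le le k)
      & forall x : {ffun lyndon_le le k -> R}, eball x0 eps x ->
          exists2 W : R * R -> R, tournamenton W &
            forall T : lyndon_le le k, density (tourn_of (val T)) W = x T].
Proof.
have [le_r le_a le_t le_o _] := hle.
pose I := lyndon_le le k; pose tT (T : I) := tourn_of (val T).
have ex (T : I) : exists w, tT T = word_tourn w /\ lyndon_word le w.
  by have /andP[_ /asboolP[w E L]] := valP T; exists w.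
have [w0 w0P] := choice ex.
have [C C1] := vertex_letter.
pose w (i : option I) := if i is Some T then w0 T else [:: C].
have tC : word_tourn [:: C] = word_tourn (w None) by [].
have sC : tsize (word_tourn [:: C]) = 1%N by rewrite tsize_word_tourn big_seq1.
have wE T : word_tourn (w (Some T)) = tT T by case: (w0P T).
have big2 T : (1 < tsize (tT T))%N by have /andP[] := valP T.
have w_inj : injective w.
  move=> [T|] [T'|] // E.
  - congr Some; apply: val_inj; apply: tourn_of_inj.
    by rewrite -[LHS]wE -[RHS]wE E.
  - by have := big2 T; rewrite -wE E -tC sC.
  - by have := big2 T'; rewrite -wE -E -tC sC.
have wL i : lyndon_word le (w i).
  case: i => [T|]; first by case: (w0P T).
  split=> // u v /(congr1 size); rewrite size_cat /=.
  by case: u => // a u; case: v => // b v /=; rewrite addnS.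
have [U [M [z [Mz rank]]]] := lyndon_full_rank R le_r le_a le_t le_o w_inj wL.
have [M1 M01 z0] := Mz.
pose e i := @edge (word_tourn (w i)).
have [eps eps0 sur] := @step_local_surjectivity R U M z _ _ e z0 rank.
pose s := \sum_u z u.
have homC z' : hom M z' (@e None) = \sum_u z' u by exact: hom_vertex.
have s0 : 0 < s.
  rewrite lt0r sumr_ge0 ?andbT => [|u _]; last exact: ltW.
  apply/negP => /eqP s0.
  have noU (u : U) : False.
    by have := z0 u; rewrite ltNge -s0 /s (bigD1 u) //= lerDl sumr_ge0 // => v _; exact: ltW.
  have [|z' _ /(_ None)] := sur (fun i => hom M z (@e i) + eps).
    by move=> i; rewrite addrAC subrr add0r gtr0_norm.
  rewrite !homC big1 => [|u]; last by case: (noU u).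
  by move=> /esym/eqP; rewrite -/s s0 add0r gt_eqF.
pose hT (T : I) := hom M z (@e (Some T)).
pose x0 : {ffun I -> R} := [ffun T => hT T / s ^+ tsize (tT T)].
pose q := 1 + \sum_T s ^+ tsize (tT T).
have q0 : 0 < q by rewrite ltr_pwDl // sumr_ge0 // => T _; rewrite exprn_ge0 // ltW.
have main (x : {ffun I -> R}) : eball x0 (eps / q) x ->
    exists2 W : R * R -> R, tournamenton W & forall T : I, density (tT T) W = x T.
  move=> xb.
  pose y (i : option I) := if i is Some T then x T * s ^+ tsize (tT T) else s.
  have [|z' z'0 z'y] := sur y.
    case=> [T|]; last by rewrite homC subrr normr0 ltW.
    have sT : 0 < s ^+ tsize (tT T) by rewrite exprn_gt0.
    have := eball_coord T xb; rewrite ffunE -/(hT T) => h.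
    have -> : y (Some T) - hom M z (@e (Some T)) =
        (x T - hT T / s ^+ tsize (tT T)) * s ^+ tsize (tT T).
      by rewrite mulrBl divfK // gt_eqF.
    rewrite normrM (gtr0_norm sT); apply: (le_trans (y := eps / q * q)).
      apply: ler_pM => //; [exact: ltW|exact: ltW|].
      rewrite /q (bigD1 T) //= addrCA lerDl addr_ge0 // sumr_ge0 // => T' _.
      by rewrite exprn_ge0 // ltW.
    by rewrite divfK // gt_eqF.
  pose z'' u := s^-1 * z' u.
  have Mz'' : step_data M z''.
    by split=> // u; rewrite mulr_gt0 // invr_gt0.
  have z''1 : \sum_u z'' u = 1.
    by rewrite -big_distrr /= -homC z'y mulVf // gt_eqF.
  have [W tW WE] := step_tournamenton Mz'' z''1.
  exists W => // T; rewrite WE -wE hom_scale card_ord wE.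
  have := z'y (Some T); rewrite /e wE => ->.
  by rewrite exprVn mulrC mulfK // expf_neq0 // gt_eqF.
have sub : eball x0 (eps / q) `<=` icube R I.
  move=> x /main[W tW WE] T; rewrite -WE; exact: density01.
have eq0 : 0 < eps / q by rewrite divr_gt0.
exists x0, (eps / q); split=> //.
apply: sub; rewrite /eball /= big1 ?sqrtr0 // => T _.
by rewrite subrr expr0n.
Qed.

(** * Products of densities as sums over tournaments *)

Definition tourn_of_rel n (e : rel 'I_n) (he : tournament_rel e) : tourn :=
  Tagged tclass (\pi_(tclass n) (Tournament (tournament_of_rel he)))%qT.

Lemma tourn_of_rel_perm n (e : rel 'I_n) (he : tournament_rel e) :
  exists s : 'S_n, forall i j, @edge (tourn_of_rel he) (s i) (s j) = e i j.
Proof.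
have [s hs] := repr_pi_perm (Tournament (tournament_of_rel he)).
by exists s => i j; rewrite /edge hs /is_edge inE.
Qed.

Lemma models_tourn_of_rel n (e : rel 'I_n) (he : tournament_rel e) :
  models e [set: 'I_n] (tourn_of_rel he).
Proof.
have [s hs] := tourn_of_rel_perm he; exists (s^-1)%g; split=> //.
- exact: perm_inj.
- apply/setP => x; rewrite inE; apply/esym/imsetP; exists (s x) => //.
  by rewrite permK.
- by move=> i j; rewrite -hs !permKV.
Qed.

Section CrossTournaments.
Variables T1 T2 : tourn.
Local Notation m := (tsize T1).
Local Notation n := (tsize T2).
Implicit Type X : {ffun 'I_m * 'I_n -> bool}.

Lemma cross_rel_tournament X : tournament_rel (cross_rel (@edge T1) (@edge T2) X).
Proof.
move=> i j; rewrite /cross_rel.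
case: (split_ordP i) => a ->; case: (split_ordP j) => b ->;
  rewrite ?(unsplitK (inl _)) ?(unsplitK (inr _)).
- by rewrite (edge_tournament a b) (inj_eq (@lshift_inj _ _)).
- by rewrite eq_lrshift negbK.
- by rewrite eq_rlshift.
- by rewrite (edge_tournament a b) (inj_eq (@rshift_inj _ _)).
Qed.

Definition cross_tourn X := tourn_of_rel (cross_rel_tournament X).

Lemma density_mul (R : realType) (W : R * R -> R) : tournamenton W ->
  density T1 W * density T2 W = \sum_X density (cross_tourn X) W.
Proof.
move=> /tournamenton_kernel[W' kW' E]; rewrite !density_labelled !E.
rewrite labelled_density_mul_sum //; apply: eq_bigr => X _.
rewrite density_labelled E; have [s hs] := tourn_of_rel_perm (cross_rel_tournament X).
by rewrite (labelled_density_perm kW' hs).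
Qed.

Let left := [set lshift n i | i : 'I_m].

Lemma models_cross_left X : models (cross_rel (@edge T1) (@edge T2) X) left T1.
Proof.
exists (lshift n); split=> //; first exact: lshift_inj.
by move=> i j; rewrite /cross_rel !(unsplitK (inl _)).
Qed.

Lemma models_cross_right X :
  models (cross_rel (@edge T1) (@edge T2) X) ([set: 'I_(m + n)] :\: left) T2.
Proof.
exists (@rshift m n); split; first exact: rshift_inj.
  apply/setP => x; rewrite !inE andbT; apply/idP/imsetP => [xl|[j _ ->]].
    case: (split_ordP x) xl => j -> xl; last by exists j.
    by case/negP: xl; apply/imsetP; exists j.
  by apply/imsetP => -[i _ /eqP]; rewrite eq_rlshift.
by move=> i j; rewrite /cross_rel !(unsplitK (inr _)).
Qed.

(** The order by number of components, then by words, that drives the elimination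
    of non-Lyndon densities rests on this lemma and on [shuffle_max]. *)
Lemma cross_tourn_shuffle X u v w : T1 = word_tourn u -> T2 = word_tourn v ->
  cross_tourn X = word_tourn w ->
  (size w <= size u + size v)%N /\ (size w = (size u + size v)%N -> shuffle u v w).
Proof.
move=> E1 E2 E; have he := cross_rel_tournament X.
apply: (models_shuffle he (B := left) (A := [set: 'I_(m + n)])).
- exact: finset.subsetT.
- by rewrite -E1; exact: models_cross_left.
- by rewrite -E2; exact: models_cross_right.
- by rewrite -E; exact: models_tourn_of_rel.
Qed.

Lemma cross_tourn_cat u v : T1 = word_tourn u -> T2 = word_tourn v ->
  cross_tourn [ffun=> true] = word_tourn (u ++ v).
Proof.
move=> E1 E2; pose X : {ffun 'I_m * 'I_n -> bool} := [ffun=> true].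
have he := cross_rel_tournament X.
apply: (models_uniq (models_tourn_of_rel (cross_rel_tournament X))).
apply: (models_cat he (K := left)).
- exact: finset.subsetT.
- by rewrite -E1; exact: models_cross_left.
- by rewrite -E2; exact: models_cross_right.
- move=> x y /imsetP[i _ ->]; rewrite inE => /andP[yl _].
  case: (split_ordP y) yl => j -> yl.
    by case/negP: yl; apply/imsetP; exists j.
  by rewrite /cross_rel (unsplitK (inl _)) (unsplitK (inr _)) ffunE.
Qed.

End CrossTournaments.

Lemma density_vertex (R : realType) (W : R * R -> R) T : tournamenton W ->
  tsize T = 1%N -> density T W = 1.
Proof.
move=> /tournamenton_kernel[W' kW' E] /tourn_size1_vertex[v0 v0E].
rewrite density_labelled E /labelled_density.
rewrite (eq_integral (fun x => (\1_(unit_cube R (tsize T)) x)%:E)) => [|x _].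
  rewrite integral_indic //; last exact: measurable_cube.
  by rewrite setIT [X in fine X](_ : _ = 1%E) //; exact: tuple_lebesgue_cube.
rewrite /integrand prod_indic big1 ?mulr1 // => i _; rewrite big_pred0 // => j.
by rewrite (v0E i) (v0E j) (edge_tournament v0 v0) eqxx.
Qed.

(** * Polynomial expressions in the Lyndon densities *)

Import -(notations) mpoly.

Section PolynomialDensities.
Variables (R : realType) (le : rel letter) (k : nat).
Hypotheses (le_refl : reflexive le) (le_anti : antisymmetric le).
Hypotheses (le_tr : transitive le) (le_total : total le).
Local Notation I := (lyndon_le le k).

Definition lyndon_polynomial (F : (R * R -> R) -> R) :=
  exists p : multipoly R I, forall W, tournamenton W ->
    peval p [ffun S : I => density (tourn_of (val S)) W] = F W.

Lemma lyndon_polynomial_ext F G : (forall W, tournamenton W -> F W = G W) ->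
  lyndon_polynomial F -> lyndon_polynomial G.
Proof. by move=> E [p pF]; exists p => W tW; rewrite pF // E. Qed.

Lemma lyndon_polynomial_const c : lyndon_polynomial (fun=> c).
Proof. by exists (mpolyC _ c) => W _; rewrite /peval mevalC. Qed.

Lemma lyndon_polynomial_var (S : I) :
  lyndon_polynomial (fun W => density (tourn_of (val S)) W).
Proof.
exists (mpolyX R (mnm1 (enum_rank S))) => W _.
by rewrite /peval mevalXU ffunE enum_rankK.
Qed.

Lemma lyndon_polynomialD F G : lyndon_polynomial F -> lyndon_polynomial G ->
  lyndon_polynomial (fun W => F W + G W).
Proof.
move=> [p pF] [q qG]; exists (p + q) => W tW.
by rewrite /peval mevalD -!/(peval _ _) pF // qG.
Qed.

Lemma lyndon_polynomialM F G : lyndon_polynomial F -> lyndon_polynomial G ->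
  lyndon_polynomial (fun W => F W * G W).
Proof.
move=> [p pF] [q qG]; exists (p * q) => W tW.
by rewrite /peval mevalM -!/(peval _ _) pF // qG.
Qed.

Lemma lyndon_polynomial_sum (J : finType) (P : pred J) (F : J -> (R * R -> R) -> R) :
  (forall j, P j -> lyndon_polynomial (F j)) ->
  lyndon_polynomial (fun W => \sum_(j | P j) F j W).
Proof.
move=> FP; elim: (index_enum J) => [|j s ih].
  by apply: lyndon_polynomial_ext (lyndon_polynomial_const 0) => W _; rewrite big_nil.
case Pj: (P j).
  apply: lyndon_polynomial_ext (lyndon_polynomialD (FP j Pj) ih) => W _.
  by rewrite big_cons Pj.
by apply: lyndon_polynomial_ext ih => W _; rewrite big_cons Pj.
Qed.

Lemma lyndon_tourn_polynomial T w : T = word_tourn w -> lyndon_word le w ->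
  (1 < tsize T <= k)%N -> lyndon_polynomial (density T).
Proof.
case: T => -[//|n] c E wL /andP[n1 nk].
pose S0 : tourn_le k := existT (fun i : 'I_k => tclass i.+1) (Ordinal nk) c.
have S0P : (1 < tsize (tourn_of S0))%N && `[< lyndon le (tourn_of S0) >].
  by apply/andP; split=> //; apply/asboolP; exists w.
exact: (lyndon_polynomial_var (exist _ S0 S0P)).
Qed.

(** If the word of [T] is not a Lyndon word, cut it as [u ++ v] so that it is the
    largest shuffle of [u] and [v].  The product of the densities of the two parts
    is a positive multiple of the density of [T] plus densities of tournaments
    with fewer components, or with a smaller word of the same length. *)
Theorem density_lyndon_polynomial T : (0 < tsize T <= k)%N ->
  lyndon_polynomial (density T).
Proof.
have [word wordP] := choice word_tourn_exists.
pose prec T' T := (size (word T') < size (word T))%N ||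
  (size (word T') == size (word T)) && lexlt le (word T') (word T).
have prec_irr S : prec S S = false.
  by rewrite /prec ltnn eqxx /lexlt eqxx.
have prec_trans S1 S2 S3 : prec S1 S2 -> prec S2 S3 -> prec S1 S3.
  rewrite /prec => /orP[h1|/andP[/eqP h1 l1]] /orP[h2|/andP[/eqP h2 l2]]; try lia.
  rewrite h1 h2 eqxx ltnn /=; move: l1 l2.
  rewrite !lexltNge // => l1 l2; apply: contra l1 => l31.
  have [//|] := boolP (lexle le (word S2) (word S1)); rewrite -lexltNge // => /andP[_ l12].
  by move: l2; rewrite (lexle_trans le_refl le_anti le_tr l31 l12).
pose rank n (T : tourn) := #|[pred c : tclass n | prec (existT tclass n c) T]|.
have rank_lt n (S' S : tourn) : tsize S' = n -> prec S' S -> (rank n S' < rank n S)%N.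
  case: S' => n' c /= En; rewrite /tsize /= in En; subst n' => h; apply: proper_card.
  apply/properP; split.
    by apply/fintype.subsetP => d; rewrite !inE => hd; exact: prec_trans hd h.
  by exists c; rewrite !inE ?prec_irr.
move En : (tsize T) => n; elim/ltn_ind: n T En => n ihn T Tn /andP[n0 nk].
move Er : (rank n T) => r; elim/ltn_ind: r T Tn Er => r ihr T Tn Er.
have prec_poly S : tsize S = n -> prec S T -> lyndon_polynomial (density S).
  by move=> Sn /(rank_lt _ _ _ Sn) h; apply: (ihr (rank n S)); rewrite // -Er.
have [n1|n1] := leqP n 1.
  apply: lyndon_polynomial_ext (lyndon_polynomial_const 1) => W tW.
  by rewrite density_vertex // Tn; apply/eqP; rewrite eqn_leq n1.
have [wL|wNL] := pselect (lyndon_word le (word T)).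
  by apply: lyndon_tourn_polynomial (wordP T) wL _; rewrite Tn n1.
have w0 : word T != [::].
  by apply/eqP => w0; move: n0; rewrite -Tn (wordP T) w0 tsize_word_tourn big_nil.
have [u [v [wE u0 v0 vmin]]] := non_lyndon_split le_refl le_anti le_tr le_total w0 wNL.
pose T1 := word_tourn u; pose T2 := word_tourn v.
have sT : (tsize T1 + tsize T2)%N = n.
  by rewrite -Tn (wordP T) wE !tsize_word_tourn big_cat.
have pos x : x != [::] -> (0 < tsize (word_tourn x))%N.
  case: x => // C x _; rewrite tsize_word_tourn big_cons.
  exact: leq_trans (letter_gt0 C) (leq_addr _ _).
have T1p : lyndon_polynomial (density T1).
  by apply: (ihn (tsize T1)) => //; have := pos v v0; have := pos u u0; rewrite -/T1 -/T2; lia.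
have T2p : lyndon_polynomial (density T2).
  by apply: (ihn (tsize T2)) => //; have := pos v v0; have := pos u u0; rewrite -/T1 -/T2; lia.
pose P X := @cross_tourn T1 T2 X == T.
have other X : ~~ P X -> lyndon_polynomial (density (cross_tourn X)).
  move=> /eqP XT; apply: prec_poly => //; rewrite /prec wE size_cat.
  have [szle sh] := @cross_tourn_shuffle T1 T2 X u v _ erefl erefl (wordP (cross_tourn X)).
  case: (ltngtP (size (word (cross_tourn X))) (size u + size v)) szle => //= /sh {}sh _.
  rewrite /lexlt (shuffle_max le_refl le_anti le_tr vmin sh) andbT.
  by apply/eqP => E; apply: XT; rewrite (wordP (cross_tourn X)) E -wE -wordP.
have P0 : P [ffun=> true] by rewrite /P (@cross_tourn_cat T1 T2 u v erefl erefl) -wE -wordP.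
pose c : R := #|P|%:R.
have c0 : c != 0 by rewrite pnatr_eq0 -lt0n; apply/card_gt0P; exists [ffun=> true].
apply: lyndon_polynomial_ext (lyndon_polynomialM (lyndon_polynomial_const c^-1)
  (lyndon_polynomialD (lyndon_polynomialM T1p T2p)
    (lyndon_polynomialM (lyndon_polynomial_const (-1)) (lyndon_polynomial_sum other)))).
move=> W tW; rewrite (density_mul _ _ tW) (bigID P) /= mulN1r addrK.
rewrite (eq_bigr (fun=> density T W)) => [|X /eqP -> //].
by rewrite sumr_const -[X in c^-1 * X]mulr_natl mulKf.
Qed.

End PolynomialDensities.

Theorem theorem2 (R : realType) (le : rel letter) (hle : letter_order le)
    (k : nat) (hk : (3 <= k)%N) :
  (exists x0 : {ffun lyndon_le le k -> R}, exists eps : R,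
     [/\ icube R (lyndon_le le k) x0,
         0 < eps,
         eball x0 eps `<=` icube R (lyndon_le le k)
       & forall x : {ffun lyndon_le le k -> R}, eball x0 eps x ->
           exists2 W : R * R -> R, tournamenton W &
             forall T : lyndon_le le k, density (tourn_of (val T)) W = x T])
  /\
  (exists f : tourn_le k -> multipoly R (lyndon_le le k),
     forall W : R * R -> R, tournamenton W ->
       forall T : tourn_le k,
         peval (f T) [ffun S : lyndon_le le k => density (tourn_of (val S)) W]
         = density (tourn_of T) W).

Proof.
split; first exact: lyndon_densities_open.
have [le_r le_a le_t le_o _] := hle.
have poly (T : tourn_le k) : @lyndon_polynomial R le k (density (tourn_of T)).
  by apply: density_lyndon_polynomial => //; rewrite /tourn_of /tsize /=.
have [f fP] := choice poly.
by exists f => W tW T; rewrite fP.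
Qed.
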